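(* Let $k$ be an algebraically closed field and let $(R,\mathfrak{m})$ be a commutative local complete Gorenstein $k$-algebra with $R/\mathfrak{m}\cong k$. Let $F'$ be a finitely generated $R$-module, $F=R\oplus F'$, $A=\mathrm{End}_R(F)$, and let $e\in A$ be the idempotent corresponding to the identity of the summand $R$. Assume that $A$ has finite global dimension and that $A/AeA$ is finite dimensional over $k$. Then the relative singularity category $\Delta_R(A)$ is Hom-finite over $k$.
   Context: $\mathrm{mod}\text{-}A$ denotes finitely generated right $A$-modules. Since $eAe\cong R$, the functor $-\otimes^L_{eAe}eA$ embeds $K^b(\mathrm{proj}\text{-}R)$ fully faithfully into $D^b(\mathrm{mod}\text{-}A)$ with image $\mathrm{thick}(eA)$ (the smallest triangulated subcategory containing $eA$ and closed under direct summands). The relative singularity category is the Verdier quotient $\Delta_R(A)=D^b(\mathrm{mod}\text{-}A)/K^b(\mathrm{proj}\text{-}R)\cong D^b(\mathrm{mod}\text{-}A)/\mathrm{thick}(eA)$. Hom-finite means that all morphism spaces are finite dimensional over $k$. *)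

(* Defs.v *)
From HB Require Import structures.
From mathcomp Require Import all_boot all_order all_algebra.
From mathcomp Require Import boolp classical_sets.
From mathcomp Require Import zify.

Set Implicit Arguments.
Unset Strict Implicit.
Unset Printing Implicit Defensive.

Import GRing.Theory.
Local Open Scope ring_scope.

(** * Modules *)

Definition zero_module (B : pzRingType) (M : lmodType B) : Prop :=
  forall x : M, x = 0.

Definition finitely_generated (B : pzRingType) (M : lmodType B) : Prop :=
  exists (n : nat) (v : 'I_n -> M),
    forall x, exists b : 'I_n -> B, x = \sum_i b i *: v i.

Definition injective_module (B : pzRingType) (I : lmodType B) : Prop :=
  forall (M N : lmodType B) (i : {linear M -> N}) (f : {linear M -> I}),
    injective i -> exists g : {linear N -> I}, forall x, g (i x) = f x.

Definition projective_module (B : pzRingType) (P : lmodType B) : Prop :=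
  forall (M N : lmodType B) (p : {linear M -> N}) (f : {linear P -> N}),
    (forall y, exists x, p x = y) ->
    exists g : {linear P -> M}, forall x, p (g x) = f x.

Definition injdim_le (B : pzRingType) (d : nat) (M : lmodType B) : Prop :=
  exists (I : nat -> lmodType B) (delta : forall n, {linear I n -> I n.+1})
         (eta : {linear M -> I 0%N}),
    [/\ forall n, injective_module (I n),
        forall n, (d < n)%N -> zero_module (I n),
        injective eta,
        forall x, delta 0%N x = 0 <-> exists y, x = eta y &
        forall n x, delta n.+1 x = 0 <-> exists y, x = delta n y].

Definition projdim_le (B : pzRingType) (d : nat) (M : lmodType B) : Prop :=
  exists (P : nat -> lmodType B) (delta : forall n, {linear P n.+1 -> P n})
         (eps : {linear P 0%N -> M}),
    [/\ forall n, projective_module (P n),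
        forall n, (d < n)%N -> zero_module (P n),
        forall y, exists x, eps x = y,
        forall x, eps x = 0 <-> exists y, x = delta 0%N y &
        forall n x, delta n x = 0 <-> exists y, x = delta n.+1 y].

(** Right [A]-modules are left modules over the converse ring [A^c]. *)
Definition finite_global_dimension (A : pzRingType) : Prop :=
  exists d : nat, forall M : lmodType A^c, projdim_le d M.

(** [dim_k (V / W)] is finite. *)
Definition finite_dim_quotient (k : pzRingType) (V : lmodType k) (W : set V) :
    Prop :=
  exists (n : nat) (v : 'I_n -> V),
    forall x, exists c : 'I_n -> k, W (x - \sum_i c i *: v i).

(** * Commutative algebra *)

Section CommutativeAlgebra.
Context (k : fieldType) (R : comAlgType k).
Implicit Types (I J m : set R).

Definition ideal I : Prop :=
  [/\ I 0, forall x y, I x -> I y -> I (x + y) & forall a x, I x -> I (a * x)].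

Definition maximal_ideal m : Prop :=
  [/\ ideal m, ~ m 1 & forall J, ideal J -> (m `<=` J)%classic ->
                       ~ J 1 -> J = m].

Definition local_ring m : Prop :=
  maximal_ideal m /\ forall m', maximal_ideal m' -> m' = m.

Definition ideal_mul I J : set R := [set x |
  exists (n : nat) (a b : 'I_n -> R),
    [/\ forall i, I (a i), forall i, J (b i) & x = \sum_i a i * b i]]%classic.

Fixpoint ideal_pow I (n : nat) : set R :=
  if n is n'.+1 then ideal_mul I (ideal_pow I n') else setT.

(** The canonical map from [R] to the inverse limit of the [R / m^n] is
    injective and surjective. *)
Definition adically_complete m : Prop :=
  (forall x, (forall n, ideal_pow m n x) -> x = 0) /\
  (forall u : nat -> R, (forall n, ideal_pow m n (u n.+1 - u n)) ->
     exists x, forall n, ideal_pow m n (x - u n)).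

Definition noetherian : Prop :=
  forall I, ideal I -> exists (n : nat) (v : 'I_n -> R),
    I = [set x | exists a : 'I_n -> R, x = \sum_i a i * v i]%classic.

(** For noetherian local rings; in general the condition is imposed on localizations. *)
Definition gorenstein : Prop := noetherian /\ exists d, injdim_le d R^o.

(** [R / m] is isomorphic to [k] as a [k]-algebra: there is a morphism of
    [k]-algebras [R -> k], necessarily surjective, with kernel [m]. *)
Definition residue_field_is_base m : Prop :=
  exists pi : {lrmorphism R -> k^o}, forall x, m x <-> pi x = 0.

End CommutativeAlgebra.

(** * Endomorphism algebras *)

Definition endo (k : fieldType) (R : comAlgType k) (F : lmodType R) : Type :=
  {linear F -> F}.

Section Endo.
Context (k : fieldType) (R : comAlgType k) (F : lmodType R).

Definition endo_fun (f : endo F) : {linear F -> F} := f.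

Lemma endo_ext (f g : endo F) : endo_fun f =1 endo_fun g -> f = g.
Proof.
rewrite /endo_fun; case: f g => [f cf] [g cg] /= /funext fg.
case: _ / fg in cg *; congr GRing.Linear.Pack.
case: cf cg => a b [a' b'].
have -> : a = a' by case: a a' => a [a']; congr GRing.isNmodMorphism.Axioms_.
by congr GRing.Linear.Class; case: b b' => b [b']; congr GRing.isScalable.Axioms_.
Qed.

HB.instance Definition _ := gen_eqMixin (endo F).
HB.instance Definition _ := gen_choiceMixin (endo F).

Definition endo_zero : endo F := [the {linear F -> F} of \0].
Definition endo_opp (f : endo F) : endo F :=
  [the {linear F -> F} of \- endo_fun f].
Definition endo_add (f g : endo F) : endo F :=
  [the {linear F -> F} of endo_fun f \+ endo_fun g].
Definition endo_one : endo F := [the {linear F -> F} of idfun].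
Definition endo_mul (f g : endo F) : endo F :=
  [the {linear F -> F} of endo_fun f \o endo_fun g].
Definition endo_scale (c : k) (f : endo F) : endo F :=
  [the {linear F -> F} of (c%:A : R) \*: endo_fun f].

Lemma endo_addA : associative endo_add.
Proof. by move=> f g h; apply: endo_ext => x /=; rewrite addrA. Qed.
Lemma endo_addC : commutative endo_add.
Proof. by move=> f g; apply: endo_ext => x /=; rewrite addrC. Qed.
Lemma endo_add0 : left_id endo_zero endo_add.
Proof. by move=> f; apply: endo_ext => x /=; rewrite add0r. Qed.
Lemma endo_addN : left_inverse endo_zero endo_opp endo_add.
Proof. by move=> f; apply: endo_ext => x /=; rewrite addNr. Qed.
HB.instance Definition _ :=
  GRing.isZmodule.Build (endo F) endo_addA endo_addC endo_add0 endo_addN.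

Lemma endo_mulA : associative endo_mul.
Proof. by move=> f g h; apply: endo_ext. Qed.
Lemma endo_mul1l : left_id endo_one endo_mul.
Proof. by move=> f; apply: endo_ext. Qed.
Lemma endo_mul1r : right_id endo_one endo_mul.
Proof. by move=> f; apply: endo_ext. Qed.
Lemma endo_mulDl : left_distributive endo_mul endo_add.
Proof. by move=> f g h; apply: endo_ext. Qed.
Lemma endo_mulDr : right_distributive endo_mul endo_add.
Proof. by move=> f g h; apply: endo_ext => x /=; rewrite linearD. Qed.
HB.instance Definition _ := GRing.Zmodule_isPzRing.Build (endo F)
  endo_mulA endo_mul1l endo_mul1r endo_mulDl endo_mulDr.

Lemma endo_scaleA a b f : endo_scale a (endo_scale b f) = endo_scale (a * b) f.
Proof.
by apply: endo_ext => x /=; rewrite scalerA -scalerAl mul1r scalerA.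
Qed.
Lemma endo_scale1 : left_id 1 endo_scale.
Proof. by move=> f; apply: endo_ext => x /=; rewrite !scale1r. Qed.
Lemma endo_scaleDr : right_distributive endo_scale +%R.
Proof. by move=> a f g; apply: endo_ext => x /=; rewrite scalerDr. Qed.
Lemma endo_scaleDl f : {morph endo_scale^~ f : a b / a + b}.
Proof. by move=> a b; apply: endo_ext => x /=; rewrite !scalerDl. Qed.
HB.instance Definition _ := GRing.Zmodule_isLmodule.Build k (endo F)
  endo_scaleA endo_scale1 endo_scaleDr endo_scaleDl.

End Endo.

(** The algebra [End_R (R (+) F')]. *)
Definition endR (k : fieldType) (R : comAlgType k) (F' : lmodType R) : Type :=
  endo (R^o * F')%type.

Section EndR.
Context (k : fieldType) (R : comAlgType k) (F' : lmodType R).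
Local Notation F := (R^o * F')%type.

HB.instance Definition _ := GRing.PzRing.on (endR F').
HB.instance Definition _ := GRing.Lmodule.on (endR F').

Lemma endR_oner_neq0 : (1 : endR F') != 0.
Proof.
apply/eqP => /(congr1 (fun f : endo F => (endo_fun f (1, 0)).1)) /= /eqP.
by rewrite oner_eq0.
Qed.
HB.instance Definition _ := GRing.PzSemiRing_isNonZero.Build (endR F') endR_oner_neq0.

Lemma endR_scaleAl (a : k) (f g : endR F') : a *: (f * g) = (a *: f) * g.
Proof. exact: endo_ext. Qed.
HB.instance Definition _ :=
  GRing.LSemiModule_isLSemiAlgebra.Build k (endR F') endR_scaleAl.

Lemma endR_scaleAr (a : k) (f g : endR F') : a *: (f * g) = f * (a *: g).
Proof.
by apply: endo_ext => x; rewrite /= -[LHS]linearZ.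
Qed.
HB.instance Definition _ :=
  GRing.LSemiAlgebra_isSemiAlgebra.Build k (endR F') endR_scaleAr.

Definition endR_idem_fun (x : F) : F := (x.1, 0).
Lemma endR_idem_linear : linear endR_idem_fun.
Proof.
by move=> a x y; rewrite /endR_idem_fun; congr pair; rewrite /= scaler0 addr0.
Qed.
HB.instance Definition _ :=
  GRing.isLinear.Build R F F *:%R endR_idem_fun endR_idem_linear.

(** The idempotent corresponding to the identity of the summand [R]. *)
Definition endR_idem : endR F' := [the {linear F -> F} of endR_idem_fun].

Lemma endR_idemE : endR_idem * endR_idem = endR_idem.
Proof. exact: endo_ext. Qed.

End EndR.

(** * Right modules *)

Section Converse.
Context (k : fieldType) (A : algType k).

Definition converse_scale (c : k) (x : A^c) : A^c := c *: (x : A).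
Lemma converse_scaleA a b x :
  converse_scale a (converse_scale b x) = converse_scale (a * b) x.
Proof. exact: (@scalerA _ A). Qed.
Lemma converse_scale1 : left_id 1 converse_scale.
Proof. exact: (@scale1r _ A). Qed.
Lemma converse_scaleDr : right_distributive converse_scale +%R.
Proof. exact: (@scalerDr _ A). Qed.
Lemma converse_scaleDl x : {morph converse_scale^~ x : a b / a + b}.
Proof. by move=> a b; exact: (@scalerDl _ A). Qed.
HB.instance Definition _ := GRing.Zmodule_isLmodule.Build k A^c
  converse_scaleA converse_scale1 converse_scaleDr converse_scaleDl.

Lemma converse_scaleAl (c : k) (x y : A^c) :
  c *: (x * y) = (c *: x : A^c) * y.
Proof. exact: (scalerAr c (y : A) (x : A)). Qed.
HB.instance Definition _ :=
  GRing.LSemiModule_isLSemiAlgebra.Build k A^c converse_scaleAl.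
Lemma converse_scaleAr (c : k) (x y : A^c) :
  c *: (x * y) = x * (c *: y : A^c).
Proof. exact: (scalerAl c (y : A) (x : A)). Qed.
HB.instance Definition _ :=
  GRing.LSemiAlgebra_isSemiAlgebra.Build k A^c converse_scaleAr.

End Converse.

Section RightIdeal.
Context (k : fieldType) (A : algType k) (e : A).

Definition right_ideal_pred : {pred A^c^o} :=
  fun x => `[< exists a : A, (x : A) = e * a >].

Lemma right_ideal_closed : submod_closed right_ideal_pred.
Proof.
split=> [|a x y /asboolP[b xE] /asboolP[c yE]]; apply/asboolP.
  by exists 0; rewrite mulr0.
exists (b * a + c : A); rewrite mulrDr mulrA -xE -yE.
by [].
Qed.
HB.instance Definition _ :=
  GRing.isSubmodClosed.Build A^c A^c^o right_ideal_pred right_ideal_closed.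

Record right_ideal : Type :=
  RightIdeal { right_ideal_val : A^c^o; _ : right_ideal_val \in right_ideal_pred }.
HB.instance Definition _ := [isSub for right_ideal_val].
HB.instance Definition _ := [Choice of right_ideal by <:].
HB.instance Definition _ := [SubChoice_isSubLmodule of right_ideal by <:].

Lemma right_ideal_fg : finitely_generated right_ideal.
Proof.
have eP : (e : A^c^o) \in right_ideal_pred.
  by apply/asboolP; exists 1; rewrite mulr1.
exists 1%N, (fun=> RightIdeal eP) => x.
have /asboolP[a xE] := valP x.
exists (fun=> a); rewrite big_ord1; apply: val_inj.
by rewrite /= xE.
Qed.

(** The two-sided ideal [A e A]. *)
Definition two_sided_ideal : set A := [set x |
  exists (n : nat) (a b : 'I_n -> A), x = \sum_i a i * e * b i]%classic.

End RightIdeal.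

(** * Linear categories and their localizations *)

(** A [k]-linear category whose morphism spaces are setoids: [heq] is the
    equality of morphisms, and [hcomp g f] is [g] after [f]. *)
Record linear_category (k : fieldType) := LinearCategory {
  object :> Type;
  hom : object -> object -> Type;
  heq : forall X Y, hom X Y -> hom X Y -> Prop;
  hid : forall X, hom X X;
  hcomp : forall X Y Z, hom Y Z -> hom X Y -> hom X Z;
  hzero : forall X Y, hom X Y;
  hadd : forall X Y, hom X Y -> hom X Y -> hom X Y;
  hscale : forall X Y, k -> hom X Y -> hom X Y;
  heq_refl : forall X Y (f : hom X Y), heq f f;
  heq_sym : forall X Y (f g : hom X Y), heq f g -> heq g f;
  heq_trans : forall X Y (f g h : hom X Y), heq f g -> heq g h -> heq f h;
  heq_comp : forall X Y Z (g g' : hom Y Z) (f f' : hom X Y),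
    heq g g' -> heq f f' -> heq (hcomp g f) (hcomp g' f');
  heq_add : forall X Y (f f' g g' : hom X Y),
    heq f f' -> heq g g' -> heq (hadd f g) (hadd f' g');
  heq_scale : forall X Y c (f f' : hom X Y),
    heq f f' -> heq (hscale c f) (hscale c f');
  hcomp_assoc : forall X Y Z W (h : hom Z W) (g : hom Y Z) (f : hom X Y),
    heq (hcomp h (hcomp g f)) (hcomp (hcomp h g) f);
  hcomp_idl : forall X Y (f : hom X Y), heq (hcomp (hid Y) f) f;
  hcomp_idr : forall X Y (f : hom X Y), heq (hcomp f (hid X)) f;
  hadd_assoc : forall X Y (f g h : hom X Y),
    heq (hadd f (hadd g h)) (hadd (hadd f g) h);
  hadd_comm : forall X Y (f g : hom X Y), heq (hadd f g) (hadd g f);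
  hadd_zero : forall X Y (f : hom X Y), heq (hadd (hzero X Y) f) f;
  hadd_opp : forall X Y (f : hom X Y),
    heq (hadd (hscale (-1) f) f) (hzero X Y);
  hscale_one : forall X Y (f : hom X Y), heq (hscale 1 f) f;
  hscale_mul : forall X Y a b (f : hom X Y),
    heq (hscale a (hscale b f)) (hscale (a * b) f);
  hscale_addl : forall X Y a b (f : hom X Y),
    heq (hscale (a + b) f) (hadd (hscale a f) (hscale b f));
  hscale_addr : forall X Y a (f g : hom X Y),
    heq (hscale a (hadd f g)) (hadd (hscale a f) (hscale a g));
  hcomp_addl : forall X Y Z (g g' : hom Y Z) (f : hom X Y),
    heq (hcomp (hadd g g') f) (hadd (hcomp g f) (hcomp g' f));
  hcomp_addr : forall X Y Z (g : hom Y Z) (f f' : hom X Y),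
    heq (hcomp g (hadd f f')) (hadd (hcomp g f) (hcomp g f'));
  hcomp_scalel : forall X Y Z c (g : hom Y Z) (f : hom X Y),
    heq (hcomp (hscale c g) f) (hscale c (hcomp g f));
  hcomp_scaler : forall X Y Z c (g : hom Y Z) (f : hom X Y),
    heq (hcomp g (hscale c f)) (hscale c (hcomp g f))
}.

Arguments hid {k l} X.
Arguments hzero {k l} X Y.

Notation "f =h g" := (heq f g) (at level 70, no associativity).
Notation "g \oh f" := (hcomp g f) (at level 50, left associativity).

Section LinearCategory.
Context (k : fieldType) (C : linear_category k).
Implicit Types X Y Z : C.

Definition hsum X Y (n : nat) (f : 'I_n -> hom X Y) : hom X Y :=
  \big[@hadd k C X Y/hzero X Y]_i f i.

Definition Hom_finite : Prop := forall X Y,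
  exists (n : nat) (f : 'I_n -> hom X Y),
    forall g : hom X Y, exists c : 'I_n -> k,
      g =h hsum (fun i => hscale (c i) (f i)).

Definition is_iso X Y (f : hom X Y) : Prop :=
  exists g : hom Y X, g \oh f =h hid X /\ f \oh g =h hid Y.

Definition isomorphic X Y : Prop := exists f : hom X Y, is_iso f.

Definition is_biproduct X Y Z : Prop :=
  exists (i : hom X Z) (j : hom Y Z) (p : hom Z X) (q : hom Z Y),
    [/\ p \oh i =h hid X, q \oh j =h hid Y, p \oh j =h hzero Y X,
        q \oh i =h hzero X Y & hadd (i \oh p) (j \oh q) =h hid Z].

End LinearCategory.

Record linear_functor (k : fieldType) (C D : linear_category k) :=
  LinearFunctor {
  fobj :> C -> D;
  fmap : forall X Y : C, hom X Y -> hom (fobj X) (fobj Y);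
  fmap_eq : forall (X Y : C) (f g : hom X Y), f =h g -> fmap f =h fmap g;
  fmap_id : forall X : C, fmap (hid X) =h hid (fobj X);
  fmap_comp : forall (X Y Z : C) (g : hom Y Z) (f : hom X Y),
    fmap (g \oh f) =h fmap g \oh fmap f;
  fmap_add : forall (X Y : C) (f g : hom X Y),
    fmap (hadd f g) =h hadd (fmap f) (fmap g);
  fmap_scale : forall (X Y : C) c (f : hom X Y),
    fmap (hscale c f) =h hscale c (fmap f)
}.

(** The localization [C[S^-1]]: the universal [k]-linear category under [C] in
    which the morphisms of [S] are invertible.  It has the objects of [C]; its
    morphisms are generated, under composition and linear combinations, by
    those of [C] and by formal inverses of those of [S], modulo the relations
    forced by the axioms.  When [S] admits a calculus of fractions (up to
    homotopy, for quasi-isomorphisms) the category of fractions is linear and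
    this is the same category. *)
Section Localization.
Context (k : fieldType) (C : linear_category k).
Context (S : forall X Y : C, hom X Y -> Prop).

Inductive fraction : C -> C -> Type :=
| Fof X Y : hom X Y -> fraction X Y
| Finv X Y (s : hom X Y) : S s -> fraction Y X
| Fcomp X Y Z : fraction Y Z -> fraction X Y -> fraction X Z
| Fadd X Y : fraction X Y -> fraction X Y -> fraction X Y
| Fscale X Y : k -> fraction X Y -> fraction X Y.

Local Notation Fid X := (Fof (hid X)).

Inductive fraction_eq : forall X Y, fraction X Y -> fraction X Y -> Prop :=
| Feq_refl X Y (f : fraction X Y) : fraction_eq f f
| Feq_sym X Y (f g : fraction X Y) : fraction_eq f g -> fraction_eq g f
| Feq_trans X Y (f g h : fraction X Y) :
    fraction_eq f g -> fraction_eq g h -> fraction_eq f h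
| Feq_comp X Y Z (g g' : fraction Y Z) (f f' : fraction X Y) :
    fraction_eq g g' -> fraction_eq f f' ->
    fraction_eq (Fcomp g f) (Fcomp g' f')
| Feq_add X Y (f f' g g' : fraction X Y) :
    fraction_eq f f' -> fraction_eq g g' -> fraction_eq (Fadd f g) (Fadd f' g')
| Feq_scale X Y c (f f' : fraction X Y) :
    fraction_eq f f' -> fraction_eq (Fscale c f) (Fscale c f')
| Fcomp_assoc X Y Z W (h : fraction Z W) (g : fraction Y Z) (f : fraction X Y) :
    fraction_eq (Fcomp h (Fcomp g f)) (Fcomp (Fcomp h g) f)
| Fcomp_idl X Y (f : fraction X Y) : fraction_eq (Fcomp (Fid Y) f) f
| Fcomp_idr X Y (f : fraction X Y) : fraction_eq (Fcomp f (Fid X)) f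
| Fadd_assoc X Y (f g h : fraction X Y) :
    fraction_eq (Fadd f (Fadd g h)) (Fadd (Fadd f g) h)
| Fadd_comm X Y (f g : fraction X Y) : fraction_eq (Fadd f g) (Fadd g f)
| Fadd_zero X Y (f : fraction X Y) : fraction_eq (Fadd (Fof (hzero X Y)) f) f
| Fadd_opp X Y (f : fraction X Y) :
    fraction_eq (Fadd (Fscale (-1) f) f) (Fof (hzero X Y))
| Fscale_one X Y (f : fraction X Y) : fraction_eq (Fscale 1 f) f
| Fscale_mul X Y a b (f : fraction X Y) :
    fraction_eq (Fscale a (Fscale b f)) (Fscale (a * b) f)
| Fscale_addl X Y a b (f : fraction X Y) :
    fraction_eq (Fscale (a + b) f) (Fadd (Fscale a f) (Fscale b f))
| Fscale_addr X Y a (f g : fraction X Y) :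
    fraction_eq (Fscale a (Fadd f g)) (Fadd (Fscale a f) (Fscale a g))
| Fcomp_addl X Y Z (g g' : fraction Y Z) (f : fraction X Y) :
    fraction_eq (Fcomp (Fadd g g') f) (Fadd (Fcomp g f) (Fcomp g' f))
| Fcomp_addr X Y Z (g : fraction Y Z) (f f' : fraction X Y) :
    fraction_eq (Fcomp g (Fadd f f')) (Fadd (Fcomp g f) (Fcomp g f'))
| Fcomp_scalel X Y Z c (g : fraction Y Z) (f : fraction X Y) :
    fraction_eq (Fcomp (Fscale c g) f) (Fscale c (Fcomp g f))
| Fcomp_scaler X Y Z c (g : fraction Y Z) (f : fraction X Y) :
    fraction_eq (Fcomp g (Fscale c f)) (Fscale c (Fcomp g f))
| Fof_eq X Y (f g : hom X Y) : f =h g -> fraction_eq (Fof f) (Fof g)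
| Fof_comp X Y Z (g : hom Y Z) (f : hom X Y) :
    fraction_eq (Fof (g \oh f)) (Fcomp (Fof g) (Fof f))
| Fof_add X Y (f g : hom X Y) :
    fraction_eq (Fof (hadd f g)) (Fadd (Fof f) (Fof g))
| Fof_scale X Y c (f : hom X Y) :
    fraction_eq (Fof (hscale c f)) (Fscale c (Fof f))
| Finv_l X Y (s : hom X Y) (Ss : S s) :
    fraction_eq (Fcomp (Finv Ss) (Fof s)) (Fid X)
| Finv_r X Y (s : hom X Y) (Ss : S s) :
    fraction_eq (Fcomp (Fof s) (Finv Ss)) (Fid Y).

Definition localization : linear_category k :=
  @LinearCategory k C fraction fraction_eq (fun X => Fid X) Fcomp
    (fun X Y => Fof (hzero X Y)) Fadd Fscale
    Feq_refl Feq_sym Feq_trans Feq_comp Feq_add Feq_scale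
    Fcomp_assoc Fcomp_idl Fcomp_idr Fadd_assoc Fadd_comm Fadd_zero Fadd_opp
    Fscale_one Fscale_mul Fscale_addl Fscale_addr
    Fcomp_addl Fcomp_addr Fcomp_scalel Fcomp_scaler.

Definition loc_functor : linear_functor C localization :=
  @LinearFunctor k C localization id Fof Fof_eq
    (fun X => Feq_refl (Fid X)) Fof_comp Fof_add Fof_scale.

End Localization.

Section FunctorTheory.
Context (k : fieldType) (C D E : linear_category k).

Lemma fmap_zero (T : linear_functor C D) (X Y : C) :
  fmap T (hzero X Y) =h hzero (T X) (T Y).
Proof.
set z := hzero X Y; set z' := hzero (T X) (T Y).
have e : hadd (hscale (-1) z) z =h z by apply: hadd_opp.
apply: heq_trans (heq_sym (fmap_eq T e)) _.
apply: heq_trans (fmap_add _ _ _) _.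
apply: heq_trans (heq_add (fmap_scale _ _ _) (heq_refl _)) _.
exact: hadd_opp.
Qed.

Definition functor_comp (U : linear_functor D E) (T : linear_functor C D) :
  linear_functor C E.
Proof.
exists (fun X => U (T X)) (fun X Y f => fmap U (fmap T f)).
- by move=> X Y f g fg; do 2!apply: fmap_eq.
- by move=> X; apply: heq_trans (fmap_eq U (fmap_id T X)) (fmap_id U _).
- by move=> X Y Z g f; apply: heq_trans (fmap_eq U (fmap_comp T g f)) (fmap_comp U _ _).
- by move=> X Y f g; apply: heq_trans (fmap_eq U (fmap_add T f g)) (fmap_add U _ _).
- by move=> X Y c f; apply: heq_trans (fmap_eq U (fmap_scale T c f)) (fmap_scale U _ _).
Defined.

End FunctorTheory.

(** The universal property: a linear functor inverting [S] extends to
    [C[S^-1]]. *)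
Section LocalizationLift.
Context (k : fieldType) (C D : linear_category k).
Context (S : forall X Y : C, hom X Y -> Prop) (T : linear_functor C D).
Context (inv : forall (X Y : C) (s : hom X Y), S s -> hom (T Y) (T X)).
Context (inv_l : forall (X Y : C) (s : hom X Y) (Ss : S s),
           inv Ss \oh fmap T s =h hid (T X)).
Context (inv_r : forall (X Y : C) (s : hom X Y) (Ss : S s),
           fmap T s \oh inv Ss =h hid (T Y)).

Fixpoint lift_fmap (X Y : C) (f : fraction S X Y) : hom (T X) (T Y) :=
  match f in fraction _ X Y return hom (T X) (T Y) with
  | Fof _ _ f => fmap T f
  | Finv _ _ _ Ss => inv Ss
  | Fcomp _ _ _ g f => lift_fmap g \oh lift_fmap f
  | Fadd _ _ f g => hadd (lift_fmap f) (lift_fmap g)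
  | Fscale _ _ c f => hscale c (lift_fmap f)
  end.

Lemma lift_fmap_eq (X Y : C) (f g : fraction S X Y) :
  fraction_eq f g -> lift_fmap f =h lift_fmap g.
Proof.
elim=> {X Y f g} /=.
- by move=> *; apply: heq_refl.
- by move=> *; apply: heq_sym.
- by move=> X Y f g h _ + _; apply: heq_trans.
- by move=> *; apply: heq_comp.
- by move=> *; apply: heq_add.
- by move=> *; apply: heq_scale.
- by move=> *; apply: hcomp_assoc.
- move=> X Y f.
  exact: heq_trans (heq_comp (fmap_id T Y) (heq_refl _)) (hcomp_idl _).
- move=> X Y f.
  exact: heq_trans (heq_comp (heq_refl _) (fmap_id T X)) (hcomp_idr _).
- by move=> *; apply: hadd_assoc.
- by move=> *; apply: hadd_comm.
- move=> X Y f.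
  exact: heq_trans (heq_add (fmap_zero T X Y) (heq_refl _)) (hadd_zero _).
- move=> X Y f.
  exact: heq_trans (hadd_opp _) (heq_sym (fmap_zero T X Y)).
- by move=> *; apply: hscale_one.
- by move=> *; apply: hscale_mul.
- by move=> *; apply: hscale_addl.
- by move=> *; apply: hscale_addr.
- by move=> *; apply: hcomp_addl.
- by move=> *; apply: hcomp_addr.
- by move=> *; apply: hcomp_scalel.
- by move=> *; apply: hcomp_scaler.
- by move=> *; apply: fmap_eq.
- by move=> *; apply: fmap_comp.
- by move=> *; apply: fmap_add.
- by move=> *; apply: fmap_scale.
- move=> X Y s Ss; exact: heq_trans (inv_l Ss) (heq_sym (fmap_id T X)).
- move=> X Y s Ss; exact: heq_trans (inv_r Ss) (heq_sym (fmap_id T Y)).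
Qed.

Definition loc_lift : linear_functor (localization S) D :=
  @LinearFunctor k (localization S) D (fobj T) lift_fmap lift_fmap_eq
    (fmap_id T)
    (fun X Y Z g f => heq_refl (lift_fmap g \oh lift_fmap f))
    (fun X Y f g => heq_refl (hadd (lift_fmap f) (lift_fmap g)))
    (fun X Y c f => heq_refl (hscale c (lift_fmap f))).

End LocalizationLift.

(** The functor induced on localizations by a functor mapping [S] to [S']. *)
Definition loc_map (k : fieldType) (C D : linear_category k)
    (S : forall X Y : C, hom X Y -> Prop)
    (S' : forall X Y : D, hom X Y -> Prop) (T : linear_functor C D)
    (TS : forall (X Y : C) (s : hom X Y), S X Y s -> S' _ _ (fmap T s)) :
    linear_functor (localization S) (localization S') :=
  @loc_lift k C (localization S') S (functor_comp (loc_functor S') T)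
    (fun X Y s Ss => Finv (TS X Y s Ss))
    (fun X Y s Ss => Finv_l (TS X Y s Ss))
    (fun X Y s Ss => Finv_r (TS X Y s Ss)).

(** * Triangles, thick subcategories and Verdier quotients *)

(** The data (without the axioms) of a [k]-linear triangulated category. *)
Record triangulated_data (k : fieldType) := TriangulatedData {
  tri_cat :> linear_category k;
  shift : linear_functor tri_cat tri_cat;
  distinguished : forall X Y Z : tri_cat,
    hom X Y -> hom Y Z -> hom Z (shift X) -> Prop
}.

Section Verdier.
Context (k : fieldType) (D : triangulated_data k).
Implicit Types (N : D -> Prop) (X Y Z : D).

(** Full triangulated subcategories, closed under isomorphism and given by
    their objects. *)
Definition triangulated_subcategory N : Prop :=
  [/\ forall X Y, isomorphic X Y -> N X -> N Y,
      forall X, N X <-> N (shift D X) &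
      forall X Y Z (u : hom X Y) (v : hom Y Z) (w : hom Z (shift D X)),
        distinguished u v w -> N X -> N Y -> N Z].

Definition thick_subcategory N : Prop :=
  triangulated_subcategory N /\
  forall X Y Z, is_biproduct X Y Z -> N Z -> N X.

(** The smallest thick subcategory containing [T]. *)
Definition thick (T : D) : D -> Prop :=
  fun X => forall N, thick_subcategory N -> N T -> N X.

Definition cone_in N X Y (u : hom X Y) : Prop :=
  exists Z (v : hom Y Z) (w : hom Z (shift D X)),
    distinguished u v w /\ N Z.

Definition verdier_quotient N : linear_category k := localization (cone_in N).

End Verdier.

(** * Bounded complexes of finitely generated modules *)

Section Complexes.
Context (k : fieldType) (B : algType k).

(** Cohomological grading. *)
Record complex := Complex {
  cobj :> int -> lmodType B;
  cdiff : forall i, {linear cobj i -> cobj (i + 1)};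
  cdiff_cdiff : forall i x, cdiff (i + 1) (cdiff i x) = 0;
  cobj_fg : forall i, finitely_generated (cobj i);
  cobj_bounded :
    exists n : nat, forall i : int, (n < `|i|)%N -> zero_module (cobj i)
}.

Record chain_map (X Y : complex) := ChainMap {
  cmap :> forall i, {linear X i -> Y i};
  cmap_cdiff : forall i x, cmap (i + 1) (cdiff X i x) = cdiff Y i (cmap i x)
}.

Section AlgebraScale.
Context (M N : lmodType B) (c : k) (f : {linear M -> N}).
Definition alg_scale (x : M) : N := (c%:A : B) *: f x.
Lemma alg_scale_linear : linear alg_scale.
Proof.
move=> b x y; rewrite /alg_scale linearP scalerDr !scalerA.
by rewrite mulr_algl mulr_algr.
Qed.
HB.instance Definition _ := GRing.isLinear.Build B M N *:%R alg_scale alg_scale_linear.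
End AlgebraScale.

Section ChainMaps.
Context (X Y Z : complex).

Definition chain_eq (f g : chain_map X Y) : Prop := forall i x, f i x = g i x.

Definition chain_id : chain_map X X.
Proof. by exists (fun i => [the {linear X i -> X i} of idfun]). Defined.

Definition chain_comp (g : chain_map Y Z) (f : chain_map X Y) : chain_map X Z.
Proof.
exists (fun i => [the {linear X i -> Z i} of g i \o f i]) => i x /=.
by rewrite !cmap_cdiff.
Defined.

Definition chain_zero : chain_map X Y.
Proof.
by exists (fun i => [the {linear X i -> Y i} of \0]) => i x /=; rewrite linear0.
Defined.

Definition chain_add (f g : chain_map X Y) : chain_map X Y.
Proof.
exists (fun i => [the {linear X i -> Y i} of f i \+ g i]) => i x /=.
by rewrite linearD !cmap_cdiff.
Defined.

Definition chain_scale (c : k) (f : chain_map X Y) : chain_map X Y.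
Proof.
exists (fun i => [the {linear X i -> Y i} of alg_scale c (f i)]) => i x /=.
by rewrite /alg_scale linearZ /= cmap_cdiff.
Defined.

End ChainMaps.

Definition complexes : linear_category k.
Proof.
apply: (@LinearCategory k complex chain_map chain_eq chain_id chain_comp
  chain_zero chain_add chain_scale) => //.
- by move=> X Y f g fg i x; rewrite fg.
- by move=> X Y f g h fg gh i x; rewrite fg gh.
- by move=> X Y Z g g' f f' gg ff i x /=; rewrite ff gg.
- by move=> X Y f f' g g' ff gg i x /=; rewrite ff gg.
- by move=> X Y c f f' ff i x /=; rewrite /alg_scale ff.
- by move=> X Y f g h i x /=; rewrite addrA.
- by move=> X Y f g i x /=; rewrite addrC.
- by move=> X Y f i x /=; rewrite add0r.
- by move=> X Y f i x /=; rewrite /alg_scale !scaleN1r addNr.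
- by move=> X Y f i x /=; rewrite /alg_scale !scale1r.
- move=> X Y a b f i x /=; rewrite /alg_scale scalerA.
  by rewrite -scalerAl mul1r scalerA.
- by move=> X Y a b f i x /=; rewrite /alg_scale !scalerDl.
- by move=> X Y a f g i x /=; rewrite /alg_scale scalerDr.
- by move=> X Y Z g f f' i x /=; rewrite linearD.
- by move=> X Y Z c g f i x /=; rewrite /alg_scale linearZ.
Defined.

(** Injectivity and surjectivity in cohomology, in degree [i + 1]. *)
Definition quasi_isomorphism (X Y : complexes) (f : hom X Y) : Prop :=
  forall i : int,
    (forall x : X (i + 1), cdiff X (i + 1) x = 0 ->
       (exists y, f (i + 1) x = cdiff Y i y) -> exists x', x = cdiff X i x') /\
    (forall y : Y (i + 1), cdiff Y (i + 1) y = 0 ->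
       exists x y', cdiff X (i + 1) x = 0 /\ y = f (i + 1) x + cdiff Y i y').

Section Shift.
Context (X : complex) (i : int).
Definition shift_diff (x : X (i + 1)) : X (i + 1 + 1) := - cdiff X (i + 1) x.
Lemma shift_diff_linear : linear shift_diff.
Proof. by move=> b x y; rewrite /shift_diff linearP opprD scalerN. Qed.
HB.instance Definition _ :=
  GRing.isLinear.Build B (X (i + 1)) (X (i + 1 + 1)) *:%R
    shift_diff shift_diff_linear.
End Shift.

Lemma shift_bounded (X : complex) :
  exists n : nat, forall i : int, (n < `|i|)%N -> zero_module (X (i + 1)).
Proof.
have [n X0] := cobj_bounded X; exists n.+1 => i ni; apply: X0.
by case: i ni => [] [] //= m; lia.
Qed.

(** [X[1]^i = X^(i+1)], with differential [- d]. *)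
Definition complex_shift (X : complex) : complex.
Proof.
apply: (@Complex (fun i => X (i + 1))
  (fun i => [the {linear X (i + 1) -> X (i + 1 + 1)} of @shift_diff X i])).
- by move=> i x; rewrite /= /shift_diff linearN /= cdiff_cdiff !oppr0.
- by move=> i; apply: cobj_fg.
- exact: shift_bounded.
Defined.

Definition chain_shift (X Y : complex) (f : chain_map X Y) :
  chain_map (complex_shift X) (complex_shift Y).
Proof.
exists (fun i => f (i + 1)) => i x /=.
by rewrite /shift_diff linearN cmap_cdiff.
Defined.

Definition complexes_shift : linear_functor complexes complexes.
Proof.
by exists complex_shift chain_shift => //= X Y f g fg i x; apply: fg.
Defined.

Lemma quasi_isomorphism_shift (X Y : complexes) (f : hom X Y) :
  quasi_isomorphism f -> quasi_isomorphism (fmap complexes_shift f).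
Proof.
move=> qf i; have [finj fsurj] := qf (i + 1); split=> /= [x|y].
  move/eqP; rewrite oppr_eq0 => /eqP dx [y fxE].
  have [|x' ->] := finj x dx.
    by exists (- y); rewrite linearN.
  by exists (- x'); rewrite /shift_diff linearN opprK.
move/eqP; rewrite oppr_eq0 => /eqP dy.
have [x [y' [dx ->]]] := fsurj y dy.
exists x, (- y'); rewrite /shift_diff dx oppr0; split=> //.
by rewrite linearN opprK.
Qed.

Section Cone.
Context (X Y : complex) (f : chain_map X Y).
Definition cone_obj (i : int) : lmodType B :=
  [the lmodType B of (X (i + 1)%R * Y i)%type].

Definition cone_diff (i : int) (u : cone_obj i) : cone_obj (i + 1) :=
  (- cdiff X (i + 1) u.1, f (i + 1) u.1 + cdiff Y i u.2).
Lemma cone_diff_linear i : linear (@cone_diff i).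
Proof.
move=> b u v; rewrite /cone_diff /=; congr pair; rewrite /= !linearP.
  by [].
by rewrite scalerDr addrACA.
Qed.
HB.instance Definition _ i :=
  GRing.isLinear.Build B (cone_obj i) (cone_obj (i + 1)) *:%R
    (@cone_diff i) (@cone_diff_linear i).

Lemma cone_fg i : finitely_generated (cone_obj i).
Proof.
have [m [v vP]] := cobj_fg X (i + 1); have [n [w wP]] := cobj_fg Y i.
exists (m + n)%N, (fun j => match split j with
                           | inl j => (v j, 0) | inr j => (0, w j) end).
move=> [x y]; have [a ->] := vP x; have [b ->] := wP y.
exists (fun j => match split j with inl j => a j | inr j => b j end).
rewrite big_split_ord /=.
have splitl j : split (lshift n j) = inl j := unsplitK (inl j).
have splitr j : split (rshift m j) = inr j := unsplitK (inr j).
under [X in _ = X + _]eq_bigr => j _ do rewrite splitl.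
under [X in _ = _ + X]eq_bigr => j _ do rewrite splitr.
have fstS I r (P : pred I) (G : I -> cone_obj i) :
    (\sum_(j <- r | P j) G j).1 = \sum_(j <- r | P j) (G j).1.
  exact: (big_morph (fun u : cone_obj i => u.1)).
have sndS I r (P : pred I) (G : I -> cone_obj i) :
    (\sum_(j <- r | P j) G j).2 = \sum_(j <- r | P j) (G j).2.
  exact: (big_morph (fun u : cone_obj i => u.2)).
apply/pair_equal_spec; split; rewrite /= ?fstS ?sndS.
  by rewrite [X in _ = _ + X]big1 ?addr0 // => j _; rewrite /= scaler0.
by rewrite [X in _ = X + _]big1 ?add0r // => j _; rewrite /= scaler0.
Qed.

(** [Cone(f)^i = X^(i+1) (+) Y^i], with differential
    [(x, y) |-> (- d x, f x + d y)]. *)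
Definition cone : complex.
Proof.
apply: (@Complex cone_obj
  (fun i => [the {linear cone_obj i -> cone_obj (i + 1)} of @cone_diff i])).
- move=> i [x y]; rewrite /= /cone_diff /=; congr pair.
    by rewrite linearN cdiff_cdiff !oppr0.
  by rewrite linearN linearD cmap_cdiff cdiff_cdiff addr0 addNr.
- exact: cone_fg.
- have [m X0] := shift_bounded X; have [n Y0] := cobj_bounded Y.
  exists (maxn m n) => i; rewrite gtn_max => /andP[mi ni] [x y].
  by rewrite (X0 i mi x) (Y0 i ni y).
Defined.

Definition cone_in_fun (i : int) (y : Y i) : cone_obj i := (0, y).
Lemma cone_in_linear i : linear (@cone_in_fun i).
Proof.
by move=> b u v; rewrite /cone_in_fun; congr pair; rewrite /= scaler0 addr0.
Qed.
HB.instance Definition _ i :=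
  GRing.isLinear.Build B (Y i) (cone_obj i) *:%R (@cone_in_fun i) (@cone_in_linear i).

Definition cone_incl : chain_map Y cone.
Proof.
exists (fun i => [the {linear Y i -> cone_obj i} of @cone_in_fun i]) => i y.
rewrite /= /cone_in_fun /cone_diff /=; congr pair; rewrite /= !linear0.
  by rewrite ?oppr0.
by rewrite add0r.
Defined.

Definition cone_proj : chain_map cone (complex_shift X).
Proof. by exists (fun i => [the {linear cone_obj i -> X (i + 1)} of fst]). Defined.

End Cone.

Section Stalk.
Context (M : lmodType B) (Mfg : finitely_generated M).

Definition stalk_obj (i : int) : lmodType B :=
  if i == 0 then M else [the lmodType B of 'rV[B]_0].

(** The module [M] as a complex concentrated in degree 0. *)
Definition stalk : complex.
Proof.
apply: (@Complex stalk_obj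
  (fun i => [the {linear stalk_obj i -> stalk_obj (i + 1)} of \0])) => //.
- move=> i; rewrite /stalk_obj; case: ifP => // _.
  exists 0%N, (fun=> 0) => x; exists (fun=> 0).
  by rewrite big_ord0; apply/rowP=> -[].
- exists 0%N => -[[|n]|n] //= _ x; by apply/rowP=> -[].
Defined.

End Stalk.

(** * The bounded derived category *)

Definition derived_category : linear_category k :=
  localization quasi_isomorphism.

Definition derived_shift : linear_functor derived_category derived_category :=
  loc_map quasi_isomorphism_shift.

Local Notation Q := (fmap (loc_functor quasi_isomorphism)).

(** Triangles isomorphic to the standard triangle
    [X' -> Y' -> Cone(f) -> X'[1]] of a chain map [f]. *)
Definition derived_distinguished (X Y Z : derived_category)
    (u : hom X Y) (v : hom Y Z) (w : hom Z (derived_shift X)) : Prop :=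
  exists (X' Y' : complexes) (f : hom X' Y') (a : @hom k derived_category X X')
      (b : @hom k derived_category Y Y')
      (c : @hom k derived_category Z (cone f)),
    [/\ is_iso a, is_iso b & is_iso c] /\
    [/\ b \oh u =h Q f \oh a,
        c \oh v =h Q (cone_incl f : @hom k complexes _ _) \oh b &
        fmap derived_shift a \oh w =h
          Q (cone_proj f : @hom k complexes _ (complex_shift X')) \oh c].

Definition Db : triangulated_data k :=
  @TriangulatedData k derived_category derived_shift derived_distinguished.

End Complexes.

(** The relative singularity category [D^b(mod-A) / thick(eA)]. *)
Definition relative_singularity_category (k : fieldType) (A : algType k) (e : A) :
    linear_category k :=
  @verdier_quotient k (Db A^c) (thick (stalk (right_ideal_fg e) : Db A^c)).

(* Main.v *)
From HB Require Import structures.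
From Stdlib Require Import Setoid Morphisms.
From mathcomp Require Import all_boot all_order all_algebra.
From mathcomp Require Import boolp classical_sets.
From mathcomp Require Import zify.
Require Import Defs.

Set Implicit Arguments.
Unset Strict Implicit.
Unset Printing Implicit Defensive.

Import GRing.Theory.
Local Open Scope ring_scope.

(** Every object is isomorphic to a bounded complex [P] of finitely generated
    projectives, because [A] is noetherian of finite global dimension.  Say that
    [P' -> P] is a denominator if [P'] arises from [P] by finitely many twisted
    extensions by shifts [eA[-j]] with [j >= c], where [P] lives in degrees at
    least [c].  The objects all of whose maps from perfect complexes are killed
    by denominators form a thick subcategory containing [eA]; hence every
    morphism [P -> Y] of the quotient is a fraction [f s^-1] with [s] a
    denominator.  Attaching cells [eA[-j]] to [Y] yields an isomorphic object of
    the quotient with [H^i(Y) e = 0] for [i >= c]; for such [Y] maps factor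
    through denominators up to homotopy, so every morphism [P -> Y] of the
    quotient comes from a chain map.  Moreover [H^i(Y)] is then a finitely
    generated [A / AeA]-module, hence finite dimensional, for [i >= c], and so is
    the space of homotopy classes [P -> Y], by induction on the degrees of [P]. *)

(** * Modules *)

(** Both localizations are formal, by generators and relations, so no calculus of fractions comes
    with them. Equality of words is detected by extending $K(P,-)$ to the derived category;
    representing a morphism by a chain map or by a fraction is an induction on words, so the class
    of fractions must be stable under composition with formal inverses. The bound $c$ answers a
    finiteness obstacle. A cell attached to kill a class of $H^{i+1}(Y)e$ enters the new complex in
    degree $i$ and may create cohomology there, so the process need not stop by itself. Since a map
    from $P$ to a shift of $eA$ in a degree below $c$ is zero, cells in degrees at least $c$ suffice
    for denominators, and $Y$ has to be corrected in finitely many degrees only. Right modules are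
    left modules over [A^c]. There $eA$ is generated by one element [eps] with $e\epsilon=\epsilon$,
    and $\mathrm{Hom}(eA,M)=Me$ is the set of $x$ with $ex=x$; all uses of $eA$ rest on this
    description. *)

Section Linear.
Context (B : pzRingType).
Implicit Types M N : lmodType B.

Definition lin M N (f : M -> N) (fL : linear f) : {linear M -> N} :=
  HB.pack f (GRing.isLinear.Build B M N *:%R f fL).

End Linear.

Section Submodule.
Context (B : pzRingType) (M : lmodType B) (S : set M).

Definition submodule : Prop :=
  S 0 /\ forall b x y, S x -> S y -> S (b *: x + y).

Hypothesis S_sub : submodule.

Definition sub_pred : {pred M} := fun x => `[< S x >].
Lemma sub_pred_closed : submod_closed sub_pred.
Proof.
case: S_sub => S0 SP; split; first exact/asboolP.
by move=> b x y /asboolP Sx /asboolP Sy; apply/asboolP/SP.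
Qed.
HB.instance Definition _ := GRing.isSubmodClosed.Build B M sub_pred sub_pred_closed.

Record sub_type : Type := SubType { sub_val : M; _ : sub_val \in sub_pred }.
HB.instance Definition _ := [isSub for sub_val].
HB.instance Definition _ := [Choice of sub_type by <:].
HB.instance Definition _ := [SubChoice_isSubLmodule of sub_type by <:].

Definition sub_module : lmodType B := [the lmodType B of sub_type].
Definition sub_incl : {linear sub_module -> M} :=
  [the {linear sub_type -> M} of val].

End Submodule.

(** The existential form hides the subtype: later arguments only use an injection with prescribed
    image. *)
Lemma submoduleP (B : pzRingType) (M : lmodType B) (S : set M) :
  submodule S -> exists (K : lmodType B) (i : {linear K -> M}),
    injective i /\ forall x, S x <-> exists y, x = i y.
Proof.
move=> S_sub; exists (sub_module S_sub), (sub_incl S_sub); split.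
  exact: val_inj.
move=> x; split=> [Sx|[y ->]]; last exact/asboolP/(valP y).
have xS : x \in sub_pred S by apply/asboolP.
by exists (SubType xS).
Qed.


Section Modules.
Context (B : pzRingType).
Implicit Types M N P : lmodType B.

Lemma sub_range M N (p : {linear M -> N}) : submodule [set y | exists x, p x = y]%classic.
Proof.
split=> [|b _ _ [x <-] [y <-]]; first by exists 0; rewrite linear0.
by exists (b *: x + y); rewrite linearP.
Qed.

Lemma sub_ker M N (p : {linear M -> N}) : submodule [set x | p x = 0]%classic.
Proof.
split=> [|b x y /= px py]; first by rewrite /= linear0.
by rewrite linearP px py scaler0 addr0.
Qed.

Lemma factor_inj M N P (i : {linear N -> M}) (f : {linear P -> M}) :
  injective i -> (forall x, exists y, f x = i y) ->
  exists g : {linear P -> N}, forall x, i (g x) = f x.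
Proof.
move=> i_inj fi; pose g x := projT1 (cid (fi x)).
have gP x : i (g x) = f x by rewrite -(projT2 (cid (fi x))).
have gL : linear g by move=> b x y; apply: i_inj; rewrite linearP !gP linearP.
by exists (lin gL).
Qed.

(** Surjectivity onto the image of [f] is enough: corestrict both maps to the image of [p] and use
    projectivity there. *)
Lemma projective_lift P M N (p : {linear M -> N}) (f : {linear P -> N}) :
  projective_module P -> (forall x, exists y, p y = f x) ->
  exists g : {linear P -> M}, forall x, p (g x) = f x.
Proof.
move=> P_proj fp; have [K [i [i_inj iP]]] := submoduleP (sub_range p).
have [p' p'E] : exists p' : {linear M -> K}, forall x, i (p' x) = p x.
  by apply: factor_inj => // x; apply/iP; exists x.
have [f' f'E] : exists f' : {linear P -> K}, forall x, i (f' x) = f x.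
  by apply: factor_inj => // x; apply/iP; apply: fp.
have p'_surj y : exists x, p' x = y.
  have /iP[x px] : exists y', i y = i y' by exists y.
  by exists x; apply: i_inj; rewrite p'E.
have [g gE] := P_proj _ _ p' f' p'_surj.
by exists g => x; rewrite -p'E gE f'E.
Qed.

Lemma zero_projective P : zero_module P -> projective_module P.
Proof.
move=> P0 M N p f _; have zL : linear (fun _ : P => 0 : M).
  by move=> b x y; rewrite scaler0 addr0.
by exists (lin zL) => x; rewrite /= linear0 (P0 x) linear0.
Qed.

Lemma prod_projective (P Q : lmodType B) :
  projective_module P -> projective_module Q ->
  projective_module (P * Q)%type.
Proof.
move=> P_proj Q_proj M N p f p_surj.
have lP : linear (fun x : P => f (x, 0)).
  move=> b x y; rewrite -linearP; congr (f _); congr pair.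
  by rewrite /= scaler0 addr0.
have lQ : linear (fun x : Q => f (0, x)).
  move=> b x y; rewrite -linearP; congr (f _); congr pair.
  by rewrite /= scaler0 addr0.
have [g gE] := P_proj _ _ p (lin lP) p_surj.
have [h hE] := Q_proj _ _ p (lin lQ) p_surj.
have kL : linear (fun x : P * Q => g x.1 + h x.2).
  by move=> b x y; rewrite /= !linearP scalerDr addrACA.
exists (lin kL) => -[x y]; rewrite /= linearD gE hE /= -linearD.
by congr (f _); congr pair; rewrite /= ?addr0 ?add0r.
Qed.

Definition module_iso M N : Prop :=
  exists (f : {linear M -> N}) (g : {linear N -> M}), cancel f g /\ cancel g f.

Lemma module_iso_sym M N : module_iso M N -> module_iso N M.
Proof. by move=> [f [g [fg gf]]]; exists g, f. Qed.

Lemma module_iso_trans M N P : module_iso M N -> module_iso N P -> module_iso M P.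
Proof.
move=> [f [g [fg gf]]] [f' [g' [fg' gf']]].
exists [the {linear M -> P} of f' \o f], [the {linear P -> M} of g \o g'].
by split=> x /=; rewrite ?fg' ?fg ?gf ?gf'.
Qed.

Lemma iso_projective M N :
  module_iso M N -> projective_module M -> projective_module N.
Proof.
move=> [i [j [ij ji]]] M_proj M' N' p f p_surj.
have [g gE] := M_proj _ _ p [the {linear M -> N'} of f \o i] p_surj.
exists [the {linear N -> M'} of g \o j] => x /=.
by rewrite gE /= ji.
Qed.

Lemma zero_iso M N : zero_module M -> zero_module N -> module_iso M N.
Proof.
move=> M0 N0; exists [the {linear M -> N} of \0], [the {linear N -> M} of \0].
by split=> x /=; rewrite ?(M0 x) ?(N0 x).
Qed.

End Modules.

(** * Families over the integers, given at successors *)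

Section Reindexing.

Lemma int_succ_ind (Q : int -> Prop) : (forall i, Q (i + 1)) -> forall i, Q i.
Proof. by move=> QS i; rewrite -[i](subrK 1); apply: QS. Qed.

(** Maps and homotopies are naturally produced in degree $i+1$, and [T (i - 1 + 1)] is not
    convertible to [T i]. Confining the transport to this lemma keeps it out of the later
    computations. *)
Lemma reindex_family (T : int -> Type) (h : forall i, T (i + 1)) :
  exists g : forall i, T i, forall i, g (i + 1) = h i.
Proof.
exists (fun i => eq_rect _ T (h (i - 1)) _ (subrK 1 i)) => i.
(* Once the equality proof is generalized, $i+1-1$ can be replaced by $i$; the proof that remains is
   reflexivity, as [int] has decidable equality. *)
move: (subrK 1 (i + 1)); rewrite /= => e.
have e' : i + 1 - 1 = i by rewrite addrK.
move: e; rewrite e' => e; by rewrite (eq_irrelevance e erefl).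
Qed.

Lemma dep_choice (I : Type) (T : I -> Type) (Q : forall i, T i -> Prop) :
  (forall i, exists x, Q i x) -> exists f : forall i, T i, forall i, Q i (f i).
Proof.
by move=> H; exists (fun i => projT1 (cid (H i))) => i; apply: (projT2 (cid (H i))).
Qed.

End Reindexing.

(** * Linear categories *)

#[export] Hint Extern 0 (heq _ _) => apply: heq_refl : core.

#[export] Instance heq_equivalence (k : fieldType) (C : linear_category k) (X Y : C) :
  Equivalence (@heq k C X Y).
Proof.
split; [exact: heq_refl | exact: heq_sym | exact: heq_trans].
Qed.

#[export] Instance hcomp_proper (k : fieldType) (C : linear_category k) (X Y Z : C) :
  Proper (@heq k C Y Z ==> @heq k C X Y ==> @heq k C X Z) (@hcomp k C X Y Z).
Proof. by move=> g g' gg f f' ff; apply: heq_comp. Qed.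

#[export] Instance hadd_proper (k : fieldType) (C : linear_category k) (X Y : C) :
  Proper (@heq k C X Y ==> @heq k C X Y ==> @heq k C X Y) (@hadd k C X Y).
Proof. by move=> f f' ff g g' gg; apply: heq_add. Qed.

#[export] Instance hscale_proper (k : fieldType) (C : linear_category k) (X Y : C) c :
  Proper (@heq k C X Y ==> @heq k C X Y) (@hscale k C X Y c).
Proof. by move=> f f' ff; apply: heq_scale. Qed.

#[export] Instance fmap_proper (k : fieldType) (C D : linear_category k)
  (T : linear_functor C D) (X Y : C) :
  Proper (@heq k C X Y ==> @heq k D (T X) (T Y)) (@fmap k C D T X Y).
Proof. by move=> f f' ff; apply: fmap_eq. Qed.

Section LinearCategories.
Context (k : fieldType) (C : linear_category k).
Implicit Types X Y Z : C.

Lemma hadd0l X Y (f : hom X Y) : hadd (hzero X Y) f =h f.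
Proof. exact: hadd_zero. Qed.

Lemma hadd0r X Y (f : hom X Y) : hadd f (hzero X Y) =h f.
Proof. by rewrite hadd_comm hadd_zero. Qed.

Lemma hscale0l X Y (f : hom X Y) : hscale 0 f =h hzero X Y.
Proof.
rewrite -[c in hscale c _](addNr (1 : k)) hscale_addl.
by rewrite (hscale_one f) hadd_opp.
Qed.

Lemma hscale0r X Y a : hscale a (hzero X Y) =h hzero X Y.
Proof.
by rewrite -{1}(hscale0l (hzero X Y)) hscale_mul mulr0 hscale0l.
Qed.

Lemma hcomp0l X Y Z (f : hom X Y) : hzero Y Z \oh f =h hzero X Z.
Proof. by rewrite -(hscale0l (hzero Y Z)) hcomp_scalel hscale0l. Qed.

Lemma hcomp0r X Y Z (g : hom Y Z) : g \oh hzero X Y =h hzero X Z.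
Proof. by rewrite -(hscale0l (hzero X Y)) hcomp_scaler hscale0l. Qed.

Definition hsub X Y (f g : hom X Y) := hadd f (hscale (-1) g).

#[export] Instance hsub_proper X Y :
  Proper (@heq k C X Y ==> @heq k C X Y ==> @heq k C X Y) (@hsub X Y).
Proof. by move=> f f' ff g g' gg; rewrite /hsub ff gg. Qed.

Lemma hsubrr X Y (f : hom X Y) : hsub f f =h hzero X Y.
Proof. by rewrite /hsub hadd_comm; apply: hadd_opp. Qed.

Lemma hsub_eq0 X Y (f g : hom X Y) : hsub f g =h hzero X Y <-> f =h g.
Proof.
split=> [fg|->]; last exact: hsubrr.
have : hadd (hsub f g) g =h hadd (hzero X Y) g by rewrite fg.
by rewrite /hsub -hadd_assoc hadd_opp hadd0r hadd0l.
Qed.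

Lemma is_iso_epi X Y Z (s : hom X Y) (f g : hom Y Z) :
  is_iso s -> f \oh s =h g \oh s -> f =h g.
Proof.
move=> [t [_ st]] fg.
by rewrite -(hcomp_idr f) -(hcomp_idr g) -st !hcomp_assoc fg.
Qed.

Lemma is_iso_mono X Y Z (s : hom Y Z) (f g : hom X Y) :
  is_iso s -> s \oh f =h s \oh g -> f =h g.
Proof.
move=> [t [ts _]] fg.
by rewrite -(hcomp_idl f) -(hcomp_idl g) -ts -!hcomp_assoc fg.
Qed.

Lemma is_iso_comp X Y Z (g : hom Y Z) (f : hom X Y) :
  is_iso g -> is_iso f -> is_iso (g \oh f).
Proof.
move=> [g' [g'g gg']] [f' [f'f ff']]; exists (f' \oh g'); split.
  by rewrite -hcomp_assoc (hcomp_assoc g') g'g hcomp_idl f'f.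
by rewrite -hcomp_assoc (hcomp_assoc f) ff' hcomp_idl gg'.
Qed.

Lemma is_iso_id X : is_iso (hid X).
Proof. by exists (hid X); rewrite !hcomp_idl. Qed.

Lemma is_iso_heq X Y (f g : hom X Y) : f =h g -> is_iso f -> is_iso g.
Proof. by move=> fg [f' [f'f ff']]; exists f'; rewrite -fg. Qed.

Lemma isomorphic_sym X Y : isomorphic X Y -> isomorphic Y X.
Proof. by move=> [f [g [gf fg]]]; exists g, f. Qed.

Lemma isomorphic_trans X Y Z : isomorphic X Y -> isomorphic Y Z -> isomorphic X Z.
Proof. by move=> [f fI] [g gI]; exists (g \oh f); apply: is_iso_comp. Qed.

End LinearCategories.

Lemma fmap_is_iso (k : fieldType) (C D : linear_category k)
  (T : linear_functor C D) (X Y : C) (f : hom X Y) : is_iso f -> is_iso (fmap T f).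
Proof.
by move=> [g [gf fg]]; exists (fmap T g); rewrite -!fmap_comp gf fg !fmap_id.
Qed.

(** * Homotopies *)

Section Homotopy.
Context (k : fieldType) (B : algType k).
Implicit Types X Y Z : complex B.

Definition chain_map_of X Y (f : forall i, X i -> Y i) (fL : forall i, linear (f i))
    (fd : forall i x, f (i + 1) (cdiff X i x) = cdiff Y i (f i x)) : chain_map X Y :=
  @ChainMap k B X Y (fun i => lin (fL i)) fd.

(** Indexing [h] by its target degree and stating the identity in degree $i+1$ avoids every
    transport; no degree is lost, each integer being a successor. *)
Definition homotopic X Y (f g : chain_map X Y) : Prop :=
  exists h : forall i, {linear X (i + 1) -> Y i},
    forall i x, f (i + 1) x - g (i + 1) x =
                cdiff Y i (h i x) + h (i + 1) (cdiff X (i + 1) x).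

Lemma homotopic0P X Y (f : chain_map X Y) :
  homotopic f (chain_zero X Y) <->
  exists h : forall i, {linear X (i + 1) -> Y i},
    forall i x, f (i + 1) x = cdiff Y i (h i x) + h (i + 1) (cdiff X (i + 1) x).
Proof. by split=> -[h hE]; exists h => i x; rewrite -hE /= subr0. Qed.

Lemma homotopic_chain_eq X Y (f g : chain_map X Y) : chain_eq f g -> homotopic f g.
Proof.
move=> fg; exists (fun i => [the {linear X (i + 1) -> Y i} of \0]) => i x.
by rewrite fg subrr /= linear0 addr0.
Qed.

Lemma homotopic_refl X Y (f : chain_map X Y) : homotopic f f.
Proof. exact: homotopic_chain_eq. Qed.

Lemma homotopic_sym X Y (f g : chain_map X Y) : homotopic f g -> homotopic g f.
Proof.
move=> [h hE]; exists (fun i => [the {linear X (i + 1) -> Y i} of \- h i]) => i x /=.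
by rewrite linearN -opprD -hE opprB.
Qed.

Lemma homotopic_trans X Y (f g h : chain_map X Y) :
  homotopic f g -> homotopic g h -> homotopic f h.
Proof.
move=> [s sE] [t tE].
exists (fun i => [the {linear X (i + 1) -> Y i} of s i \+ t i]) => i x /=.
by rewrite linearD addrACA -sE -tE addrA subrK.
Qed.

Lemma homotopic_comp X Y Z (g g' : chain_map Y Z) (f f' : chain_map X Y) :
  homotopic g g' -> homotopic f f' ->
  homotopic (chain_comp g f) (chain_comp g' f').
Proof.
move=> [t tE] [s sE].
exists (fun i => [the {linear X (i + 1) -> Z i} of
                    (g i \o s i) \+ (t i \o f' (i + 1))]) => i x /=.
have -> : g (i + 1) (f (i + 1) x) - g' (i + 1) (f' (i + 1) x) =
    g (i + 1) (f (i + 1) x - f' (i + 1) x) +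
    (g (i + 1) (f' (i + 1) x) - g' (i + 1) (f' (i + 1) x)).
  by rewrite linearB addrA subrK.
by rewrite sE tE !linearD (cmap_cdiff g) -(cmap_cdiff f') addrACA.
Qed.

Lemma homotopic_add X Y (f f' g g' : chain_map X Y) :
  homotopic f f' -> homotopic g g' ->
  homotopic (chain_add f g) (chain_add f' g').
Proof.
move=> [s sE] [t tE].
exists (fun i => [the {linear X (i + 1) -> Y i} of s i \+ t i]) => i x /=.
by rewrite [in RHS]linearD [RHS]addrACA -sE -tE opprD addrACA.
Qed.

Lemma homotopic_scale X Y c (f f' : chain_map X Y) :
  homotopic f f' -> homotopic (chain_scale c f) (chain_scale c f').
Proof.
move=> [s sE].
exists (fun i => [the {linear X (i + 1) -> Y i} of alg_scale c (s i)]) => i x /=.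
by rewrite /alg_scale [in RHS]linearZ -scalerDr -sE scalerBr.
Qed.

Definition homotopy_category : linear_category k.
Proof.
pose C := complexes B.
apply: (@LinearCategory k (complex B) (@chain_map k B) homotopic (@chain_id k B)
  (@chain_comp k B) (@chain_zero k B) (@chain_add k B) (@chain_scale k B)).
- exact: homotopic_refl.
- exact: homotopic_sym.
- exact: homotopic_trans.
- exact: homotopic_comp.
- exact: homotopic_add.
- exact: homotopic_scale.
- by move=> *; apply: homotopic_chain_eq; apply: (@hcomp_assoc k C).
- by move=> *; apply: homotopic_chain_eq; apply: (@hcomp_idl k C).
- by move=> *; apply: homotopic_chain_eq; apply: (@hcomp_idr k C).
- by move=> *; apply: homotopic_chain_eq; apply: (@hadd_assoc k C).
- by move=> *; apply: homotopic_chain_eq; apply: (@hadd_comm k C).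
- by move=> *; apply: homotopic_chain_eq; apply: (@hadd_zero k C).
- by move=> *; apply: homotopic_chain_eq; apply: (@hadd_opp k C).
- by move=> *; apply: homotopic_chain_eq; apply: (@hscale_one k C).
- by move=> *; apply: homotopic_chain_eq; apply: (@hscale_mul k C).
- by move=> *; apply: homotopic_chain_eq; apply: (@hscale_addl k C).
- by move=> *; apply: homotopic_chain_eq; apply: (@hscale_addr k C).
- by move=> *; apply: homotopic_chain_eq; apply: (@hcomp_addl k C).
- by move=> *; apply: homotopic_chain_eq; apply: (@hcomp_addr k C).
- by move=> *; apply: homotopic_chain_eq; apply: (@hcomp_scalel k C).
- by move=> *; apply: homotopic_chain_eq; apply: (@hcomp_scaler k C).
Defined.

Definition homotopy_functor : linear_functor (complexes B) homotopy_category.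
Proof.
apply: (@LinearFunctor k (complexes B) homotopy_category id (fun X Y f => f)).
- by move=> X Y f g fg; apply: homotopic_chain_eq.
- by move=> *; apply: homotopic_refl.
- by move=> *; apply: homotopic_refl.
- by move=> *; apply: homotopic_refl.
- by move=> *; apply: homotopic_refl.
Defined.

Definition acyclic X : Prop :=
  forall (i : int) (x : X (i + 1)), cdiff X (i + 1) x = 0 -> exists y, x = cdiff X i y.

Lemma quasi_isomorphism_acyclic0 X :
  acyclic X -> quasi_isomorphism (chain_zero X X : @hom k (complexes B) X X).
Proof.
move=> Xac i; split=> [x dx _|y dy]; first exact: Xac.
by exists 0; have [y' ->] := Xac i y dy; exists y'; rewrite !linear0 add0r.
Qed.

Local Notation DB := (derived_category B).
Local Notation Q := (fmap (loc_functor (@quasi_isomorphism k B))).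

Lemma Q_quasi_isomorphism X Y (f : @hom k (complexes B) X Y) :
  quasi_isomorphism f -> is_iso (Q f).
Proof. by move=> qf; exists (Finv qf); split; [apply: Finv_l | apply: Finv_r]. Qed.

(* The zero endomorphism of an acyclic complex is a quasi-isomorphism, hence
   invertible. *)
Lemma acyclic_id0 X : acyclic X -> @hid k DB X =h @hzero k DB X X.
Proof.
move=> /quasi_isomorphism_acyclic0/Q_quasi_isomorphism[t [tz _]].
rewrite -tz; exact: (hcomp0r (C := DB)).
Qed.

Lemma cone_id_acyclic X : acyclic (cone (chain_id X)).
Proof.
move=> i [x y] /= [/eqP]; rewrite oppr_eq0 => /eqP dx xdy.
exists (y, 0); rewrite /cone_diff /= linear0 addr0; congr pair.
by apply/esym/eqP; rewrite eq_sym -addr_eq0; apply/eqP.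
Qed.

(** A null-homotopy [h] of [f] is the same as a factorization of [f] through the cone of the
    identity, by $(x,y)\mapsto h x+f y$. That cone is acyclic, so its identity is zero in the
    derived category. *)
Lemma null_homotopic_Q X Y (f : @hom k (complexes B) X Y) :
  homotopic f (chain_zero X Y) -> Q f =h @hzero k DB X Y.
Proof.
move=> /homotopic0P[h hE].
have gL i : linear (fun u : cone (chain_id X) i => h i u.1 + f i u.2).
  by move=> b u v; rewrite /= !linearP scalerDr addrACA.
have gd i (u : cone (chain_id X) i) :
    (fun u : cone (chain_id X) (i + 1) => h (i + 1) u.1 + f (i + 1) u.2)
      (cdiff (cone (chain_id X)) i u) =
    cdiff Y i (h i u.1 + f i u.2).
  rewrite /= linearN !linearD /= hE -!cmap_cdiff.
  by rewrite [_ + h _ _]addrC -[_ + _ + f _ _]addrA addKr.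
pose g : @hom k (complexes B) (cone (chain_id X)) Y := chain_map_of gL gd.
have fE : f =h g \oh (cone_incl (chain_id X) : @hom k (complexes B) _ _).
  by move=> i x /=; rewrite linear0 add0r.
rewrite (fmap_eq _ fE) fmap_comp -(hcomp_idr (Q g)).
rewrite (acyclic_id0 (@cone_id_acyclic X)).
by rewrite -hcomp_assoc hcomp0l hcomp0r.
Qed.

Lemma chain_sub0 X Y (f g : chain_map X Y) :
  homotopic f g -> homotopic (chain_add f (chain_scale (-1) g)) (chain_zero X Y).
Proof. by move=> fg; apply/(@hsub_eq0 k homotopy_category). Qed.

Lemma homotopic_Q X Y (f g : @hom k (complexes B) X Y) :
  homotopic f g -> Q f =h Q g.
Proof.
move=> /chain_sub0/null_homotopic_Q fg; apply/hsub_eq0.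
by rewrite -fg /hsub -fmap_scale -fmap_add.
Qed.

End Homotopy.

(** * Desuspension of complexes *)

Section Unshift.
Context (k : fieldType) (B : algType k).
Implicit Types X Y Z : complex B.

Section Transport.
Context (X : complex B).

Definition transport (i j : int) (E : i = j) : {linear X i -> X j} :=
  match E in _ = j return {linear X i -> X j} with
  | erefl => [the {linear X i -> X i} of idfun] end.

Lemma transport_id (i : int) (E : i = i) x : transport E x = x.
Proof. by rewrite (eq_irrelevance E erefl). Qed.

Lemma transport_trans (i j l : int) (E : i = j) (E' : j = l) (E'' : i = l) x :
  transport E' (transport E x) = transport E'' x.
Proof. by case: _ / E' E''; case: _ / E => E''; rewrite !transport_id. Qed.

Lemma transport_diff (i j : int) (E : i = j) (E' : i + 1 = j + 1) x :
  cdiff X j (transport E x) = transport E' (cdiff X i x).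
Proof. by move: E'; case: _ / E => E'; rewrite !transport_id. Qed.

Lemma unshift_index (i : int) : i - 1 + 1 = i + 1 - 1.
Proof. by rewrite subrK addrK. Qed.

Definition unshift : complex B.
Proof.
apply: (@Complex k B (fun i => X (i - 1)) (fun i =>
  [the {linear X (i - 1) -> X (i + 1 - 1)} of
     \- (transport (unshift_index i) \o cdiff X (i - 1))])).
- move=> i x /=; rewrite !linearN /= opprK.
  rewrite (transport_diff _ (congr1 (+%R^~ 1) (unshift_index i))) cdiff_cdiff.
  by rewrite !linear0.
- by move=> i; apply: cobj_fg.
- have [n X0] := cobj_bounded X; exists n.+1 => i ni; apply: X0.
  by case: i ni => [] [] //= m; lia.
Defined.

Definition unshift_in : chain_map X (complex_shift unshift).
Proof.
apply: (@ChainMap k B X (complex_shift unshift)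
  (fun i => transport (esym (addrK 1 i)))) => i x /=.
rewrite /shift_diff /= opprK.
rewrite (transport_diff _ (congr1 (+%R^~ 1) (esym (addrK 1 i)))).
by rewrite (@transport_trans _ _ _ _ _ (esym (addrK 1 (i + 1)))).
Defined.

Definition unshift_out : chain_map (complex_shift unshift) X.
Proof.
apply: (@ChainMap k B (complex_shift unshift) X
  (fun i => transport (addrK 1 i))) => i x /=.
rewrite /shift_diff /= opprK.
rewrite (transport_diff _ (congr1 (+%R^~ 1) (addrK 1 i))).
by rewrite (@transport_trans _ _ _ _ _ (congr1 (+%R^~ 1) (addrK 1 i))).
Defined.

Lemma unshift_inK i : cancel (unshift_in i) (unshift_out i).
Proof. by move=> x /=; rewrite (transport_trans _ _ erefl). Qed.
Lemma unshift_outK i : cancel (unshift_out i) (unshift_in i).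
Proof. by move=> x /=; rewrite (transport_trans _ _ erefl). Qed.

End Transport.

Lemma chain_shift_full X Y (f : chain_map (complex_shift X) (complex_shift Y)) :
  exists g : chain_map X Y, chain_eq (chain_shift g) f.
Proof.
have [g gE] := @reindex_family (fun i => {linear X i -> Y i}) f.
have gd : forall i x, g (i + 1) (cdiff X i x) = cdiff Y i (g i x).
  apply: int_succ_ind => i x; rewrite !gE.
  have /= := cmap_cdiff f (x : complex_shift X i).
  by rewrite /shift_diff linearN => /oppr_inj.
by exists (ChainMap gd) => i x; rewrite /= gE.
Qed.

Lemma chain_shift_homotopic X Y (f g : chain_map X Y) :
  homotopic (chain_shift f) (chain_shift g) -> homotopic f g.
Proof.
move=> [h hE].
have [h' h'E] := @reindex_family (fun i => {linear X (i + 1) -> Y i})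
  (fun i => [the {linear X (i + 1 + 1) -> Y (i + 1)} of \- h i]).
exists h'; apply: int_succ_ind => i x; rewrite !h'E.
have /= -> := hE i x.
by rewrite /shift_diff !linearN.
Qed.

End Unshift.

(** * Perfect complexes *)

Section Perfect.
Context (k : fieldType) (B : algType k).
Implicit Types X Y Z P C : complex B.

Definition perfect P : Prop := forall i, projective_module (P i).

Lemma perfect_shift P : perfect P -> perfect (complex_shift P).
Proof. by move=> P_perf i; apply: P_perf. Qed.

(** The homotopy is built by descending induction, starting above the top degree of [P], where both
    sides vanish. *)
Lemma acyclic_null P C (f : chain_map P C) :
  perfect P -> acyclic C -> homotopic f (chain_zero P C).
Proof.
move=> P_perf C_ac; apply/homotopic0P; have [n P0] := cobj_bounded P.
have step (m : nat) : exists h : forall i, {linear P (i + 1) -> C i},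
    forall i : int, n%:Z - m%:Z < i + 1 -> forall x,
      f (i + 1) x = cdiff C i (h i x) + h (i + 1) (cdiff P (i + 1) x).
  elim: m => [|m [h hE]].
    exists (fun i => [the {linear P (i + 1) -> C i} of \0]) => i ni x /=.
    by rewrite linear0 addr0 (P0 (i + 1) _ x) ?linear0 //; lia.
  pose i0 : int := n%:Z - m%:Z - 1.
  (* By the identity already known one degree higher, $f-hd$ takes values in cocycles. These are
     boundaries in [C], so projectivity gives a lift through the differential, which becomes the new
     component of [h]. *)
  have uL : linear (fun x : P (i0 + 1) => f (i0 + 1) x - h (i0 + 1) (cdiff P (i0 + 1) x)).
    by move=> b x y; rewrite !linearP scalerDr addrACA.
  have [||g gE] := @projective_lift _ (P (i0 + 1)) (C i0) (C (i0 + 1)) (cdiff C i0) (lin uL).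
  - exact: P_perf.
  - move=> x; have [|y ->] := C_ac i0 (lin uL x); last by exists y.
    rewrite /= linearB -cmap_cdiff /= hE ?cdiff_cdiff ?linear0 ?addr0 ?subrr //.
    by rewrite /i0; lia.
  exists (dfwith h g) => i ni x.
  have [ii0|ii0] := eqVneq i i0.
    subst i; rewrite dfwith_in dfwith_out; last by apply/eqP; lia.
    by rewrite gE; apply/esym/subrK.
  rewrite !dfwith_out; try by apply/eqP; move/eqP: ii0; lia.
  by apply: hE; move/eqP: ii0; rewrite /i0; lia.
(* With $m=2n+1$ the identity holds in all degrees from $-n$ on; below them [P] is zero. *)
have [h hE] := step (2 * n + 1)%N; exists h => i x.
have [ni|ni] := boolP (n%:Z - (2 * n + 1)%N%:Z < i + 1); first exact: hE.
by rewrite (P0 (i + 1) _ x) ?linear0 ?addr0 //; lia.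
Qed.

Lemma quasi_isomorphism_cone X Y (f : @hom k (complexes B) X Y) :
  quasi_isomorphism f -> acyclic (cone f).
Proof.
move=> qf i [x y] /= [/eqP]; rewrite oppr_eq0 => /eqP dx fxdy.
have [|x' xE] := (qf (i + 1)).1 x dx.
  by exists (- y); rewrite linearN; apply/eqP; rewrite -addr_eq0; apply/eqP.
have [|x'' [y' [dx'' yE]]] := (qf i).2 (y + f (i + 1) x').
  by rewrite linearD -cmap_cdiff -xE [LHS]addrC.
exists (x'' - x', y'); congr pair => /=.
  by rewrite linearB dx'' sub0r opprK.
rewrite linearB addrAC -yE addrK //.
Qed.

(** A null-homotopy of $P\to Y\to\mathrm{Cone}(f)$ has two components: the one in [X] is a chain map
    $P\to X$, and the negative of the one in [Y] is a homotopy from its composite with [f] to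
    [g]. *)
Lemma cone_incl_lift X Y P (f : chain_map X Y) (g : chain_map P Y) :
  homotopic (chain_comp (cone_incl f) g) (chain_zero P (cone f)) ->
  exists g' : chain_map P X, homotopic (chain_comp f g') g.
Proof.
move=> /homotopic0P[h hE].
have h1L i : linear (fun x : P (i + 1) => (h i x).1).
  by move=> b x y; rewrite linearP.
have h2L i : linear (fun x : P (i + 1) => - (h i x).2).
  by move=> b x y; rewrite linearP /= opprD scalerN.
have h1d i x : (lin (h1L (i + 1))) (cdiff (complex_shift P) i x) =
    cdiff (complex_shift X) i (lin (h1L i) x).
  have /(congr1 fst)/= := hE i x; rewrite /shift_diff linearN /= => /esym/eqP.
  by rewrite addr_eq0 eqr_oppLR opprK => /eqP ->.
have [g' g'E] := chain_shift_full (@ChainMap k B (complex_shift P) (complex_shift X)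
    (fun i => lin (h1L i)) h1d).
exists g'; exists (fun i => lin (h2L i)) => i x /=.
have /= -> := g'E i x; have /(congr1 snd)/= -> := hE i x.
by rewrite [in RHS]linearN -addrA opprD addrA subrr add0r opprD.
Qed.

Lemma quasi_isomorphism_lift X Y P (q : @hom k (complexes B) X Y)
    (g : chain_map P Y) :
  perfect P -> quasi_isomorphism q ->
  exists g' : chain_map P X, homotopic (chain_comp q g') g.
Proof.
move=> P_perf qq; apply: cone_incl_lift.
exact: acyclic_null (quasi_isomorphism_cone qq).
Qed.

(** If [h] contracts $qg$, then $(g,-h)$ is a chain map $P[1]\to\mathrm{Cone}(q)$. It is
    null-homotopic because the cone is acyclic, and the [X]-component of a contraction contracts
    $g[1]$. *)
Lemma quasi_isomorphism_null X Y P (q : @hom k (complexes B) X Y)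
    (g : chain_map P X) :
  perfect P -> quasi_isomorphism q ->
  homotopic (chain_comp q g) (chain_zero P Y) -> homotopic g (chain_zero P X).
Proof.
move=> P_perf qq /homotopic0P[h hE]; apply: chain_shift_homotopic.
have uL i : linear (fun x : P (i + 1) => (g (i + 1) x, - h i x) : cone q i).
  move=> b x y; by rewrite !linearP.
have ud i x : lin (uL (i + 1)) (cdiff (complex_shift P) i x) =
              cdiff (cone q) i (lin (uL i) x).
  rewrite /= /shift_diff /cone_diff /=; congr pair.
    by rewrite linearN cmap_cdiff.
  have /= -> := hE i x; rewrite !linearN /= opprK.
  by rewrite [RHS]addrAC subrr add0r.
pose u : chain_map (complex_shift P) (cone q) :=
  @ChainMap k B (complex_shift P) (cone q) (fun i => lin (uL i)) ud.
have [s sE] := iffLR (homotopic0P u)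
  (acyclic_null u (perfect_shift P_perf) (quasi_isomorphism_cone qq)).
have tL i : linear (fun x : complex_shift P (i + 1) => (s i x).1).
  by move=> b x y; rewrite linearP.
apply/homotopic0P; exists (fun i => lin (tL i)) => i x /=.
by have /(congr1 fst)/= := sE i x.
Qed.

End Perfect.

(** * Morphisms from perfect complexes in the derived category *)

Section Representable.
Context (k : fieldType) (C : linear_category k) (P : C).

Record hom_operator (X Y : C) := HomOperator {
  op_fun :> hom P X -> hom P Y;
  op_eq : forall f g, f =h g -> op_fun f =h op_fun g;
  op_add : forall f g, op_fun (hadd f g) =h hadd (op_fun f) (op_fun g);
  op_scale : forall c f, op_fun (hscale c f) =h hscale c (op_fun f)
}.

#[local] Instance op_proper X Y (T : hom_operator X Y) :
  Proper (@heq k C P X ==> @heq k C P Y) T.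
Proof. by move=> f g; apply: op_eq. Qed.

Definition operator_eq X Y (S T : hom_operator X Y) := forall f, S f =h T f.

Definition operator_id X : hom_operator X X.
Proof. by exists id. Defined.

Definition operator_comp X Y Z (S : hom_operator Y Z) (T : hom_operator X Y) :
  hom_operator X Z.
Proof.
exists (fun f => S (T f)).
- by move=> f g fg; rewrite fg.
- by move=> f g; rewrite !op_add.
- by move=> c f; rewrite !op_scale.
Defined.

Definition operator_zero X Y : hom_operator X Y.
Proof.
exists (fun=> hzero P Y) => //.
- by move=> f g; rewrite hadd0l.
- by move=> c f; rewrite hscale0r.
Defined.

Definition operator_add X Y (S T : hom_operator X Y) : hom_operator X Y.
Proof.
exists (fun f => hadd (S f) (T f)).
- by move=> f g fg; rewrite fg.
- move=> f g; rewrite !op_add -!hadd_assoc.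
  by rewrite (hadd_assoc (S g)) (hadd_comm (S g)) -(hadd_assoc (T f)).
- by move=> c f; rewrite !op_scale hscale_addr.
Defined.

Definition operator_scale X Y (a : k) (T : hom_operator X Y) : hom_operator X Y.
Proof.
exists (fun f => hscale a (T f)).
- by move=> f g fg; rewrite fg.
- by move=> f g; rewrite !op_add hscale_addr.
- by move=> c f; rewrite !op_scale !hscale_mul mulrC.
Defined.

(** A stand-in for $k$-vector spaces as target of $\mathrm{Hom}(P,-)$: the objects stay those of
    [C], and a morphism $X\to Y$ is a linear map $\mathrm{Hom}(P,X)\to\mathrm{Hom}(P,Y)$. The
    universal property of the localization then applies. *)
Definition representable_category : linear_category k.
Proof.
apply: (@LinearCategory k C hom_operator operator_eq operator_id operator_comp
  operator_zero operator_add operator_scale); try by move=> *; move=> ?.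
- by move=> X Y f g fg x; rewrite fg.
- by move=> X Y f g h fg gh x; rewrite fg gh.
- by move=> X Y Z g g' f f' gg ff x /=; rewrite ff gg.
- by move=> X Y f f' g g' ff gg x /=; rewrite ff gg.
- by move=> X Y c f f' ff x /=; rewrite ff.
- by move=> X Y f g h x /=; rewrite hadd_assoc.
- by move=> X Y f g x /=; rewrite hadd_comm.
- by move=> X Y f x /=; rewrite hadd0l.
- by move=> X Y f x /=; rewrite hadd_opp.
- by move=> X Y f x /=; rewrite hscale_one.
- by move=> X Y a b f x /=; rewrite hscale_mul.
- by move=> X Y a b f x /=; rewrite hscale_addl.
- by move=> X Y a f g x /=; rewrite hscale_addr.
- by move=> X Y Z g f f' x /=; rewrite op_add.
- by move=> X Y Z c g f x /=; rewrite op_scale.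
Defined.

Definition operator_of X Y (f : hom X Y) : hom_operator X Y.
Proof.
exists (fun x => f \oh x).
- by move=> x y xy; rewrite xy.
- by move=> x y; rewrite hcomp_addr.
- by move=> c x; rewrite hcomp_scaler.
Defined.

Definition representable_functor : linear_functor C representable_category.
Proof.
apply: (@LinearFunctor k C representable_category id operator_of).
- by move=> X Y f g fg x /=; rewrite fg.
- by move=> X x /=; rewrite hcomp_idl.
- by move=> X Y Z g f x /=; rewrite hcomp_assoc.
- by move=> X Y f g x /=; rewrite hcomp_addl.
- by move=> X Y c f x /=; rewrite hcomp_scalel.
Defined.

Lemma operator_inverse X Y (T : hom_operator X Y) :
  (forall y, exists x, T x =h y) ->
  (forall x, T x =h hzero P Y -> x =h hzero P X) ->
  exists S : hom_operator Y X,
    operator_eq (operator_comp S T) (operator_id X) /\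
    operator_eq (operator_comp T S) (operator_id Y).
Proof.
move=> T_surj T_ker.
have T_inj x y : T x =h T y -> x =h y.
  move=> xy; apply/hsub_eq0/T_ker.
  by rewrite op_add op_scale xy; apply: hsubrr.
pose s y := projT1 (cid (T_surj y)).
have sP y : T (s y) =h y := projT2 (cid (T_surj y)).
have s_eq f g : f =h g -> s f =h s g by move=> fg; apply: T_inj; rewrite !sP.
have s_add f g : s (hadd f g) =h hadd (s f) (s g).
  by apply: T_inj; rewrite op_add !sP.
have s_scale c f : s (hscale c f) =h hscale c (s f).
  by apply: T_inj; rewrite op_scale !sP.
exists (HomOperator s_eq s_add s_scale); split=> x /=; last exact: sP.
by apply: T_inj; rewrite sP.
Qed.

End Representable.

Section PerfectHoms.
Context (k : fieldType) (B : algType k).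

Local Notation DB := (derived_category B).
Local Notation Q := (fmap (loc_functor (@quasi_isomorphism k B))).

Section Fixed.
Context (P : complex B) (P_perf : perfect P).

Let rep := @representable_category k (homotopy_category B) P.
Let rep_functor : linear_functor (complexes B) rep :=
  functor_comp (representable_functor _) (homotopy_functor B).

Lemma quasi_isomorphism_operator (X Y : complexes B) (q : hom X Y) :
  quasi_isomorphism q ->
  exists t : @hom k rep Y X,
    t \oh fmap rep_functor q =h @hid k rep X /\
    fmap rep_functor q \oh t =h @hid k rep Y.
Proof.
move=> qq; apply: operator_inverse => /= [y|x].
  exact: (quasi_isomorphism_lift y P_perf qq).
exact: (quasi_isomorphism_null P_perf qq).
Qed.

(** $K(P,-)$ turns quasi-isomorphisms into bijections, so it extends to the derived category; this
    extension separates words of the localization. *)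
Definition derived_operator : linear_functor DB rep :=
  @loc_lift k (complexes B) rep (@quasi_isomorphism k B) rep_functor
    (fun X Y s qs => projT1 (cid (quasi_isomorphism_operator qs)))
    (fun X Y s qs => (projT2 (cid (quasi_isomorphism_operator qs))).1)
    (fun X Y s qs => (projT2 (cid (quasi_isomorphism_operator qs))).2).

Lemma Q_homotopic (X : complexes B) (f g : @hom k (complexes B) P X) :
  Q f =h Q g -> homotopic f g.
Proof.
(* The operators of [f] and [g], evaluated at the identity of [P], return [f] and [g] up to
   homotopy. *)
move=> /(fmap_eq derived_operator)/(_ (chain_id P)).
exact.
Qed.

(** Induction on the word [h]. A formal inverse of a quasi-isomorphism [s] is absorbed by lifting
    [f] through [s] up to homotopy. *)
Lemma perfect_hom_aux (X Y : DB) (h : hom X Y) (f : @hom k (complexes B) P X) :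
  exists f' : @hom k (complexes B) P Y, h \oh Q f =h Q f'.
Proof.
elim: h f => {X Y} [X Y h|X Y s qs|X Y Z h IHh g IHg|X Y h IHh g IHg|X Y c h IHh] f.
- by exists (h \oh f); rewrite fmap_comp.
- have [f' f'E] := quasi_isomorphism_lift f P_perf qs.
  have sf' : Q s \oh Q f' =h Q f by rewrite -fmap_comp; apply: homotopic_Q.
  exists f'; apply: (heq_trans (heq_comp (heq_refl (Finv qs : @hom k DB _ _)) (heq_sym sf'))).
  apply: heq_trans (@hcomp_assoc k DB _ _ _ _ _ _ _) _.
  have invs : (Finv qs : @hom k DB Y X) \oh Q s =h @hid k DB X := Finv_l qs.
  by apply: heq_trans (heq_comp invs (heq_refl _)) _; apply: (@hcomp_idl k DB).
- have [f' f'E] := IHg f; have [f'' f''E] := IHh f'.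
  by exists f''; rewrite -f''E -f'E; symmetry; exact: (@hcomp_assoc k DB).
- have [f' f'E] := IHg f; have [f'' f''E] := IHh f.
  exists (hadd f'' f'); rewrite fmap_add -f''E -f'E.
  exact: (@hcomp_addl k DB).
- have [f' f'E] := IHh f; exists (hscale c f'); rewrite fmap_scale -f'E.
  exact: (@hcomp_scalel k DB).
Qed.

Lemma perfect_hom (X : DB) (h : @hom k DB P X) :
  exists f : @hom k (complexes B) P X, h =h Q f.
Proof.
have [f fE] := perfect_hom_aux h (@hid k (complexes B) P).
exists f; rewrite -fE; symmetry; exact: (@hcomp_idr k DB).
Qed.

End Fixed.

End PerfectHoms.

(** * Exactness in the derived category *)

Section Derived.
Context (k : fieldType) (B : algType k).
Implicit Types X Y Z P : complex B.

Local Notation DB := (derived_category B).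

Definition qmap X Y (f : chain_map X Y) : @hom k DB X Y :=
  fmap (loc_functor (@quasi_isomorphism k B)) f.

Lemma qmap_homotopic X Y (f g : chain_map X Y) : homotopic f g -> qmap f =h qmap g.
Proof. exact: homotopic_Q. Qed.

Lemma qmap_inj P X (f g : chain_map P X) :
  perfect P -> qmap f =h qmap g -> homotopic f g.
Proof. by move=> P_perf; apply: Q_homotopic. Qed.

Lemma qmap_full P X (h : @hom k DB P X) :
  perfect P -> exists f : chain_map P X, h =h qmap f.
Proof. by move=> P_perf; apply: (perfect_hom P_perf h). Qed.

Lemma qmap_comp X Y Z (g : chain_map Y Z) (f : chain_map X Y) :
  qmap (chain_comp g f) =h qmap g \oh qmap f.
Proof. exact: (fmap_comp (loc_functor (@quasi_isomorphism k B))). Qed.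

Lemma qmap_id X : qmap (chain_id X) =h @hid k DB X.
Proof. exact: (fmap_id (loc_functor (@quasi_isomorphism k B))). Qed.

Lemma qmap_zero X Y : qmap (chain_zero X Y) =h @hzero k DB X Y.
Proof. exact: heq_refl. Qed.

Lemma qmap_add X Y (f g : chain_map X Y) :
  qmap (chain_add f g) =h hadd (qmap f) (qmap g).
Proof. exact: (fmap_add (loc_functor (@quasi_isomorphism k B))). Qed.

Lemma qmap_scale X Y c (f : chain_map X Y) :
  qmap (chain_scale c f) =h hscale c (qmap f).
Proof. exact: (fmap_scale (loc_functor (@quasi_isomorphism k B))). Qed.

Lemma qmap_eq0 P X (f : chain_map P X) :
  perfect P -> qmap f =h @hzero k DB P X <-> homotopic f (chain_zero P X).
Proof.
move=> P_perf; split=> [f0|f0]; first exact: qmap_inj.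
by apply: heq_trans (qmap_homotopic f0) _; apply: qmap_zero.
Qed.

Lemma qmap_iso X Y (f : chain_map X Y) :
  quasi_isomorphism (f : @hom k (complexes B) X Y) -> is_iso (qmap f).
Proof. exact: Q_quasi_isomorphism. Qed.

Lemma bijective_quasi_isomorphism X Y (f : chain_map X Y) (g : chain_map Y X) :
  (forall i, cancel (f i) (g i)) -> (forall i, cancel (g i) (f i)) ->
  quasi_isomorphism (f : @hom k (complexes B) X Y).
Proof.
move=> fg gf i; split=> [x dx [y fxE]|y dy].
  by exists (g i y); rewrite -cmap_cdiff -fxE fg.
exists (g (i + 1) y), 0; rewrite linear0 addr0 gf; split=> //.
by rewrite -cmap_cdiff dy linear0.
Qed.

Definition dshift X Y (h : @hom k DB X Y) :
    @hom k DB (complex_shift X) (complex_shift Y) :=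
  fmap (derived_shift B) h.

Lemma dshift_qmap X Y (f : chain_map X Y) : dshift (qmap f) = qmap (chain_shift f).
Proof. by []. Qed.

Lemma dshift_comp X Y Z (g : @hom k DB Y Z) (f : @hom k DB X Y) :
  dshift (g \oh f) =h dshift g \oh dshift f.
Proof. exact: (fmap_comp (derived_shift B)). Qed.

Lemma dshift_eq X Y (f g : @hom k DB X Y) : f =h g -> dshift f =h dshift g.
Proof. exact: (fmap_eq (derived_shift B)). Qed.

(** Faithfulness of the shift is read off on chain maps, which represent all morphisms out of [P]
    and on which the shift reflects homotopy. *)
Lemma dshift_perfect0 P X (f : @hom k DB P X) :
  perfect P -> dshift f =h @hzero k DB (complex_shift P) (complex_shift X) ->
  f =h @hzero k DB P X.
Proof.
move=> P_perf f0; have [f' f'E] := qmap_full f P_perf.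
apply: (heq_trans f'E); apply/qmap_eq0 => //.
apply: chain_shift_homotopic; apply/qmap_inj; first exact: perfect_shift.
rewrite -!dshift_qmap -(dshift_eq f'E) f0.
by symmetry; apply: (fmap_zero (derived_shift B)).
Qed.

Lemma distinguished_lift (X Y Z : DB) (u : hom X Y) (v : hom Y Z)
    (w : hom Z (derived_shift B X)) P (y : @hom k DB P Y) :
  perfect P -> derived_distinguished u v w -> v \oh y =h hzero (P : DB) Z ->
  exists x : @hom k DB P X, u \oh x =h y.
Proof.
move=> P_perf [X' [Y' [f [a [b [c [[aI bI cI] [e1 e2 _]]]]]]]] vy0.
have [y' y'E] := qmap_full (b \oh y) P_perf.
have [x' x'E] : exists x' : chain_map P X', homotopic (chain_comp f x') y'.
  apply: cone_incl_lift; apply/qmap_inj => //.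
  rewrite qmap_comp qmap_zero -y'E hcomp_assoc.
  have <- : c \oh v =h qmap (cone_incl f) \oh b := e2.
  by rewrite -hcomp_assoc vy0 hcomp0r.
have [a' [a'a aa']] := aI; exists (a' \oh qmap x'); apply: (is_iso_mono bI).
rewrite y'E !hcomp_assoc e1 -(hcomp_assoc _ a) aa' hcomp_idr.
have <- : qmap (chain_comp f x') =h qmap y' by apply: qmap_homotopic.
by rewrite qmap_comp.
Qed.

Definition short_exact X Y Z (f : chain_map X Y) (g : chain_map Y Z) : Prop :=
  [/\ forall i, injective (f i), forall i z, exists y, g i y = z &
      forall i y, g i y = 0 <-> exists x, y = f i x].

Lemma short_exact_shift X Y Z (f : chain_map X Y) (g : chain_map Y Z) :
  short_exact f g -> short_exact (chain_shift f) (chain_shift g).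
Proof.
by move=> [fi gs fg]; split=> i; [apply: fi | apply: gs | apply: fg].
Qed.

(** Lift the null-homotopy of $gy$ degreewise to [Y] and subtract its boundary from [y]. The result
    is homotopic to [y] and is killed by [g] on the nose, so it factors through [f]. *)
Lemma short_exact_lift X Y Z P (f : chain_map X Y) (g : chain_map Y Z)
    (y : chain_map P Y) :
  perfect P -> short_exact f g ->
  homotopic (chain_comp g y) (chain_zero P Z) ->
  exists x : chain_map P X, homotopic (chain_comp f x) y.
Proof.
move=> P_perf [f_inj g_surj fgP] /homotopic0P[h hE].
have /dep_choice[h' h'E] : forall i, exists h' : {linear P (i + 1) -> Y i},
    forall x, g i (h' x) = h i x.
  by move=> i; apply: projective_lift => // x; apply: g_surj.
have [t tE] := @reindex_family (fun i => {linear P i -> Y i})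
  (fun i => [the {linear P (i + 1) -> Y (i + 1)} of
     y (i + 1) \- ((cdiff Y i \o h' i) \+ (h' (i + 1) \o cdiff P (i + 1)))]).
have gt : forall i x, g i (t i x) = 0.
  apply: int_succ_ind => i x; rewrite tE /= [LHS]linearB [g _ (_ + _)]linearD cmap_cdiff !h'E.
  by rewrite -hE /= subrr.
have /dep_choice[x xE] : forall i, exists x : {linear P i -> X i},
    forall p, f i (x p) = t i p.
  move=> i; apply: factor_inj => // p.
  by have /fgP[q qE] := gt i p; exists q.
have xd : forall i p, x (i + 1) (cdiff P i p) = cdiff X i (x i p).
  apply: int_succ_ind => i p; apply: f_inj; rewrite (cmap_cdiff f) !xE !tE /=.
  rewrite [in RHS]linearB [cdiff Y _ (_ + _)]linearD /= !cdiff_cdiff -cmap_cdiff linear0.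
  by congr (_ - _); rewrite [LHS]addr0 [RHS]add0r.
exists (ChainMap xd); apply: homotopic_sym.
exists h' => i p; rewrite /= xE tE /= opprB [LHS]addrC; apply: subrK.
Qed.

Lemma short_exact_cone X Y (f : chain_map X Y) :
  short_exact (cone_incl f) (cone_proj f).
Proof.
split=> [i x y [] //|i z|i [x y]]; first by exists (z, 0).
split=> [/= ->|[y' /= [-> _]] //]; by exists y.
Qed.

End Derived.

(** * Twisted sums *)

Lemma prod_finitely_generated (B : pzRingType) (M N : lmodType B) :
  finitely_generated M -> finitely_generated N ->
  finitely_generated (M * N)%type.
Proof.
move=> [m [v vP]] [n [w wP]].
exists (m + n)%N, (fun j => match split j with
  | inl j => (v j, 0) | inr j => (0, w j) end) => -[x y].
have [a xE] := vP x; have [b yE] := wP y.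
exists (fun j => match split j with inl j => a j | inr j => b j end).
rewrite big_split_ord /= xE yE; pose i1 (x : M) : (M * N)%type := (x, 0).
pose i2 (y : N) : (M * N)%type := (0, y).
have i1L : linear i1 by move=> c p q; rewrite /i1; congr pair; rewrite /= scaler0 addr0.
have i2L : linear i2 by move=> c p q; rewrite /i2; congr pair; rewrite /= scaler0 addr0.
rewrite (eq_bigr (fun j => lin i1L (a j *: v j))); last first.
  by move=> j _; rewrite (unsplitK (inl j : 'I_m + 'I_n)) linearZ.
rewrite [X in _ + X](eq_bigr (fun j => lin i2L (b j *: w j))); last first.
  by move=> j _; rewrite (unsplitK (inr j : 'I_m + 'I_n)) linearZ.
rewrite -!linear_sum /= /i1 /i2; congr pair; by rewrite /= ?addr0 ?add0r.
Qed.

Section Twist.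
Context (k : fieldType) (B : algType k) (P G : complex B).
Context (u : chain_map P (complex_shift G)).

Definition twist_diff (i : int) (x : P i * G i) : P (i + 1) * G (i + 1) :=
  (cdiff P i x.1, (u i x.1 : G (i + 1)) + cdiff G i x.2).

Lemma twist_diff_linear i : linear (@twist_diff i).
Proof.
move=> b x y; rewrite /twist_diff /=; congr pair; rewrite /= !linearP //.
by rewrite scalerDr addrACA.
Qed.

(** The cocone of [u], an extension of [P] by [G]. Its direct description needs no transport between
    degrees, unlike a desuspended cone. *)
Definition twist : complex B.
Proof.
apply: (@Complex k B (fun i => (P i * G i)%type) (fun i => lin (@twist_diff_linear i))).
- move=> i x; rewrite /= /twist_diff /= cdiff_cdiff; congr pair.
  by rewrite cmap_cdiff linearD cdiff_cdiff /= /shift_diff [_ + 0]addr0; apply: addNr.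
- by move=> i; apply: prod_finitely_generated; apply: cobj_fg.
- have [m P0] := cobj_bounded P; have [n G0] := cobj_bounded G.
  exists (maxn m n) => i; rewrite gtn_max => /andP[mi ni] [x y].
  by rewrite (P0 i mi x) (G0 i ni y).
Defined.

Definition twist_proj : chain_map twist P.
Proof.
exists (fun i => [the {linear (P i * G i)%type -> P i} of fst]); by [].
Defined.

Lemma twist_in_linear i : linear (fun x : G i => (0, x) : twist i).
Proof. by move=> b x y; congr pair; rewrite /= scaler0 addr0. Qed.

Definition twist_incl : chain_map G twist.
Proof.
apply: (@ChainMap k B G twist (fun i => lin (@twist_in_linear i))) => i x /=.
by rewrite /twist_diff /= !linear0 add0r.
Defined.

Lemma short_exact_twist : short_exact twist_incl twist_proj.
Proof.
split=> [i x y [] //|i z|i [x y]]; first by exists (z, 0).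
split=> [/= ->|[y' /= [-> _]] //]; by exists y.
Qed.

(** The projection to [G] is the contraction. Hence attaching [G] along [u] is the way to kill
    [u]. *)
Lemma twist_null : homotopic (chain_comp u twist_proj)
  (chain_zero twist (complex_shift G)).
Proof.
apply/homotopic0P.
have sndL i : linear (fun x : twist (i + 1) => x.2) by [].
exists (fun i => lin (sndL i)).
move=> i [x y] /=; rewrite /shift_diff /= [RHS]addrC addrK //.
Qed.

Lemma perfect_twist : perfect P -> perfect G -> perfect twist.
Proof. by move=> P_perf G_perf i; apply: prod_projective. Qed.

End Twist.

(** The map is $x\mapsto(fx,0)$. As [g] is surjective, the [Z]-component of a cocycle of the cone
    can be removed by a boundary, and what remains lies in the image of [f]. *)
Lemma short_exact_cone_quasi_isomorphism (k : fieldType) (B : algType k)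
    (X Y Z : complex B) (f : chain_map X Y) (g : chain_map Y Z) :
  short_exact f g ->
  exists q : chain_map (complex_shift X) (cone g),
    quasi_isomorphism (q : @hom k (complexes B) _ _).
Proof.
move=> [f_inj g_surj fgP].
have gf i x : g i (f i x) = 0 by apply/fgP; exists x.
have qL i : linear (fun x : X (i + 1) => (f (i + 1) x, 0) : cone g i).
  by move=> b x y; congr pair; rewrite /= ?scaler0 ?addr0 // linearP.
have qd i x : lin (qL (i + 1)) (cdiff (complex_shift X) i x) =
              cdiff (cone g) i (lin (qL i) x).
  rewrite /= /cone_diff /shift_diff /=; congr pair.
    by rewrite linearN cmap_cdiff.
  by rewrite gf linear0 addr0.
exists (@ChainMap k B (complex_shift X) (cone g) (fun i => lin (qL i)) qd) => i.
split=> [x _ [[y z]] /= [fxE /eqP]|[y z] /= [/eqP + /eqP]].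
  rewrite eq_sym addr_eq0 => /eqP gy.
  have [y' zE] := g_surj _ z.
  have /fgP[x' x'E] : g (i + 1) (y + cdiff Y i y') = 0.
    by rewrite linearD gy cmap_cdiff zE addNr.
  exists x'; rewrite /shift_diff; apply: f_inj.
  rewrite fxE linearN cmap_cdiff -x'E linearD cdiff_cdiff [_ + 0]addr0 //.
rewrite oppr_eq0 addr_eq0 => /eqP dy /eqP gy.
have [y' zE] := g_surj _ z.
have /fgP[x xE] : g (i + 1 + 1) (y + cdiff Y (i + 1) y') = 0.
  by rewrite linearD gy cmap_cdiff zE addNr.
exists x, (y', 0); rewrite /shift_diff /cone_diff /=; split.
  apply/eqP; rewrite oppr_eq0; apply/eqP/f_inj.
  by rewrite cmap_cdiff -xE linearD dy cdiff_cdiff linear0 [LHS]addr0.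
by congr pair; rewrite /= ?linear0 ?addr0 ?add0r ?zE // -xE addrK.
Qed.

(** * Iterated shifts *)

Section IteratedShift.
Context (k : fieldType) (B : algType k).
Implicit Types X Y Z P : complex B.
Local Notation DB := (derived_category B).

Definition nshift (n : nat) X : complex B := iter n (@complex_shift k B) X.

Fixpoint chain_nshift (n : nat) X Y (f : chain_map X Y) :
    chain_map (nshift n X) (nshift n Y) :=
  if n is n'.+1 then chain_shift (chain_nshift n' f) else f.

Lemma nshiftSr n X : nshift n (complex_shift X) = nshift n.+1 X.
Proof. by rewrite /nshift -iterSr. Qed.

Lemma perfect_nshift n P : perfect P -> perfect (nshift n P).
Proof. by move=> P_perf; elim: n => //= n; apply: perfect_shift. Qed.

Lemma isomorphic_nshift n X Y :
  @isomorphic k DB X Y -> @isomorphic k DB (nshift n X) (nshift n Y).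
Proof.
move=> XY; elim: n => //= n [f fI].
by exists (dshift f); apply: (fmap_is_iso (derived_shift B) fI).
Qed.

Lemma short_exact_nshift n X Y Z (f : chain_map X Y) (g : chain_map Y Z) :
  short_exact f g -> short_exact (chain_nshift n f) (chain_nshift n g).
Proof. by move=> fg; elim: n => //= n; apply: short_exact_shift. Qed.

Lemma chain_nshift_comp n X Y Z (g : chain_map Y Z) (f : chain_map X Y) :
  chain_eq (chain_nshift n (chain_comp g f))
           (chain_comp (chain_nshift n g) (chain_nshift n f)).
Proof. by elim: n => //= n IHn i x; apply: IHn. Qed.

Lemma chain_nshift_null n X Y (f : chain_map X Y) :
  homotopic f (chain_zero X Y) ->
  homotopic (chain_nshift n f) (chain_zero (nshift n X) (nshift n Y)).
Proof.
move=> f0; elim: n => //= n /homotopic0P[h hE]; apply/homotopic0P.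
exists (fun i => [the {linear nshift n X (i + 1 + 1) -> nshift n Y (i + 1)} of
   \- h (i + 1)]) => i x /=.
by rewrite hE /shift_diff !linearN !opprK.
Qed.

Lemma chain_nshift_full n X Y (f : chain_map (nshift n X) (nshift n Y)) :
  exists g : chain_map X Y, chain_eq (chain_nshift n g) f.
Proof.
elim: n f => [|n IHn] f; first by exists f.
have [g gE] := chain_shift_full f; have [g' g'E] := IHn g.
by exists g' => i x /=; rewrite g'E; apply: gE.
Qed.

Definition chain_iso X Y : Prop :=
  exists (f : chain_map X Y) (g : chain_map Y X),
    (forall i, cancel (f i) (g i)) /\ (forall i, cancel (g i) (f i)).

Lemma chain_iso_shift X Y :
  chain_iso X Y -> chain_iso (complex_shift X) (complex_shift Y).
Proof.
by move=> [f [g [fg gf]]]; exists (chain_shift f), (chain_shift g); split=> i x /=;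
  rewrite ?fg ?gf.
Qed.

Lemma chain_iso_trans X Y Z : chain_iso X Y -> chain_iso Y Z -> chain_iso X Z.
Proof.
move=> [f [g [fg gf]]] [f' [g' [fg' gf']]].
by exists (chain_comp f' f), (chain_comp g g'); split=> i x /=;
  rewrite ?fg' ?fg ?gf ?gf'.
Qed.

Lemma chain_iso_sym X Y : chain_iso X Y -> chain_iso Y X.
Proof. by move=> [f [g [fg gf]]]; exists g, f. Qed.

Lemma chain_iso_isomorphic X Y : chain_iso X Y -> @isomorphic k DB X Y.
Proof.
move=> [f [g [fg gf]]]; exists (qmap f); apply: qmap_iso.
exact: bijective_quasi_isomorphism fg gf.
Qed.

Lemma chain_iso_unshift X : chain_iso X (complex_shift (unshift X)).
Proof.
exists (unshift_in X), (unshift_out X).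
by split; [apply: unshift_inK | apply: unshift_outK].
Qed.

Lemma nshift_ess_surj n X : exists Y, chain_iso X (nshift n Y).
Proof.
elim: n => [|n [Y XY]].
  by exists X, (chain_id X), (chain_id X).
exists (unshift Y); rewrite -nshiftSr; apply: (chain_iso_trans XY).
elim: (n) => [|m]; [exact: chain_iso_unshift | exact: chain_iso_shift].
Qed.

End IteratedShift.

(** * Denominators *)

Section Thick.
Context (k : fieldType) (D : triangulated_data k) (T : D).

Lemma thick_base : thick T T.
Proof. by move=> N. Qed.

Lemma thick_iso (X Y : D) : isomorphic X Y -> thick T X -> thick T Y.
Proof.
move=> XY TX N N_thick NT; have [[N_iso _ _] _] := N_thick.
exact: N_iso XY (TX N N_thick NT).
Qed.

Lemma thick_shift (X : D) : thick T X <-> thick T (shift D X).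
Proof.
split=> TX N N_thick NT; have [[_ NS _] _] := N_thick.
  exact: (iffLR (NS X) (TX N N_thick NT)).
exact: (iffRL (NS X) (TX N N_thick NT)).
Qed.

End Thick.

Section Denominators.
Context (k : fieldType) (B : algType k) (U : lmodType B).
Context (U_fg : finitely_generated U) (U_proj : projective_module U).
Implicit Types X Y Z P G : complex B.
Local Notation DB := (derived_category B).

(** Being isomorphic to [M] in degree [j], rather than being a given shift of [stalk], is stable
    under isomorphism of complexes, so that shifts and desuspensions stay within the notion. *)
Definition concentrated (M : lmodType B) (j : int) X : Prop :=
  (forall i, i != j -> zero_module (X i)) /\ module_iso M (X j).

Lemma concentrated_shift M j X :
  concentrated M j (complex_shift X) <-> concentrated M (j + 1) X.
Proof.
split=> [[X0 Xj]|[X0 Xj]]; split=> //.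
  apply: int_succ_ind => i ij; apply: X0.
  by apply/eqP; move/eqP: ij => + ij; rewrite ij.
by move=> i ij; apply: X0; apply/eqP => /(addIr 1) /eqP; apply/negP.
Qed.

Lemma concentrated_nshift M n j X :
  concentrated M j (nshift n X) <-> concentrated M (j + n%:Z) X.
Proof.
elim: n j => [|n IHn] j; first by rewrite addr0.
rewrite concentrated_shift IHn.
by have -> : j + 1 + n%:Z = j + n.+1%:Z by lia.
Qed.

Lemma concentrated_iso M j X Y :
  chain_iso X Y -> concentrated M j X -> concentrated M j Y.
Proof.
move=> [f [g [fg gf]]] [X0 Xj]; split.
  by move=> i ij y; rewrite -(gf i y) (X0 i ij (g i y)) linear0.
by apply: (module_iso_trans Xj); exists (f j), (g j).
Qed.

Lemma concentrated_stalk M (M_fg : finitely_generated M) :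
  concentrated M 0 (stalk M_fg).
Proof.
split=> [i /negPf i0|].
  by rewrite /= /stalk_obj i0 => x; apply/rowP => -[].
by exists [the {linear M -> M} of idfun], [the {linear M -> M} of idfun].
Qed.

Lemma concentrated_chain_iso M j X Y :
  concentrated M j X -> concentrated M j Y -> chain_iso X Y.
Proof.
move=> [X0 Xj] [Y0 Yj].
have /dep_choice[f fP] : forall i, exists f : {linear X i -> Y i},
    exists g : {linear Y i -> X i}, cancel f g /\ cancel g f.
  move=> i; have [->|ij] := eqVneq i j.
    exact: (module_iso_trans (module_iso_sym Xj) Yj).
  by apply: zero_iso; [apply: X0 | apply: Y0].
have {fP}/dep_choice[g fg] := fP.
have d0 (V W : complex B) (h : forall i, {linear V i -> W i}) :
    (forall i, i != j -> zero_module (V i)) ->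
    (forall i, i != j -> zero_module (W i)) ->
    forall i x, h (i + 1) (cdiff V i x) = cdiff W i (h i x).
  move=> V0 W0 i x; have [ij|ij] := eqVneq (i + 1) j.
    by rewrite (V0 i _ x) ?linear0 ?linear0 //; apply/eqP; lia.
  by rewrite (W0 _ ij (h _ _)) (W0 _ ij (cdiff W _ _)).
exists (ChainMap (d0 _ _ f X0 Y0)), (ChainMap (d0 _ _ g Y0 X0)).
by split=> i x /=; case: (fg i).
Qed.

Local Notation thickU := (@thick k (Db B) (stalk U_fg : Db B)).

(** Induction on $|j|$, moving [G] towards degree 0 by a shift or a desuspension; membership in
    [thickU] passes both ways along a shift. *)
Lemma thick_concentrated j G : concentrated U j G -> thickU G.
Proof.
have thick_chain_iso X Y : chain_iso X Y -> thickU X -> thickU Y.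
  by move=> /chain_iso_isomorphic; apply: (@thick_iso k (Db B)).
have [m jm] : exists m : nat, j = m%:Z \/ j = - m%:Z.
  by exists `|j|%N; lia.
case: jm => -> {j}; elim: m G => [|m IHm] G Gj.
- exact: thick_chain_iso (concentrated_chain_iso (concentrated_stalk U_fg) Gj)
                         (@thick_base _ _ _).
- apply/(@thick_shift k (Db B)); apply: IHm; apply/concentrated_shift.
  by have -> : m%:Z + 1 = m.+1%:Z by lia.
- exact: thick_chain_iso (concentrated_chain_iso (concentrated_stalk U_fg) Gj)
                         (@thick_base _ _ _).
- apply: (thick_chain_iso _ _ (chain_iso_sym (chain_iso_unshift G))).
  apply/(@thick_shift k (Db B) _ (unshift G : Db B)); apply: IHm.
  have := concentrated_iso (chain_iso_unshift G) Gj.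
  move/concentrated_shift.
  by have -> : - m.+1%:Z + 1 = - m%:Z by lia.
Qed.

Definition cell (c : int) G : Prop := exists2 j, c <= j & concentrated U j G.

Definition vanishes_below (c : int) P : Prop := forall i, i < c -> zero_module (P i).

Lemma cell_perfect c G : cell c G -> perfect G.
Proof.
move=> [j _ [G0 Gj]] i; have [->|/G0] := eqVneq i j.
  exact: iso_projective Gj U_proj.
exact: zero_projective.
Qed.

(* [P'] is [P] with finitely many cells, i.e. shifts of [U] in degrees at
   least [c], attached. *)
Inductive denominator (c : int) P : forall P', chain_map P' P -> Prop :=
| denominator_id : denominator c (chain_id P)
| denominator_step P' (s : chain_map P' P) G (u : chain_map P' (complex_shift G)) :
    denominator c s -> cell c G -> denominator c (chain_comp s (twist_proj u)).

Lemma denominator_perfect c P P' (s : chain_map P' P) :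
  denominator c s -> perfect P -> perfect P'.
Proof.
move=> sD P_perf; elim: sD => {P' s} // P' s G u _ P'_perf /cell_perfect G_perf.
exact: perfect_twist.
Qed.

Lemma denominator_below c P P' (s : chain_map P' P) :
  denominator c s -> vanishes_below c P -> vanishes_below c P'.
Proof.
move=> sD P0; elim: sD => {P' s} // P' s G u _ P'0 [j cj [G0 _]] i ic [x y].
rewrite (P'0 i ic x) (G0 i _ y) //; apply/eqP; lia.
Qed.

Lemma denominator_comp c P P' P'' (s : chain_map P' P) (s' : chain_map P'' P') :
  denominator c s -> denominator c s' ->
  exists2 t : chain_map P'' P, denominator c t & chain_eq t (chain_comp s s').
Proof.
move=> sD s'D; elim: s'D => {P'' s'} [|P'' s' G u _ [t tD tE] Gc].
  by exists s.
exists (chain_comp t (twist_proj u)); first exact: denominator_step.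
by move=> i x /=; rewrite tE.
Qed.

(** The Ore condition: the cells of [s] are attached to [P1] along the composed attaching maps, and
    the twist of $uh'$ maps to the twist of $u$. *)
Lemma denominator_pullback c P P' (s : chain_map P' P) P1 (h : chain_map P1 P) :
  denominator c s ->
  exists P1' (s1 : chain_map P1' P1) (h' : chain_map P1' P'),
    denominator c s1 /\ chain_eq (chain_comp h s1) (chain_comp s h').
Proof.
elim=> {P' s} [|P' s G u sD [P1' [s1 [h' [s1D s1E]]]] Gc].
  by exists P1, (chain_id P1), h; split=> //; apply: denominator_id.
have h2L i : linear (fun x : twist (chain_comp u h') i => (h' i x.1, x.2) : twist u i).
  by move=> b x y; rewrite /= linearP.
have h2d i x : lin (h2L (i + 1)) (cdiff (twist (chain_comp u h')) i x) =
               cdiff (twist u) i (lin (h2L i) x).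
  by rewrite /= /twist_diff /= cmap_cdiff.
exists (twist (chain_comp u h')), (chain_comp s1 (twist_proj (chain_comp u h'))).
exists (@ChainMap k B (twist (chain_comp u h')) (twist u) (fun i => lin (h2L i)) h2d).
split; first exact: denominator_step.
by move=> i x /=; have /= -> := s1E i x.1.
Qed.

Fixpoint dnshift n X Y (h : @hom k DB X Y) : @hom k DB (nshift n X) (nshift n Y) :=
  if n is n'.+1 then dshift (dnshift n' h) else h.

Lemma dnshift_eq n X Y (f g : @hom k DB X Y) : f =h g -> dnshift n f =h dnshift n g.
Proof. by move=> fg; elim: n => //= n; apply: dshift_eq. Qed.

Lemma dnshift_comp n X Y Z (g : @hom k DB Y Z) (f : @hom k DB X Y) :
  dnshift n (g \oh f) =h dnshift n g \oh dnshift n f.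
Proof.
elim: n => [|n IHn]; first exact: heq_refl.
exact: heq_trans (dshift_eq IHn) (dshift_comp _ _).
Qed.

Lemma dnshift_id n X : dnshift n (@hid k DB X) =h @hid k DB (nshift n X).
Proof.
elim: n => [|n IHn]; first exact: heq_refl.
exact: heq_trans (dshift_eq IHn) (fmap_id (derived_shift B) _).
Qed.

(* Shifting [P] as well makes this property visibly invariant under
   desuspension. *)
Definition negligible (Z : DB) : Prop :=
  forall c P a b (g : @hom k DB (nshift a P) (nshift b (Z : complex B))),
    perfect P -> vanishes_below c P ->
    exists P' (s : chain_map P' P), denominator c s /\
      g \oh qmap (chain_nshift a s) =h @hzero k DB (nshift a P') (nshift b Z).

Lemma negligible_iso (X Y : DB) : isomorphic X Y -> negligible X -> negligible Y.
Proof.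
move=> XY NX c P a b g P_perf P0.
have [f fI] := isomorphic_nshift b XY; have [f' [f'f ff']] := fI.
have [P' [s [sD gs]]] := NX c P a b (f' \oh g) P_perf P0.
exists P', s; split=> //; apply: (@is_iso_mono k DB _ _ _ f'); first by exists f.
by rewrite hcomp_assoc gs hcomp0r.
Qed.

Lemma negligible_shift (X : DB) : negligible X <-> negligible (derived_shift B X).
Proof.
split=> NX c P a b.
  by rewrite [nshift b _]nshiftSr => g; apply: NX.
move=> g P_perf P0.
have := NX c P a.+1 b; rewrite [nshift b _]nshiftSr => /(_ (dshift g) P_perf P0).
move=> [P' [s [sD gs]]]; exists P', s; split=> //.
apply: dshift_perfect0.
  by apply: perfect_nshift; apply: denominator_perfect sD P_perf.
by rewrite dshift_comp.
Qed.

(** Two stages: a denominator kills the image in $X[1]$, so the map lifts to [Y] by exactness, and a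
    second denominator kills the lift. *)
Lemma negligible_cone X Y (f : chain_map X Y) :
  negligible X -> negligible Y -> negligible (cone f).
Proof.
move=> /negligible_shift NX NY c P a b g P_perf P0.
have [g' g'E] := qmap_full g (perfect_nshift P_perf).
have [P' [s [sD gs]]] := NX c P a b
  (qmap (chain_comp (chain_nshift b (cone_proj f)) g')) P_perf P0.
have P'_perf := denominator_perfect sD P_perf.
have [|l lE] := @short_exact_lift k B _ _ _ (nshift a P') _ _
    (chain_comp g' (chain_nshift a s)) (@perfect_nshift k B a _ P'_perf)
    (short_exact_nshift b (short_exact_cone f)).
  apply/(qmap_eq0 _ (@perfect_nshift k B a _ P'_perf)).
  by rewrite -gs !qmap_comp hcomp_assoc.
have [P'' [s' [s'D ls']]] := NY c P' a b (qmap l) P'_perf (denominator_below sD P0).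
have [t tD tE] := denominator_comp sD s'D.
exists P'', t; split=> //.
have -> : qmap (chain_nshift a t) =h qmap (chain_nshift a s) \oh qmap (chain_nshift a s').
  rewrite -qmap_comp; apply/qmap_homotopic/homotopic_chain_eq => i x.
  rewrite -chain_nshift_comp.
  by elim: (a) i x => [|a' IHa] i x; [apply: tE | apply: IHa].
rewrite hcomp_assoc g'E -qmap_comp -(qmap_homotopic lE) qmap_comp.
by rewrite -hcomp_assoc ls' hcomp0r.
Qed.

(** The map amounts to some $u:P\to E$ with [E] a shift of [U] placed in degree [j]. The cell that
    kills it is $E[-1]$, in degree $j+1$; if $j+1<c$ this cell is not allowed, but then [P] vanishes
    in degree [j] and $u=0$. *)
Lemma negligible_stalk : negligible (stalk U_fg : complex B).
Proof.
move=> c P a b g P_perf P0.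
have [g' g'E] := qmap_full g (perfect_nshift P_perf).
(* Writing the target as an [a]-fold shift makes the map an [a]-fold shift of a chain map out of [P]
   itself. *)
have [E stalkE] := nshift_ess_surj a (nshift b (stalk U_fg)).
have [j Ej] : exists j, concentrated U j E.
  exists (- b%:Z + a%:Z); apply/concentrated_nshift/(concentrated_iso stalkE).
  by apply/concentrated_nshift; rewrite addNr; apply: concentrated_stalk.
have [t [t' [tt' t't]]] := stalkE.
have [u uE] := chain_nshift_full (chain_comp t g').
suff [P' [s [sD us]]] : exists P' (s : chain_map P' P),
    denominator c s /\ homotopic (chain_comp u s) (chain_zero P' E).
  exists P', s; split=> //.
  have P'_perf := denominator_perfect sD P_perf.
  rewrite g'E -qmap_comp; apply/qmap_eq0; first exact: perfect_nshift.
  have us0 := chain_nshift_null a us.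
  apply: homotopic_trans (homotopic_trans _ (homotopic_comp (homotopic_refl t') us0)) _.
    apply: homotopic_sym; apply: homotopic_chain_eq => i x.
    by rewrite /= chain_nshift_comp /= uE /= tt'.
  by apply: homotopic_chain_eq => i x /=; rewrite linear0.
have [v [v' [vv' v'v]]] := chain_iso_unshift E.
have Gj : concentrated U (j + 1) (unshift E).
  by apply/concentrated_shift; apply: concentrated_iso Ej; exists v, v'.
have [cj|jc] := boolP (c <= j + 1).
  exists (twist (chain_comp v u)), (chain_comp (chain_id P) (twist_proj (chain_comp v u))).
  split; first by apply: denominator_step; [apply: denominator_id | exists (j + 1)].
  apply: homotopic_trans (homotopic_trans _
    (homotopic_comp (homotopic_refl v') (twist_null (chain_comp v u)))) _.
    by apply: homotopic_sym; apply: homotopic_chain_eq => i x /=; rewrite vv'.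
  by apply: homotopic_chain_eq => i x /=; rewrite linear0.
exists P, (chain_id P); split; first exact: denominator_id.
apply: homotopic_chain_eq => i x /=; have [ij|/(Ej.1 i)] := eqVneq i j; last exact.
by rewrite (P0 i _ x) ?linear0 //; lia.
Qed.

Lemma negligible_thick : @thick_subcategory k (Db B) negligible.
Proof.
split; last first.
  move=> X Y Z [i [j [p [q [pi _ _ _ _]]]]] NZ c P a b g P_perf P0.
  have [P' [s [sD gs]]] := NZ c P a b (dnshift b i \oh g) P_perf P0.
  exists P', s; split=> //.
  have pi_b : dnshift b p \oh dnshift b i =h @hid k DB (nshift b X).
    by rewrite -dnshift_comp (dnshift_eq b pi) dnshift_id.
  set r := g \oh _; rewrite -(hcomp_idl r) -pi_b -hcomp_assoc /r.
  by rewrite (hcomp_assoc _ g) gs hcomp0r.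
split; [exact: negligible_iso | exact: negligible_shift |].
move=> X Y Z u v w [X' [Y' [f [a [b [d [[aI bI dI] _]]]]]]] NX NY.
have dI' : @isomorphic k DB (cone f) Z.
  by have [d' [d'd dd']] := dI; exists d', d.
apply: (negligible_iso dI'); apply: negligible_cone.
  by apply: negligible_iso NX; exists a.
by apply: negligible_iso NY; exists b.
Qed.

End Denominators.

(** * Fractions *)

Section Fractions.
Context (k : fieldType) (B : algType k) (U : lmodType B).
Context (U_fg : finitely_generated U) (U_proj : projective_module U).
Implicit Types X Y Z P G : complex B.
Local Notation DB := (derived_category B).
Local Notation thickU := (@thick k (Db B) (stalk U_fg : Db B)).
Local Notation VQ := (@verdier_quotient k (Db B) thickU).

Definition vmap (X Y : DB) (f : @hom k DB X Y) : @hom k VQ X Y :=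
  fmap (loc_functor (@cone_in k (Db B) thickU)) f.

Lemma vmap_comp (X Y Z : DB) (g : @hom k DB Y Z) (f : @hom k DB X Y) :
  vmap (g \oh f) =h vmap g \oh vmap f.
Proof. exact: (fmap_comp (loc_functor (@cone_in k (Db B) thickU))). Qed.

Lemma vmap_eq (X Y : DB) (f g : @hom k DB X Y) : f =h g -> vmap f =h vmap g.
Proof. exact: (fmap_eq (loc_functor (@cone_in k (Db B) thickU))). Qed.

Lemma vmap_add (X Y : DB) (f g : @hom k DB X Y) :
  vmap (hadd f g) =h hadd (vmap f) (vmap g).
Proof. exact: (fmap_add (loc_functor (@cone_in k (Db B) thickU))). Qed.

Lemma vmap_scale (X Y : DB) c (f : @hom k DB X Y) :
  vmap (hscale c f) =h hscale c (vmap f).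
Proof. exact: (fmap_scale (loc_functor (@cone_in k (Db B) thickU))). Qed.

Lemma vmap_is_iso (X Y : DB) (f : @hom k DB X Y) : is_iso f -> is_iso (vmap f).
Proof. exact: (fmap_is_iso (loc_functor (@cone_in k (Db B) thickU))). Qed.

Lemma vmap_cone_iso X Y (f : chain_map X Y) :
  thickU (cone f) -> is_iso (vmap (qmap f)).
Proof.
move=> Tf; have S : @cone_in k (Db B) thickU _ _ (qmap f).
  exists (cone f), (qmap (cone_incl f)), (qmap (cone_proj f)); split=> //.
  exists X, Y, f, (@hid k DB X), (@hid k DB Y), (@hid k DB (cone f)).
  split; first by split; apply: is_iso_id.
  split.
  - exact: heq_trans (@hcomp_idl k DB _ _ _) (heq_sym (@hcomp_idr k DB _ _ _)).
  - exact: heq_trans (@hcomp_idl k DB _ _ _) (heq_sym (@hcomp_idr k DB _ _ _)).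
  - have sid : fmap (derived_shift B) (@hid k DB X) =h @hid k DB (complex_shift X).
      exact: (fmap_id (derived_shift B)).
    apply: heq_trans (heq_comp sid (heq_refl _)) _.
    exact: heq_trans (@hcomp_idl k DB _ _ _) (heq_sym (@hcomp_idr k DB _ _ _)).
by exists (Finv S); split; [apply: Finv_l | apply: Finv_r].
Qed.

Lemma vmap_short_exact_iso X Y Z (f : chain_map X Y) (g : chain_map Y Z) :
  short_exact f g -> thickU X -> is_iso (vmap (qmap g)).
Proof.
move=> /short_exact_cone_quasi_isomorphism[q /qmap_iso qI] TX.
apply: vmap_cone_iso; apply: (@thick_iso k (Db B) _ (complex_shift X : Db B)).
  by exists (qmap q).
exact: (iffLR (@thick_shift k (Db B) _ (X : Db B))).
Qed.

Lemma vmap_denominator_iso c P P' (s : chain_map P' P) :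
  denominator U c s -> is_iso (vmap (qmap s)).
Proof.
elim=> {P' s} [|P' s G u _ sI [j _ Gj]].
  by apply: vmap_is_iso; apply: is_iso_heq (heq_sym (qmap_id P)) (is_iso_id _).
have pI := vmap_short_exact_iso (short_exact_twist u) (thick_concentrated Gj).
apply: is_iso_heq (is_iso_comp sI pI).
by rewrite -vmap_comp; apply: vmap_eq; rewrite qmap_comp.
Qed.

Section Source.
Context (c : int) (P : complex B) (P_perf : perfect P) (P0 : vanishes_below c P).

Definition is_fraction (Y : VQ) (g : @hom k VQ P Y) : Prop :=
  exists P' (s : chain_map P' P) (f : chain_map P' Y),
    denominator U c s /\ g \oh vmap (qmap s) =h vmap (qmap f).

Lemma fraction_refine P1 P2 (s1 : chain_map P1 P) (s2 : chain_map P2 P) :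
  denominator U c s1 -> denominator U c s2 ->
  exists P3 (s3 : chain_map P3 P) (t1 : chain_map P3 P1) (t2 : chain_map P3 P2),
    [/\ denominator U c s3, qmap s3 =h qmap s1 \oh qmap t1 &
        qmap s3 =h qmap s2 \oh qmap t2].
Proof.
move=> s1D s2D.
have [P3 [t1 [t2 [t1D t1E]]]] := denominator_pullback s1 s2D.
have [s3 s3D s3E] := denominator_comp s1D t1D.
exists P3, s3, t1, t2; split=> //; rewrite -qmap_comp.
  by apply/qmap_homotopic/homotopic_chain_eq.
by apply/qmap_homotopic/homotopic_chain_eq => i x; rewrite s3E t1E.
Qed.

Lemma is_fraction_eq (Y : VQ) (g g' : @hom k VQ P Y) :
  g =h g' -> is_fraction g -> is_fraction g'.
Proof.
by move=> gg' [P' [s [f [sD sE]]]]; exists P', s, f; split=> //; rewrite -gg'.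
Qed.

Lemma is_fraction_add (Y : VQ) (g g' : @hom k VQ P Y) :
  is_fraction g -> is_fraction g' -> is_fraction (hadd g g').
Proof.
move=> [P1 [s1 [f1 [s1D g1E]]]] [P2 [s2 [f2 [s2D g2E]]]].
have [P3 [s3 [t1 [t2 [s3D s31 s32]]]]] := fraction_refine s1D s2D.
exists P3, s3, (chain_add (chain_comp f1 t1) (chain_comp f2 t2)); split=> //.
rewrite (vmap_eq (qmap_add _ _)) vmap_add hcomp_addl.
apply: heq_add.
  rewrite (vmap_eq s31) (vmap_eq (qmap_comp _ _)) !vmap_comp -g1E.
  exact: (@hcomp_assoc k VQ).
rewrite (vmap_eq s32) (vmap_eq (qmap_comp _ _)) !vmap_comp -g2E.
exact: (@hcomp_assoc k VQ).
Qed.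

Lemma is_fraction_scale (Y : VQ) a (g : @hom k VQ P Y) :
  is_fraction g -> is_fraction (hscale a g).
Proof.
move=> [P1 [s1 [f1 [s1D g1E]]]]; exists P1, s1, (chain_scale a f1); split=> //.
by rewrite hcomp_scalel g1E (vmap_eq (qmap_scale _ _)) vmap_scale.
Qed.

(** Induction on the word [h]. For the formal inverse of [t], the cone [Z] of [t] is negligible, so
    after a further denominator the numerator dies in [Z] and lifts through [t]. *)
Lemma is_fraction_comp (X Y : VQ) (h : @hom k VQ X Y) (g : @hom k VQ P X) :
  is_fraction g -> is_fraction (h \oh g).
Proof.
elim: h g => {X Y} [X Y h|X Y t tS|X Y Z h IHh h' IHh'|X Y h IHh h' IHh'|X Y a h IHh] g gF.
- have [P' [s [f [sD gE]]]] := gF.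
  have P'_perf := denominator_perfect U_proj sD P_perf.
  have [f' f'E] := qmap_full (h \oh qmap f) P'_perf.
  exists P', s, f'; split=> //.
  rewrite -(vmap_eq f'E) vmap_comp -gE.
  exact/heq_sym/(@hcomp_assoc k VQ).
- have [P' [s [f [sD gE]]]] := gF.
  have P'_perf := denominator_perfect U_proj sD P_perf.
  have P'0 := denominator_below sD P0.
  have [Z [v [w [tvw TZ]]]] := tS.
  (* Membership in [thick] is a statement about all thick subcategories; it is applied to the
     negligible objects. *)
  have NZ : negligible U Z.
    by apply: (TZ (negligible U)); [apply: negligible_thick U_proj | apply: (negligible_stalk U_proj)].
  have [P'' [s' [s'D vfs]]] := NZ c P' 0%N 0%N (v \oh qmap f) P'_perf P'0.
  have P''_perf := denominator_perfect U_proj s'D P'_perf.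
  have [|x xE] := distinguished_lift (y := qmap f \oh qmap s') P''_perf tvw.
    by rewrite hcomp_assoc; exact: vfs.
  have [x' x'E] := qmap_full x P''_perf.
  have [s'' s''D s''E] := denominator_comp sD s'D.
  exists P'', s'', x'; split=> //.
  have s''E' : qmap s'' =h qmap s \oh qmap s'.
    by rewrite -qmap_comp; apply/qmap_homotopic/homotopic_chain_eq.
  have inv_t : (Finv tS : @hom k VQ Y X) \oh vmap t =h @hid k VQ X := Finv_l tS.
  rewrite (vmap_eq s''E') vmap_comp -hcomp_assoc (hcomp_assoc g) gE.
  rewrite -vmap_comp -(vmap_eq xE) vmap_comp hcomp_assoc inv_t.
  by apply: heq_trans (@hcomp_idl k VQ _ _ _) _; apply: vmap_eq.
- apply: is_fraction_eq (IHh _ (IHh' _ gF)).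
  exact: (@hcomp_assoc k VQ).
- apply: is_fraction_eq (is_fraction_add (IHh _ gF) (IHh' _ gF)).
  exact/heq_sym/(@hcomp_addl k VQ).
- apply: is_fraction_eq (is_fraction_scale a (IHh _ gF)).
  exact/heq_sym/(@hcomp_scalel k VQ).
Qed.

Lemma every_fraction (Y : VQ) (g : @hom k VQ P Y) : is_fraction g.
Proof.
apply: is_fraction_eq (@hcomp_idr k VQ P Y g) _; apply: is_fraction_comp.
exists P, (chain_id P), (chain_id P); split; first exact: denominator_id.
exact: (@hcomp_idl k VQ).
Qed.

End Source.

End Fractions.

(** * Complexes in one degree *)

Section ZeroModule.
Context (B : pzRingType).

Lemma row0_zero : zero_module [the lmodType B of 'rV[B]_0].
Proof. by move=> x; apply/rowP => -[]. Qed.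

Lemma zero_finitely_generated (M : lmodType B) :
  zero_module M -> finitely_generated M.
Proof.
move=> M0; exists 0%N, (fun=> 0) => x; exists (fun=> 0).
by rewrite big_ord0; apply: M0.
Qed.

End ZeroModule.

Section StalkAt.
Context (k : fieldType) (B : algType k) (j : int) (M : lmodType B).
Context (M_fg : finitely_generated M).

Definition stalk_at_obj (i : int) : lmodType B :=
  if i == j then M else [the lmodType B of 'rV[B]_0].

Lemma stalk_at_zero i : i != j -> zero_module (stalk_at_obj i).
Proof. by rewrite /stalk_at_obj => /negPf ->; apply: row0_zero. Qed.

Definition stalk_at : complex B.
Proof.
apply: (@Complex k B stalk_at_obj
  (fun i => [the {linear stalk_at_obj i -> stalk_at_obj (i + 1)} of \0])) => //.
- move=> i; rewrite /stalk_at_obj; case: ifP => // _.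
  exact: zero_finitely_generated (@row0_zero B).
- exists `|j|%N => i ji; apply: stalk_at_zero.
  by apply/eqP => ij; move: ji; rewrite ij ltnn.
Defined.

Lemma stalk_at_concentrated : concentrated M j stalk_at.
Proof.
split; first exact: stalk_at_zero.
rewrite /= /stalk_at_obj eqxx.
by exists [the {linear M -> M} of idfun], [the {linear M -> M} of idfun].
Qed.

End StalkAt.

Lemma concentrated_map (k : fieldType) (B : algType k) (M : lmodType B) (j : int)
    (X Y : complex B) (r : {linear X j -> M}) (f : {linear M -> Y j}) :
  (forall i, i != j -> zero_module (X i)) ->
  (forall x, cdiff Y j (f x) = 0) ->
  exists g : chain_map X Y, forall x, g j x = f (r x).
Proof.
move=> X0 df.
pose g := dfwith (fun i => [the {linear X i -> Y i} of \0])
                 [the {linear X j -> Y j} of f \o r].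
have gd i x : g (i + 1) (cdiff X i x) = cdiff Y i (g i x).
  have [ij|ij] := eqVneq i j.
    subst i; rewrite /g dfwith_in /= df dfwith_out /=; last by apply/eqP; lia.
    by [].
  by rewrite (X0 i ij x) !linear0.
by exists (ChainMap gd) => x; rewrite /= /g dfwith_in.
Qed.

(** * Killing the cohomology supported on [e] *)

Section Local.
Context (k : fieldType) (B : algType k) (U : lmodType B).
Context (U_fg : finitely_generated U) (e : B) (eps : U).
Context (e_idem : e * e = e) (e_eps : e *: eps = eps).
Context (U_gen : forall u, exists b, u = b *: eps).
Context (U_free : forall (M : lmodType B) (x : M), e *: x = x ->
  exists f : {linear U -> M}, f eps = x).
Implicit Types X Y Z P G : complex B.
Local Notation DB := (derived_category B).
Local Notation thickU := (@thick k (Db B) (stalk U_fg : Db B)).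
Local Notation VQ := (@verdier_quotient k (Db B) thickU).

(** Multiplying any preimage of $f(\epsilon)$ by $e$ gives an element fixed by $e$ with the same
    image, since $e\epsilon=\epsilon$. *)
Lemma U_projective : projective_module U.
Proof.
move=> M N p f p_surj; have [x px] := p_surj (f eps).
have [g geps] : exists g : {linear U -> M}, g eps = e *: x.
  by apply: U_free; rewrite scalerA e_idem.
exists g => u; have [b ->] := U_gen u.
by rewrite !linearZ geps linearZ /= px -{2}e_eps linearZ.
Qed.

(* For right modules: [H^j(Y) e = 0] for [j >= c]. *)
Definition local_above (c : int) Y : Prop :=
  forall i : int, c <= i + 1 -> forall y : Y (i + 1),
    cdiff Y (i + 1) y = 0 -> e *: y = y -> exists w, y = cdiff Y i w.

(** The image of [eps] is a cocycle fixed by [e], hence a boundary $dw$. Replacing $w$ by $ew$ makes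
    it the image of [eps] under a map from [U], and this map is the homotopy. *)
Lemma concentrated_local_null c j G Y (f : chain_map G Y) :
  concentrated U j G -> c <= j -> local_above c Y -> homotopic f (chain_zero G Y).
Proof.
have -> : j = (j - 1) + 1 by rewrite subrK.
move: (j - 1) => {}j [G0 [r [r' [rr' r'r]]]] cj Y_loc.
have [||w wE] := Y_loc j cj (f (j + 1) (r eps)).
- rewrite -cmap_cdiff (G0 _ _ (cdiff G _ _)) ?linear0 //.
  by apply/eqP; lia.
- by rewrite -{2}e_eps linearZ linearZ.
have [g geps] : exists g : {linear U -> Y j}, g eps = e *: w.
  by apply: U_free; rewrite scalerA e_idem.
apply/homotopic0P.
exists (dfwith (fun i => [the {linear G (i + 1) -> Y i} of \0])
               [the {linear G (j + 1) -> Y j} of g \o r']) => i x.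
have [ij|ij] := eqVneq i j.
  subst i; rewrite dfwith_in dfwith_out /= ?[_ + 0]addr0; last by apply/eqP; lia.
  rewrite -{1}(r'r x); have [b ->] := U_gen (r' x).
  rewrite !linearZ /= wE geps; congr (_ *: _).
  by rewrite linearZ /= -wE -{1}e_eps linearZ linearZ.
have x0 : x = 0 by apply: G0; apply/eqP => /(addIr 1) /eqP; apply/negP.
by rewrite x0 !linear0 addr0.
Qed.

(** If [h] contracts the restriction of [f] to [G], then $x\mapsto f(x,0)-h(ux)$ is a chain map on
    [P], and [h] on the second component is the homotopy. *)
Lemma twist_local_factor c P G Y (u : chain_map P (complex_shift G))
    (f : chain_map (twist u) Y) :
  cell U c G -> local_above c Y ->
  exists f' : chain_map P Y, homotopic f (chain_comp f' (twist_proj u)).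
Proof.
move=> [j cj Gj] Y_loc.
have /homotopic0P[h hE] :=
  concentrated_local_null (chain_comp f (twist_incl u)) Gj cj Y_loc.
have inL i : linear (fun x : P i => (x, 0) : twist u i).
  by move=> b x y; congr pair; rewrite /= scaler0 addr0.
have [f' f'E] := @reindex_family (fun i => {linear P i -> Y i}) (fun i =>
  [the {linear P (i + 1) -> Y (i + 1)} of
     (f (i + 1) \o lin (inL (i + 1))) \- (h (i + 1) \o u (i + 1))]).
have splitE i (x : P i) (y : G i) :
    f i ((x, y) : twist u i) = f i ((x, 0) : twist u i) + f i ((0, y) : twist u i).
  by rewrite -linearD; congr (f i _); congr pair; rewrite /= ?addr0 ?add0r.
have fd i (x : P i) (y : G i) : cdiff Y i (f i ((x, y) : twist u i)) =
    f (i + 1) ((cdiff P i x, u i x + cdiff G i y) : twist u (i + 1)).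
  by rewrite -cmap_cdiff.
have f'd : forall i x, f' (i + 1) (cdiff P i x) = cdiff Y i (f' i x).
  apply: int_succ_ind => i x; rewrite !f'E /= [in RHS]linearB fd.
  rewrite linear0 [u _ _ + 0]addr0 [in RHS]splitE.
  have /= -> := hE (i + 1) (u (i + 1) x).
  rewrite cmap_cdiff /= /shift_diff linearN opprK.
  by rewrite -[RHS]addrA [_ + _ - _]addrAC subrr add0r.
exists (ChainMap f'd).
have hL i : linear (fun x : twist u (i + 1) => h i x.2).
  by move=> b x y; rewrite /= linearP.
exists (fun i => lin (hL i)) => i [x y] /=; rewrite f'E /= splitE.
have /= -> := hE i y; rewrite [h _ (_ + _)]linearD.
by rewrite opprB [LHS]addrC [LHS]addrA subrK [LHS]addrCA.
Qed.

Lemma denominator_local_factor c P P' (s : chain_map P' P) Y (f : chain_map P' Y) :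
  denominator U c s -> local_above c Y ->
  exists f' : chain_map P Y, homotopic f (chain_comp f' s).
Proof.
move=> sD Y_loc; elim: sD f => {P' s} [|P' s G u _ IH Gc] f.
  by exists f; apply: homotopic_refl.
have [f1 f1E] := twist_local_factor f Gc Y_loc; have [f2 f2E] := IH f1.
exists f2; apply: homotopic_trans f1E _.
exact: homotopic_comp f2E (homotopic_refl _).
Qed.

End Local.

Lemma short_exact_cone_quasi_isomorphism_r (k : fieldType) (B : algType k)
    (X Y Z : complex B) (f : chain_map X Y) (g : chain_map Y Z) :
  short_exact f g ->
  exists q : chain_map (cone f) Z,
    quasi_isomorphism (q : @hom k (complexes B) _ _).
Proof.
move=> [f_inj g_surj fgP].
have gf i x : g i (f i x) = 0 by apply/fgP; exists x.
have qL i : linear (fun x : cone f i => g i x.2).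
  by move=> b x y; rewrite /= linearP.
have qd i x : lin (qL (i + 1)) (cdiff (cone f) i x) = cdiff Z i (lin (qL i) x).
  by rewrite /= linearD gf cmap_cdiff [LHS]add0r.
exists (@ChainMap k B (cone f) Z (fun i => lin (qL i)) qd) => i.
split=> [[x y] /= [dx /eqP]|z dz].
  rewrite addr_eq0 => /eqP fx [z gyE].
  have [y'' zE] := g_surj _ z.
  have /fgP[x0 x0E] : g (i + 1) (y - cdiff Y i y'') = 0.
    by rewrite linearB gyE cmap_cdiff zE subrr.
  exists (x0, y''); rewrite /cone_diff /= -x0E; congr pair; last by rewrite subrK.
  apply: f_inj; rewrite linearN cmap_cdiff -x0E linearB cdiff_cdiff subr0.
  by rewrite fx.
have [y yE] := g_surj _ z.
have /fgP[x1 x1E] : g (i + 1 + 1) (cdiff Y (i + 1) y) = 0 by rewrite cmap_cdiff yE.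
exists (- x1, y), 0; rewrite /= linear0 [_ + 0]addr0 yE; split=> //.
rewrite /cone_diff /=; congr pair.
  by rewrite [cdiff X _ _]linearN opprK; apply: f_inj; rewrite cmap_cdiff -x1E cdiff_cdiff linear0.
by rewrite linearN x1E addNr.
Qed.

(** * Attaching cells to a complex *)

Section Replacement.
Context (k : fieldType) (B : algType k) (U : lmodType B).
Context (U_fg : finitely_generated U) (e : B) (eps : U).
Context (e_idem : e * e = e) (e_eps : e *: eps = eps).
Context (U_gen : forall u, exists b, u = b *: eps).
Context (U_free : forall (M : lmodType B) (x : M), e *: x = x ->
  exists f : {linear U -> M}, f eps = x).
(** The coefficients commute with [e] because they will come from the central ring $R$; then the
    elements $e z_l$ span the part of the kernel fixed by [e]. *)
Context (ker_fg : forall (M N : lmodType B) (f : {linear M -> N}),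
  finitely_generated M ->
  exists (n : nat) (z : 'I_n -> M), (forall l, f (z l) = 0) /\
    forall x, f x = 0 -> exists r : 'I_n -> B,
      (forall l, e * r l = r l * e) /\ x = \sum_l r l *: z l).
Implicit Types X Y Z P G : complex B.
Local Notation DB := (derived_category B).
Local Notation thickU := (@thick k (Db B) (stalk U_fg : Db B)).
Local Notation VQ := (@verdier_quotient k (Db B) thickU).

(** The part of $H^{i+1}(Y)$ fixed by [e] lies in the submodule generated by [n] of its classes; [n]
    counts the cells still to be attached in this degree. *)
Definition spanned n Y (i : int) : Prop :=
  exists z : 'I_n -> Y (i + 1),
    (forall l, cdiff Y (i + 1) (z l) = 0 /\ e *: z l = z l) /\
    forall y, cdiff Y (i + 1) y = 0 -> e *: y = y ->
      exists (b : 'I_n -> B) w, y = \sum_l b l *: z l + cdiff Y i w.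

(** Take the cone of the map from a cell in degree $i+1$ that sends [eps] to the first generator.
    The cone differs from [Y] in degree [i] only, so cocycles in degrees above [i] are unchanged,
    while that generator becomes a boundary. *)
Lemma attach_cell n Y (i : int) :
  spanned n.+1 Y i -> local_above e (i + 1 + 1) Y ->
  exists Y', [/\ @isomorphic k VQ Y Y', spanned n Y' i & local_above e (i + 1 + 1) Y'].
Proof.
move=> [z [zP z_span]] Y_loc; have [dz ez] := zP ord0.
have [f feps] := U_free ez.
have df u : cdiff Y (i + 1) (f u) = 0.
  by have [b ->] := U_gen u; rewrite !linearZ feps /= dz scaler0.
pose X := stalk_at (i + 1) U_fg.
have [X0 [r' [r [r'r rr']]]] : concentrated U (i + 1) X by apply: stalk_at_concentrated.
have [phi phiE] := @concentrated_map k B U (i + 1) X Y r f X0 df.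
have Xz j (x : X (j + 1)) : j != i -> x = 0.
  by move=> ji; apply: X0; apply/eqP => /(addIr 1) /eqP; apply/negP.
have i1 : i + 1 != i by apply/eqP; lia.
exists (cone phi); split.
- have TX : thickU (complex_shift X).
    apply/(@thick_shift k (Db B) _ (X : Db B)).
    by apply: thick_concentrated; apply: stalk_at_concentrated.
  exists (vmap U_fg (qmap (cone_incl phi))); apply: vmap_cone_iso.
  (* The cone of $Y\to\mathrm{Cone}(\phi)$ is $X[1]$ up to quasi-isomorphism, which lies in the
     thick subcategory. *)
  have [q /qmap_iso qI] := short_exact_cone_quasi_isomorphism_r (short_exact_cone phi).
  apply: (@thick_iso k (Db B) _ (complex_shift X : Db B)) => //.
  by apply: isomorphic_sym; exists (qmap q).
- exists (fun l => (0, z (lift ord0 l))); split.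
    move=> l; have [dzl ezl] := zP (lift ord0 l); split.
      by rewrite /= /cone_diff /= !linear0 dzl ?oppr0 [0 + 0]addr0.
    by congr pair; rewrite /= ?scaler0.
  move=> [g y]; rewrite (Xz _ g i1) => -[_ dy] [_ ey].
  have [b [w yE]] : exists b w, y = \sum_l b l *: z l + cdiff Y i w.
    by apply: z_span => //; move: dy; rewrite linear0 [0 + _]add0r.
  (* The term at the killed generator is the image under [phi] of this element of the cell. *)
  exists (fun l => b (lift ord0 l)), (r' (b ord0 *: eps), w).
  pose j2 (y : Y (i + 1)) : cone phi (i + 1) := (0, y).
  have j2L : linear j2 by move=> a p q; rewrite /j2; congr pair; rewrite /= scaler0 addr0.
  rewrite (eq_bigr (fun l => lin j2L (b (lift ord0 l) *: z (lift ord0 l)))); last first.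
    by move=> l _; rewrite linearZ.
  rewrite -linear_sum /= /j2 /cone_diff /= phiE r'r linearZ feps; congr pair.
    by rewrite /= ?oppr0 ?addr0.
  by rewrite /= yE big_ord_recl -[LHS]addrA [LHS]addrCA.
- move=> j ij [g y]; have ji : j + 1 != i by apply/eqP; lia.
  have ji' : j != i by apply/eqP; lia.
  rewrite (Xz _ g ji) => -[_ dy] [_ ey].
  have [w yE] : exists w, y = cdiff Y j w.
    by apply: Y_loc => //; move: dy; rewrite linear0 [0 + _]add0r.
  exists (0, w); rewrite /= /cone_diff /= !linear0 ?oppr0 yE; congr pair.
  by rewrite [0 + _]add0r.
Qed.

Lemma spanned_exists Y (i : int) : exists n, spanned n Y i.
Proof.
have [n [z [zP z_span]]] := ker_fg (cdiff Y (i + 1)) (cobj_fg Y (i + 1)).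
exists n, (fun l => e *: z l); split.
  by move=> l; rewrite linearZ /= zP scaler0 scalerA e_idem.
move=> y dy ey; have [r [er yE]] := z_span y dy; exists r, 0.
rewrite linear0 addr0 -{1}ey yE scaler_sumr; apply: eq_bigr => l _.
by rewrite !scalerA er.
Qed.

Lemma local_above_step Y (i : int) :
  local_above e (i + 1 + 1) Y ->
  exists Y', @isomorphic k VQ Y Y' /\ local_above e (i + 1) Y'.
Proof.
have [n Yn] := spanned_exists Y i; elim: n Y Yn => [|n IHn] Y Yn Y_loc.
  exists Y; split; first by exists (@hid k VQ Y); apply: is_iso_id.
  move=> j ij y dy ey; have [ji|ji] := eqVneq j i; last first.
    by apply: Y_loc => //; move/eqP: ji; lia.
  subst j; have [z [_ z_span]] := Yn.
  have [b [w ->]] := z_span y dy ey; exists w.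
  by rewrite big_ord0 add0r.
have [Y1 [YY1 Y1n Y1_loc]] := attach_cell Yn Y_loc.
have [Y' [Y1Y' Y'_loc]] := IHn Y1 Y1n Y1_loc.
by exists Y'; split=> //; apply: isomorphic_trans YY1 Y1Y'.
Qed.

Lemma local_replacement Y (c : int) :
  exists Y', @isomorphic k VQ Y Y' /\ local_above e c Y'.
Proof.
have [N Y0] := cobj_bounded Y.
have step (m : nat) : exists Y', @isomorphic k VQ Y Y' /\
    local_above e (N%:Z + 1 - m%:Z) Y'.
  elim: m => [|m [Y' [YY' Y'_loc]]].
    exists Y; split; first by exists (@hid k VQ Y); apply: is_iso_id.
    by move=> i Ni y _ _; exists 0; rewrite linear0; apply: Y0; lia.
  have [|Y'' [Y'Y'' Y''_loc]] := @local_above_step Y' (N%:Z - m%:Z - 1).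
    by have -> : N%:Z - m%:Z - 1 + 1 + 1 = N%:Z + 1 - m%:Z by lia.
  exists Y''; split; first exact: isomorphic_trans YY' Y'Y''.
  by have -> : N%:Z + 1 - m.+1%:Z = N%:Z - m%:Z - 1 + 1 by lia.
(* For $c>N+1$ the absolute value descends below [c], which is harmless: a smaller bound gives a
   stronger property. *)
have [Y' [YY' Y'_loc]] := step (absz (N%:Z + 1 - c)%R); exists Y'; split=> //.
by move=> i ci; apply: Y'_loc; lia.
Qed.

Context (quotient_fd : exists (m : nat) (a : 'I_m -> B), forall b,
  exists (c : 'I_m -> k) (n : nat) (x y : 'I_n -> B),
    b = \sum_t (c t)%:A * a t + \sum_i x i * e * y i).

(** For a cocycle $z$, each $e x'z$ is a cocycle fixed by [e], hence a boundary; so the two-sided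
    ideal of [e] kills $H^{i+1}(Y)$. Generators of the cocycles times a finite basis modulo this
    ideal therefore span over $k$. *)
Lemma cohomology_finite_dim (c i : int) Y :
  local_above e c Y -> c <= i + 1 ->
  exists (J : finType) (v : J -> Y (i + 1)), (forall l, cdiff Y (i + 1) (v l) = 0) /\
    forall y, cdiff Y (i + 1) y = 0 ->
      exists (a : J -> k) w, y = \sum_l (a l)%:A *: v l + cdiff Y i w.
Proof.
move=> Y_loc ci; have [m [a aP]] := quotient_fd.
have [n [z [zP z_span]]] := ker_fg (cdiff Y (i + 1)) (cobj_fg Y (i + 1)).
exists ('I_n * 'I_m)%type, (fun lt => a lt.2 *: z lt.1); split.
  by move=> l; rewrite linearZ /= zP scaler0.
move=> y /z_span[r [_ ->]].
have rE l : exists (g : 'I_m -> k) w,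
    r l *: z l = \sum_t (g t)%:A *: (a t *: z l) + cdiff Y i w.
  have [g [p [x [x' rE]]]] := aP (r l).
  have /choice[w wE] : forall s, exists w, (x s * e * x' s) *: z l = cdiff Y i w.
    move=> s; have [||w wE] := Y_loc i ci (e *: (x' s *: z l)).
    - by rewrite !linearZ /= zP !scaler0.
    - by rewrite scalerA e_idem.
    - by exists (x s *: w); rewrite linearZ /= -wE !scalerA mulrA.
  exists g, (\sum_s w s); rewrite rE scalerDl !scaler_suml linear_sum.
  by congr (_ + _); apply: eq_bigr => s _; rewrite ?scalerA ?wE.
have /choice[g /choice[w wE]] := rE.
exists (fun lt => g lt.1 lt.2), (\sum_l w l).
rewrite (eq_bigr _ (fun l _ => wE l)) big_split linear_sum pair_big /=.
by [].
Qed.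

End Replacement.

(** * Projective dimension *)

Section ProjectiveDimension.
Context (B : nzRingType).
Implicit Types K M N U V Q L : lmodType B.

Lemma row_projective n : projective_module [the lmodType B of 'rV[B]_n].
Proof.
move=> M N p f p_surj.
have /choice[x xE] : forall l : 'I_n, exists x, p x = f (delta_mx 0 l).
  by move=> l; apply: p_surj.
have gL : linear (fun r : 'rV[B]_n => \sum_l r 0 l *: x l).
  move=> b r s; rewrite scaler_sumr -big_split; apply: eq_bigr => l _ /=.
  by rewrite !mxE scalerDl scalerA.
exists (lin gL) => r /=; rewrite {2}(row_sum_delta r) !linear_sum.
by apply: eq_bigr => l _; rewrite !linearZ /= xE.
Qed.

Lemma row_finitely_generated n : finitely_generated [the lmodType B of 'rV[B]_n].
Proof.
exists n, (fun l => delta_mx 0 l) => r; exists (fun l => r 0 l).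
exact: row_sum_delta.
Qed.

Lemma free_cover M : finitely_generated M ->
  exists L (p : {linear L -> M}), [/\ projective_module L, finitely_generated L &
    forall y, exists x, p x = y].
Proof.
move=> [n [v v_span]].
have pL : linear (fun r : 'rV[B]_n => \sum_l r 0 l *: v l).
  move=> b r s; rewrite scaler_sumr -big_split; apply: eq_bigr => l _ /=.
  by rewrite !mxE scalerDl scalerA.
exists [the lmodType B of 'rV[B]_n], (lin pL); split.
- exact: row_projective.
- exact: row_finitely_generated.
- move=> y; have [b ->] := v_span y; exists (\row_l b l) => /=.
  by apply: eq_bigr => l _; rewrite mxE.
Qed.

Definition is_kernel K M N (i : {linear K -> M}) (p : {linear M -> N}) : Prop :=
  injective i /\ forall x, p x = 0 <-> exists y, x = i y.

Lemma kernel_exists M N (p : {linear M -> N}) :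
  exists K (i : {linear K -> M}), is_kernel i p.
Proof. by have [K [i iP]] := submoduleP (sub_ker p); exists K, i. Qed.

(** Projective dimension less than [d]; starting from the zero module makes the base of the
    inductions trivial. *)
Fixpoint pd_lt d M : Prop :=
  if d is d'.+1 then
    exists K Q (i : {linear K -> Q}) (p : {linear Q -> M}),
      [/\ projective_module Q, forall y, exists x, p x = y, is_kernel i p & pd_lt d' K]
  else zero_module M.

Lemma projdim_le_pd_lt d M : projdim_le d M -> pd_lt d.+1 M.
Proof.
move=> [P [delta [eps [P_proj P0 eps_surj ex0 ex]]]].
have {}P0 n : (d.+1 <= n)%N -> zero_module (P n) by apply: P0.
move: (d.+1) P0 => {}d P0.
elim: d M P delta eps P_proj P0 eps_surj ex0 ex =>
  [|d IHd] M P delta eps P_proj P0 eps_surj ex0 ex.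
  by move=> y; have [x <-] := eps_surj y; rewrite (P0 0%N isT x) linear0.
have [K [i iP]] := kernel_exists eps; have [i_inj epsP] := iP.
have [eps' eps'E] : exists eps' : {linear P 1%N -> K}, forall x, i (eps' x) = delta 0%N x.
  by apply: factor_inj => // x; apply/epsP/ex0; exists x.
exists K, (P 0%N), i, eps; split=> //.
apply: (IHd K (fun n => P n.+1) (fun n => delta n.+1) eps') => //.
- by move=> n dn; apply: P0.
- move=> y; have /ex0[x xE] : eps (i y) = 0 by apply/epsP; exists y.
  by exists x; apply: i_inj; rewrite eps'E.
- move=> x; rewrite -ex -eps'E; split=> [->|ix]; first exact: linear0.
  by apply: i_inj; rewrite linear0.
Qed.

(* [V] is a direct summand of the sum of [U] and a projective module. *)
Definition stable_summand V U : Prop :=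
  exists Q (f : {linear U -> V}) (g : {linear V -> U}) (h : {linear V -> Q})
    (p : {linear Q -> V}), projective_module Q /\ forall v, v = f (g v) + p (h v).

Lemma stable_summand_refl V : stable_summand V V.
Proof.
pose Z := [the lmodType B of 'rV[B]_0].
exists Z, [the {linear V -> V} of idfun], [the {linear V -> V} of idfun],
  [the {linear V -> Z} of \0], [the {linear Z -> V} of \0]; split.
  exact: row_projective.
by move=> v /=; rewrite addr0.
Qed.

Lemma stable_summand_zero V U :
  stable_summand V U -> zero_module U -> projective_module V.
Proof.
move=> [Q [f [g [h [p [Q_proj fgph]]]]]] U0 M N q t q_surj.
have [s sE] := Q_proj _ _ q [the {linear Q -> N} of t \o p] q_surj.
exists [the {linear V -> M} of s \o h] => v; rewrite /= sE /=.
by rewrite [in RHS](fgph v) (U0 (g v)) linear0 add0r.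
Qed.

(** A form of Schanuel's lemma. The projective resolutions supplied by finite global dimension need
    not be finitely generated; this compares their syzygies with those of finitely generated free
    covers. *)
Lemma stable_summand_kernel V U (QV QU KV KU : lmodType B) (iV : {linear KV -> QV})
    (pV : {linear QV -> V}) (iU : {linear KU -> QU}) (pU : {linear QU -> U}) :
  stable_summand V U -> projective_module QV -> projective_module QU ->
  (forall y, exists x, pV x = y) -> (forall y, exists x, pU x = y) ->
  is_kernel iV pV -> is_kernel iU pU -> stable_summand KV KU.
Proof.
move=> [Q [f [g [h [p [Q_proj fgph]]]]]] QV_proj QU_proj pV_surj pU_surj.
move=> [iV_inj iVP] [iU_inj iUP].
have [a aE] := QU_proj _ _ pV [the {linear QU -> V} of f \o pU] pV_surj.
have [b bE] := QV_proj _ _ pU [the {linear QV -> U} of g \o pV] pU_surj.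
have [p' p'E] := Q_proj _ _ pV p pV_surj.
have pi0 y : pV (iV y) = 0 by apply/iVP; exists y.
have pi0' y : pU (iU y) = 0 by apply/iUP; exists y.
have [f' f'E] : exists f' : {linear KU -> KV}, forall x, iV (f' x) = a (iU x).
  apply: (factor_inj (f := [the {linear KU -> QV} of a \o iU]) iV_inj) => x.
  by apply/iVP; rewrite /= aE /= pi0' linear0.
have [g' g'E] : exists g' : {linear KV -> KU}, forall x, iU (g' x) = b (iV x).
  apply: (factor_inj (f := [the {linear KV -> QU} of b \o iV]) iU_inj) => x.
  by apply/iUP; rewrite /= bE /= pi0 linear0.
(* The endomorphism $1-(ab+p'h\,p_V)$ of [QV] is killed by $p_V$, so it lands in [KV]; it is the
   part of the decomposition that passes through a projective. *)
have [|t tE] := factor_inj (f := [the {linear QV -> QV} of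
    idfun \- ((a \o b) \+ (p' \o (h \o pV)))]) iV_inj.
  move=> x; apply/iVP; rewrite /= linearB linearD aE p'E /= bE /= -fgph.
  by rewrite subrr.
exists QV, f', g', iV, t; split=> // v; apply: iV_inj.
rewrite linearD f'E g'E tE /= pi0 !linear0 addr0 addrC.
exact/esym/subrK.
Qed.

End ProjectiveDimension.

(** * Perfect resolutions *)

Section Truncation.
Context (k : fieldType) (B : algType k) (X : complex B) (S : int -> bool).

Definition trunc_obj (i : int) : lmodType B :=
  if S i then X i else [the lmodType B of 'rV[B]_0].

Definition cond_out (b : bool) (M N : lmodType B) : {linear (if b then M else N) -> M} :=
  match b with
  | true => [the {linear M -> M} of idfun] | false => [the {linear N -> M} of \0] end.
Definition cond_in (b : bool) (M N : lmodType B) : {linear M -> (if b then M else N)} :=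
  match b with
  | true => [the {linear M -> M} of idfun] | false => [the {linear M -> N} of \0] end.

Lemma cond_inK b M N x : cond_out b M N (cond_in b M N x) = if b then x else 0.
Proof. by case: b. Qed.

Definition trunc_out i : {linear trunc_obj i -> X i} := cond_out (S i) _ _.
Definition trunc_in i : {linear X i -> trunc_obj i} := cond_in (S i) _ _.

Lemma trunc_zero i : ~~ S i -> zero_module (trunc_obj i).
Proof. by rewrite /trunc_obj => /negPf ->; apply: row0_zero. Qed.

Lemma trunc_inK i x : trunc_out i (trunc_in i x) = if S i then x else 0.
Proof. exact: cond_inK. Qed.

Lemma trunc_outK i : cancel (trunc_out i) (trunc_in i).
Proof.
rewrite /trunc_in /trunc_out /trunc_obj; case: (S i) => //= x.
by apply/rowP => -[].
Qed.

Definition trunc : complex B.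
Proof.
apply: (@Complex k B trunc_obj (fun i =>
  [the {linear trunc_obj i -> trunc_obj (i + 1)} of
     trunc_in (i + 1) \o (cdiff X i \o trunc_out i)])).
- move=> i x /=; rewrite trunc_inK; case: (S (i + 1)); last by rewrite !linear0.
  by rewrite cdiff_cdiff linear0.
- move=> i; rewrite /trunc_obj; case: (S i); first exact: cobj_fg.
  exact: zero_finitely_generated (@row0_zero B).
- have [n X0] := cobj_bounded X; exists n => i ni x.
  by rewrite -(trunc_outK x) (X0 i ni (trunc_out i x)) linear0.
Defined.

End Truncation.

(** Brutal truncation: [S] is closed upwards, so the components in [S] form a subcomplex, with
    quotient the other components. *)
Lemma truncation_exact (k : fieldType) (B : algType k) (X : complex B) (S : int -> bool) :
  (forall i, S i -> S (i + 1)) ->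
  exists X1 X2 (f : chain_map X1 X) (g : chain_map X X2),
    [/\ short_exact f g, forall i, ~~ S i -> zero_module (X1 i) &
        forall i, S i -> zero_module (X2 i)].
Proof.
move=> S_up; pose T i := ~~ S i.
have fd i (x : trunc X S i) : trunc_out X S (i + 1) (cdiff (trunc X S) i x) =
    cdiff X i (trunc_out X S i x).
  rewrite /= trunc_inK; case: ifPn => // Si.
  rewrite (@trunc_zero k B X S i _ x) ?linear0 ?linear0 //.
  by apply: contra Si; apply: S_up.
have gd i (x : X i) : trunc_in X T (i + 1) (cdiff X i x) =
    cdiff (trunc X T) i (trunc_in X T i x).
  rewrite /= trunc_inK; case: ifPn => //; rewrite /T negbK => Si.
  have T0 : zero_module (trunc_obj X T (i + 1)).
    by apply: trunc_zero; rewrite /T negbK S_up.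
  by rewrite (T0 (trunc_in _ _ _ _)) (T0 (trunc_in _ _ _ _)).
exists (trunc X S), (trunc X T), (@ChainMap k B (trunc X S) X (trunc_out X S) fd),
  (@ChainMap k B X (trunc X T) (trunc_in X T) gd); split.
- split=> i /=.
  + exact: can_inj (@trunc_outK k B X S i).
  + by move=> z; exists (trunc_out X T i z); rewrite trunc_outK.
  + move=> y; split=> [y0|[x ->]].
      exists (trunc_in X S i y); rewrite trunc_inK; case: ifPn => // Si.
      by have := @trunc_inK k B X T i y; rewrite y0 linear0 /T Si.
    apply: (can_inj (@trunc_outK k B X T i)); rewrite trunc_inK linear0 /T.
    by case: ifPn => // Si; rewrite (@trunc_zero k B X S i Si x) linear0.
- exact: trunc_zero.
- by move=> i Si; apply: trunc_zero; rewrite /T negbK.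
Qed.

(** * Resolving extensions *)

Section Resolutions.
Context (k : fieldType) (B : algType k).
Implicit Types X Y Z P : complex B.

Definition quasi_iso X Y (q : chain_map X Y) : Prop :=
  quasi_isomorphism (q : @hom k (complexes B) X Y).

Definition resolvable X : Prop :=
  exists P (q : chain_map P X), perfect P /\ quasi_iso q.

Lemma quasi_iso_comp X Y Z (g : chain_map Y Z) (f : chain_map X Y) :
  quasi_iso f -> quasi_iso g -> quasi_iso (chain_comp g f).
Proof.
move=> qf qg i; split=> [x dx gfx|z dz].
  by apply: (qf i).1 => //; apply: (qg i).1 => //; rewrite -cmap_cdiff dx linear0.
have [y [w [dy ->]]] := (qg i).2 z dz.
have [x [v [dx ->]]] := (qf i).2 y dy.
exists x, (g i v + w); split=> //.
by rewrite !linearD cmap_cdiff -addrA.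
Qed.

Lemma resolvable_quasi_iso X Y (q : chain_map X Y) :
  quasi_iso q -> resolvable X -> resolvable Y.
Proof.
move=> qq [P [p [P_perf pq]]]; exists P, (chain_comp q p); split=> //.
exact: quasi_iso_comp.
Qed.

Lemma perfect_resolvable P : perfect P -> resolvable P.
Proof.
move=> P_perf; exists P, (chain_id P); split=> //.
exact: (@bijective_quasi_isomorphism _ _ _ _ (chain_id P) (chain_id P)).
Qed.

Lemma resolvable_shift X : resolvable X -> resolvable (complex_shift X).
Proof.
move=> [P [q [P_perf qq]]]; exists (complex_shift P), (chain_shift q).
by split; [apply: perfect_shift | apply: quasi_isomorphism_shift].
Qed.

(** A horseshoe argument. A degreewise lift [r] of [q] to [Y] fails to be a chain map by some
    $v:Q\to X[1]$; lifting [v] to $u:Q\to P[1]$ gives the attaching map, and the twist of [u]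
    resolves [Y]. *)
Lemma resolvable_short_exact X Y Z (f : chain_map X Y) (g : chain_map Y Z) :
  short_exact f g -> resolvable X -> resolvable Z -> resolvable Y.
Proof.
move=> [f_inj g_surj fgP] [P [p [P_perf pq]]] [Q [q [Q_perf qq]]].
have gf i x : g i (f i x) = 0 by apply/fgP; exists x.
have /dep_choice[r rE] : forall i, exists r : {linear Q i -> Y i}, forall x, g i (r x) = q i x.
  by move=> i; apply: projective_lift => // x; apply: g_surj.
have /dep_choice[v vE] : forall i, exists v : {linear Q i -> X (i + 1)},
    forall x, f (i + 1) (v x) = cdiff Y i (r i x) - r (i + 1) (cdiff Q i x).
  move=> i; apply: (factor_inj (f := [the {linear Q i -> Y (i + 1)} of
    (cdiff Y i \o r i) \- (r (i + 1) \o cdiff Q i)])) => // x.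
  by apply/fgP; rewrite /= linearB cmap_cdiff !rE cmap_cdiff subrr.
have vd i x : v (i + 1) (cdiff Q i x) = cdiff (complex_shift X) i (v i x).
  apply: f_inj; rewrite vE cdiff_cdiff linear0 subr0 /= /shift_diff linearN.
  by rewrite cmap_cdiff vE linearB cdiff_cdiff sub0r opprK.
pose V := @ChainMap k B Q (complex_shift X) v vd.
have [u [h hE]] := quasi_isomorphism_lift (q := chain_shift p) V Q_perf
  (quasi_isomorphism_shift pq).
have [h' h'E] := @reindex_family (fun i => {linear Q i -> X i}) h.
(* The homotopy between $pu$ and $v$ is absorbed into [r], so that the defect of [r'] is exactly
   $fpu$. *)
pose r' i : {linear Q i -> Y i} := [the {linear Q i -> Y i} of r i \- (f i \o h' i)].
have r'd : forall i x, cdiff Y i (r' i x) - r' (i + 1) (cdiff Q i x) =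
    f (i + 1) (p (i + 1) (u i x)).
  apply: int_succ_ind => i x.
  have /= /eqP := hE i x; rewrite subr_eq => /eqP ->.
  rewrite /r' /= !h'E /shift_diff [cdiff Y _ (_ - _)]linearB /= -(cmap_cdiff f).
  rewrite [RHS]linearD vE [f _ (_ + _)]linearD [f _ (- _)]linearN.
  rewrite [RHS]addrC [RHS]addrACA opprB. by congr (_ + _); apply: addrC.
have gr' i x : g i (r' i x) = q i x by rewrite /r' /= linearB gf subr0 rE.
clearbody r' => {h'E h'}.
have tL i : linear (fun x : twist u i => r' i x.1 + f i (p i x.2)).
  by move=> b x y; rewrite /= !linearP scalerDr addrACA.
have td i x : lin (tL (i + 1)) (cdiff (twist u) i x) = cdiff Y i (lin (tL i) x).
  rewrite /= /twist_diff /= [in RHS]linearD -!cmap_cdiff.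
  have /eqP := r'd i x.1; rewrite subr_eq => /eqP ->.
  by rewrite [p _ (_ + _)]linearD [f _ (_ + _)]linearD [LHS]addrA [r' _ _ + _]addrC.
exists (twist u), (@ChainMap k B (twist u) Y (fun i => lin (tL i)) td).
split; first exact: perfect_twist.
have dr'0 i x : cdiff Q i x = 0 -> cdiff Y i (r' i x) = f (i + 1) (p (i + 1) (u i x)).
  by move=> dx; rewrite -r'd dx linear0 subr0.
have du i x : cdiff P (i + 1) (u i x) = - u (i + 1) (cdiff Q i x).
  by rewrite cmap_cdiff /= /shift_diff opprK.
have dr'E i x : cdiff Y i (r' i x) = f (i + 1) (p (i + 1) (u i x)) + r' (i + 1) (cdiff Q i x).
  by rewrite -r'd subrK.
(* The five lemma on elements: a class is first corrected along [Q], using [qq], and the remainder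
   lies in [X] and is treated by [pq]. *)
apply: int_succ_ind => i; split=> [[x y] [dx uxdy] [z tzE]|z dz].
  have dy : cdiff P (i + 1 + 1) y = - u (i + 1 + 1) x.
    by apply/eqP; rewrite -addr_eq0 [w in w == 0]addrC; apply/eqP.
  have {}tzE : r' (i + 1 + 1) x + f (i + 1 + 1) (p (i + 1 + 1) y) = cdiff Y (i + 1) z := tzE.
  have [|x' x'E] := (qq (i + 1)).1 x dx.
    by exists (g (i + 1) z); rewrite -cmap_cdiff -tzE linearD gf [_ + 0]addr0 gr'.
  pose z1 := z - r' (i + 1) x'; pose y1 := y - u (i + 1) x'.
  have dy1 : cdiff P (i + 1 + 1) y1 = 0.
    by rewrite linearB du dy -x'E subrr.
  have dz1 : cdiff Y (i + 1) z1 = f (i + 1 + 1) (p (i + 1 + 1) y1).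
    rewrite linearB dr'E -tzE -x'E /y1 [p _ (_ - _)]linearB [f _ (_ - _)]linearB.
    by rewrite [r' _ _ + _]addrC opprD [LHS]addrACA subrr [LHS]addr0.
  clearbody z1; have [|x2 [zeta [dx2 gz1]]] := (qq i).2 (g (i + 1) z1).
    by rewrite -cmap_cdiff dz1 gf.
  have [eta etaE] := g_surj i zeta.
  have /fgP[xi xiE] : g (i + 1) (z1 - r' (i + 1) x2 - cdiff Y i eta) = 0.
    by rewrite !linearB gr' cmap_cdiff etaE gz1 [q _ _ + _]addrC addrK subrr.
  have [||y' y'E] := (pq (i + 1)).1 (y1 - u (i + 1) x2).
  - by rewrite linearB dy1 du dx2 linear0 oppr0 subr0.
  - exists xi; apply: f_inj; rewrite cmap_cdiff -xiE [in RHS]linearB cdiff_cdiff subr0.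
    by rewrite [in RHS]linearB dz1 dr'0 // -!linearB.
  exists (x' + x2, y'); congr pair.
    by rewrite /= linearD dx2 -x'E addr0.
  rewrite /= -y'E linearD /y1 -[y - _ - _]addrA -opprD [RHS]addrC.
  exact/esym/subrK.
have [|x [zeta [dx gz]]] := (qq (i + 1)).2 (g (i + 1 + 1) z).
  by rewrite -cmap_cdiff dz linear0.
have [eta etaE] := g_surj (i + 1) zeta.
have /fgP[xi xiE] : g (i + 1 + 1) (z - r' (i + 1 + 1) x - cdiff Y (i + 1) eta) = 0.
  by rewrite !linearB gr' cmap_cdiff etaE gz [q _ _ + _]addrC addrK subrr.
have dxi : cdiff X (i + 1 + 1) xi = - p (i + 1 + 1 + 1) (u (i + 1 + 1) x).
  apply: f_inj; rewrite cmap_cdiff -xiE [LHS]linearB cdiff_cdiff subr0.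
  by rewrite [LHS]linearB dz sub0r dr'0 // [RHS]linearN.
have [||y0 y0E] := (pq (i + 1 + 1)).1 (u (i + 1 + 1) x).
- by rewrite du dx linear0 oppr0.
- by exists (- xi); rewrite linearN dxi opprK.
have [|y1 [xi' [dy1 y1E]]] := (pq (i + 1)).2 (xi + p (i + 1 + 1) y0).
  by rewrite linearD dxi -cmap_cdiff -y0E addNr.
exists (x, y1 - y0), (eta + f (i + 1) xi'); split.
  rewrite /= /twist_diff /= dx; congr pair.
  by rewrite linearB dy1 sub0r -y0E subrr.
have fpy : f (i + 1 + 1) (p (i + 1 + 1) (y1 - y0)) =
    z - r' (i + 1 + 1) x - cdiff Y (i + 1) (eta + f (i + 1) xi').
  have -> : p (i + 1 + 1) (y1 - y0) = xi - cdiff X (i + 1) xi'.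
    rewrite linearB; apply/eqP; rewrite subr_eq [w in _ == w]addrAC y1E addrK //.
  by rewrite [LHS]linearB -xiE linearD cmap_cdiff opprD addrA.
rewrite /= fpy.
by apply/esym; rewrite -[LHS]addrA subrK [LHS]addrC subrK.
Qed.

End Resolutions.

(** * Perfect resolutions from finite global dimension *)

Section BoundedResolutions.
Context (k : fieldType) (B : algType k).
Context (kernel_fg : forall (K M N : lmodType B) (i : {linear K -> M}) (f : {linear M -> N}),
  is_kernel i f -> finitely_generated M -> finitely_generated K).
Implicit Types X Y Z P : complex B.

(** [U] carries the bound on the dimension and [M] the finite generation. Both pass to syzygies, and
    [M] is the cone of $K\to L$ for a free cover [L] with kernel [K]; at $d=0$ the module [M] is
    projective. *)
Lemma resolvable_concentrated d (U M : lmodType B) (j : int) X :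
  pd_lt d U -> stable_summand M U -> finitely_generated M ->
  concentrated M j X -> resolvable X.
Proof.
elim: d U M X => [|d IHd] U M X.
  move=> U0 MU _ [X0 Xj]; apply: perfect_resolvable => i.
  have [->|/X0] := eqVneq i j; last exact: zero_projective.
  exact: iso_projective Xj (stable_summand_zero MU U0).
move=> [KU [QU [iU [pU [QU_proj pU_surj iUP KU_pd]]]]] MU M_fg [X0 [r [r' [rr' r'r]]]].
have [L [p [L_proj L_fg p_surj]]] := free_cover M_fg.
have [K [i iP]] := kernel_exists p; have K_fg := kernel_fg iP L_fg.
have KKU := stable_summand_kernel MU L_proj QU_proj p_surj pU_surj iP iUP.
have [i_inj iE] := iP.
have SL := stalk_at_concentrated j L_fg; have SK := stalk_at_concentrated j K_fg.
have SL_res : resolvable (stalk_at j L_fg).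
  apply: perfect_resolvable => n; have [->|/(SL.1)] := eqVneq n j.
    exact: iso_projective SL.2 L_proj.
  exact: zero_projective.
have SK_res : resolvable (stalk_at j K_fg) by apply: IHd KU_pd KKU K_fg SK.
have [SL0 [l [l' [ll' l'l]]]] := SL; have [SK0 [s [s' [ss' s's]]]] := SK.
have jj : j + 1 != j by apply/eqP; lia.
have [|a aE] := @concentrated_map k B K j (stalk_at j K_fg) (stalk_at j L_fg) s'
  [the {linear K -> stalk_at j L_fg j} of l \o i] SK0.
  by move=> x; apply: SL0 jj _.
have [|b bE] := @concentrated_map k B L j (stalk_at j L_fg) X l'
  [the {linear L -> X j} of r \o p] SL0.
  by move=> x; apply: X0 jj _.
have ab : short_exact a b.
  split=> n; have [->|nj] := eqVneq n j.
  - by move=> x y; rewrite !aE /= => /(can_inj ll')/i_inj/(can_inj s's).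
  - by move=> x y _; rewrite (SK0 n nj x) (SK0 n nj y).
  - move=> z; have [x xE] := p_surj (r' z); exists (l x).
    by rewrite bE /= ll' xE r'r.
  - by move=> z; exists 0; rewrite linear0 (X0 n nj z).
  - move=> y; rewrite bE /=; split=> [/(congr1 r')|[x ->]].
      rewrite rr' linear0 => /iE[x xE]; exists (s x).
      by rewrite aE /= ss' -xE l'l.
    by rewrite aE /= ll' (_ : p _ = 0) ?linear0 //; apply/iE; exists (s' x).
  - by move=> y; split=> _; [exists 0; rewrite linear0 | ]; first exact: SL0 nj _; apply: X0.
have [q qq] := short_exact_cone_quasi_isomorphism_r ab.
apply: (resolvable_quasi_iso qq).
exact: resolvable_short_exact (short_exact_cone a) SL_res (resolvable_shift SK_res).
Qed.

Hypothesis gldim : exists d, forall M : lmodType B, projdim_le d M.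

Lemma every_resolvable X : resolvable X.
Proof.
have [d pd] := gldim; have [n X0] := cobj_bounded X.
have step (m : nat) (a : int) Y :
    (forall i, ~~ ((a <= i) && (i < a + m%:Z)) -> zero_module (Y i)) -> resolvable Y.
  elim: m Y => [|m IHm] Y Y0.
    apply: perfect_resolvable => i; apply/zero_projective/Y0; lia.
  (* Induction on the width of the complex: its top degree splits off as a subcomplex in one
     degree. *)
  have [|Y1 [Y2 [f [g [fg Y10 Y20]]]]] := @truncation_exact k B Y (fun i => a + m%:Z <= i).
    by move=> i; lia.
  have [f_inj g_surj fgP] := fg.
  apply: (resolvable_short_exact fg).
    apply: (resolvable_concentrated (j := a + m%:Z) (projdim_le_pd_lt (pd (Y1 (a + m%:Z))))).
    - exact: stable_summand_refl.
    - exact: cobj_fg.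
    - split=> [i ia|]; last first.
        by exists [the {linear Y1 (a + m%:Z) -> Y1 (a + m%:Z)} of idfun],
          [the {linear Y1 (a + m%:Z) -> Y1 (a + m%:Z)} of idfun].
      have [ai|ai] := boolP (a + m%:Z <= i); last exact: Y10.
      move=> x; apply: f_inj; rewrite linear0; apply: Y0.
      by move/eqP: ia; lia.
  apply: IHm => i ia; have [ai|ai] := boolP (a + m%:Z <= i); first exact: Y20.
  move=> z; have [y <-] := g_surj i z; rewrite (Y0 i _ y) ?linear0 //; lia.
apply: (step (2 * n + 1)%N (- n%:Z)) => i ni; apply: X0; lia.
Qed.

End BoundedResolutions.

(** * Finite spans of morphisms *)

Section Span.
Context (k : fieldType) (C : linear_category k) (X Y : C).
Implicit Types (f g : hom X Y) (fs : seq (hom X Y)) (V W : hom X Y -> Prop).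

Fixpoint in_span fs g : Prop :=
  if fs is f :: fs' then
    exists a g', in_span fs' g' /\ g =h hadd (hscale a f) g'
  else g =h hzero X Y.

Lemma in_span_eq fs g g' : g =h g' -> in_span fs g -> in_span fs g'.
Proof.
case: fs => [|f fs] gg'; first by move=> /= <-; symmetry.
by move=> [a [h [hs gE]]]; exists a, h; rewrite -gg'.
Qed.

Lemma in_span_cat fs fs' g g' :
  in_span fs g -> in_span fs' g' -> in_span (fs ++ fs') (hadd g g').
Proof.
elim: fs g => [|f fs IH] g /=.
  by move=> g0; apply: in_span_eq; rewrite g0 hadd0l.
move=> [a [h [hs gE]]] gs; exists a, (hadd h g'); split; first exact: IH.
by rewrite gE hadd_assoc.
Qed.

Lemma in_span_hsum fs g : in_span fs g ->
  exists c : 'I_(size fs) -> k,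
    g =h hsum (fun i => hscale (c i) (nth (hzero X Y) fs i)).
Proof.
elim: fs g => [|f fs IH] g /=.
  by move=> g0; exists (fun=> 0); rewrite g0 /hsum big_ord0.
move=> [a [h [/IH[c hE] gE]]].
exists (fun i => if unlift ord0 i is Some j then c j else a).
rewrite gE hE /hsum big_ord_recl unlift_none /=.
by under [X in _ =h hadd _ X]eq_bigr => i _ do rewrite liftK.
Qed.

Definition finite_modulo V W : Prop :=
  exists fs, forall g, V g ->
    exists g1 g2, [/\ in_span fs g1, W g2 & g =h hadd g1 g2].

Lemma finite_modulo_trans V W Z :
  finite_modulo V W -> finite_modulo W Z -> finite_modulo V Z.
Proof.
move=> [fs fsP] [fs' fs'P]; exists (fs ++ fs') => g /fsP[g1 [g2 [g1s Wg2 gE]]].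
have [g3 [g4 [g3s Zg4 g2E]]] := fs'P _ Wg2.
exists (hadd g1 g3), g4; split=> //; first exact: in_span_cat.
by rewrite gE g2E hadd_assoc.
Qed.

(** [R] plays the role of an injection of $V/W$ into $k^J$. It is only a relation because
    coordinates of a cohomology class depend on choices. The proof is Gaussian elimination, one
    coordinate at a time. *)
Lemma linear_relation_finite (J : finType) V W (R : hom X Y -> (J -> k) -> Prop) :
  (forall g, V g -> exists a, R g a) ->
  (forall g g' a a' s, R g a -> R g' a' ->
     R (hadd g (hscale s g')) (fun j => a j + s * a' j)) ->
  (forall g, R g (fun=> 0) -> W g) ->
  finite_modulo V W.
Proof.
move=> R_total R_lin R_ker.
suff step (s : seq J) :
    finite_modulo (fun g => exists a, R g a /\ forall j, j \notin s -> a j = 0) W.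
  have [fs fsP] := step (enum J); exists fs => g /R_total[a Ra].
  by apply: fsP; exists a; split=> // j; rewrite mem_enum.
elim: s => [|j s [fs fsP]].
  exists [::] => g [a [Ra a0]]; exists (hzero X Y), g; split; [exact: heq_refl | | by rewrite hadd0l].
  by apply: R_ker; have <- : a = (fun=> 0) by apply/funext => j; apply: a0.
(* Either some [f] has a nonzero [j]-th coordinate and serves as pivot, or that coordinate always
   vanishes. *)
have [[f [c [[Rf c0] cj]]]|noc] := pselect (exists f c,
    (R f c /\ forall i, i \notin j :: s -> c i = 0) /\ c j != 0).
  exists (f :: fs) => g [a [Ra a0]].
  have [|g1 [g2 [g1s Wg2 gE]]] := fsP (hadd g (hscale (- (a j / c j)) f)).
    exists (fun i => a i + - (a j / c j) * c i); split; first exact: R_lin.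
    move=> i si; have [->|ij] := eqVneq i j; first by rewrite mulNr divfK ?subrr.
    have si' : i \notin j :: s by rewrite inE negb_or ij.
    by rewrite (a0 i) // (c0 i) // mulr0 addr0.
  exists (hadd (hscale (a j / c j) f) g1), g2; split=> //.
    by exists (a j / c j), g1; split.
  rewrite -hadd_assoc -gE (hadd_comm g) hadd_assoc -hscale_addl subrr.
  by rewrite hscale0l hadd0l.
exists fs => g [a [Ra a0]]; apply: fsP; exists a; split=> // i si.
have [->|ij] := eqVneq i j; last by apply: a0; rewrite inE negb_or ij.
by apply/eqP; apply: contra_notT noc => aj; exists g, a.
Qed.

End Span.

Lemma in_span_map (k : fieldType) (C D : linear_category k) (X Y : C) (X' Y' : D)
    (T : hom X Y -> hom X' Y') (fs : seq (hom X Y)) (g : hom X Y) :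
  (forall f f', f =h f' -> T f =h T f') ->
  (forall f f', T (hadd f f') =h hadd (T f) (T f')) ->
  (forall a f, T (hscale a f) =h hscale a (T f)) ->
  in_span fs g -> in_span (map T fs) (T g).
Proof.
move=> T_eq T_add T_scale; elim: fs g => [|f fs IH] g /=.
  move=> /T_eq ->; rewrite -(T_eq _ _ (hscale0l (hzero X Y))) T_scale.
  exact: hscale0l.
move=> [a [h [/IH hs /T_eq gE]]]; exists a, (T h); split=> //.
by rewrite gE T_add T_scale.
Qed.

(** * Finiteness of the space of homotopy classes *)

Section HomFinite.
Context (k : fieldType) (B : algType k) (P Y : complex B) (c : int).
Context (P_perf : perfect P) (P0 : vanishes_below c P).
Context (Y_fd : forall i, c <= i + 1 ->
  exists (J : finType) (v : J -> Y (i + 1)), (forall l, cdiff Y (i + 1) (v l) = 0) /\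
    forall y, cdiff Y (i + 1) y = 0 ->
      exists (a : J -> k) w, y = \sum_l (a l)%:A *: v l + cdiff Y i w).

Lemma homotopy_boundary (X Z : complex B) (h : forall i, {linear X (i + 1) -> Z i}) :
  exists t : chain_map X Z, forall i x,
    t (i + 1) x = cdiff Z i (h i x) + h (i + 1) (cdiff X (i + 1) x).
Proof.
have [t tE] := @reindex_family (fun i => {linear X i -> Z i}) (fun i =>
  [the {linear X (i + 1) -> Z (i + 1)} of
     (cdiff Z i \o h i) \+ (h (i + 1) \o cdiff X (i + 1))]).
have td : forall i x, t (i + 1) (cdiff X i x) = cdiff Z i (t i x).
  apply: int_succ_ind => i x; rewrite !tE /= [in RHS]linearD !cdiff_cdiff linear0.
  by rewrite [LHS]addr0 [RHS]add0r.
by exists (ChainMap td) => i x; rewrite /= tE.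
Qed.

Definition supported_below (j : int) (f : @hom k (homotopy_category B) P Y) : Prop :=
  exists f' : chain_map P Y, homotopic f f' /\ forall i, j < i -> forall x, f' i x = 0.

(** A map vanishing above degree $i+1$ sends [P (i + 1)] to cocycles; the coordinates are those of
    the classes of the images of generators. If all are zero, projectivity lifts the component
    through the differential, and subtracting the resulting boundary makes it vanish. *)
Lemma supported_below_step (i : int) : c <= i + 1 ->
  finite_modulo (supported_below (i + 1)) (supported_below i).
Proof.
move=> ci; have [J [v [dv v_span]]] := Y_fd ci.
have [m [p p_span]] := cobj_fg P (i + 1).
apply: (@linear_relation_finite k (homotopy_category B) P Y
    [the finType of ('I_m * J)%type] _ _ (fun f a =>
  exists f' : chain_map P Y, [/\ homotopic f f', forall j, i + 1 < j -> forall x, f' j x = 0 &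
    forall l, exists w, f' (i + 1) (p l) = \sum_t (a (l, t))%:A *: v t + cdiff Y i w])).
- move=> f [f' [ff' f'0]].
  have /choice[a aP] : forall l, exists (a : J -> k), exists w,
      f' (i + 1) (p l) = \sum_t (a t)%:A *: v t + cdiff Y i w.
    by move=> l; apply: v_span; rewrite -cmap_cdiff f'0 //; lia.
  by exists (fun lt => a lt.1 lt.2), f'.
- move=> f g a b s [f' [ff' f'0 f'E]] [g' [gg' g'0 g'E]].
  exists (chain_add f' (chain_scale s g')); split.
  + exact: homotopic_add ff' (homotopic_scale s gg').
  + by move=> j ij x; rewrite /= /alg_scale f'0 // g'0 // scaler0 addr0.
  + move=> l; have [w wE] := f'E l; have [w' w'E] := g'E l.
    exists (w + s%:A *: w'); rewrite /= /alg_scale wE w'E scalerDr linearD.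
    rewrite [X in _ = _ + (_ + X)]linearZ /= [LHS]addrACA; congr (_ + _).
    rewrite scaler_sumr -big_split; apply: eq_bigr => t _ /=.
    by rewrite scalerA -scalerDl -[_%:A * _]scalerAl mul1r scalerA -scalerDl.
move=> f [f' [ff' f'0 f'E]].
have P1_proj : projective_module (P (i + 1)) by apply: P_perf.
have [|h hE] := @projective_lift _ (P (i + 1)) _ _ (cdiff Y i) (f' (i + 1)) P1_proj.
  have /choice[w wE] : forall l, exists w, f' (i + 1) (p l) = cdiff Y i w.
    move=> l; have [w ->] := f'E l; exists w.
    by rewrite big1 ?add0r // => t _; rewrite scale0r scale0r.
  move=> x; have [b ->] := p_span x; exists (\sum_l b l *: w l).
  by rewrite !linear_sum; apply: eq_bigr => l _; rewrite !linearZ /= wE.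
pose H := dfwith (fun i => [the {linear P (i + 1) -> Y i} of \0]) h.
have [t tE] := homotopy_boundary H.
exists (chain_add f' (chain_scale (-1) t)); split.
  apply: homotopic_trans ff' _; apply: homotopic_sym.
  exists (fun j => [the {linear P (j + 1) -> Y j} of \- H j]) => j x /=.
  rewrite /alg_scale scaleN1r scaleN1r tE linearN -opprD [LHS]addrAC subrr [LHS]add0r //.
apply: int_succ_ind => j ij x; rewrite /= /alg_scale scaleN1r scaleN1r tE.
have Hj : H (j + 1) (cdiff P (j + 1) x) = 0.
  by rewrite /H dfwith_out //; apply/eqP; lia.
rewrite Hj; have [ji|ji] := eqVneq j i.
  by subst j; rewrite /H dfwith_in hE [f' _ _ + 0]addr0 subrr.
rewrite /H dfwith_out /= ?linear0 ?f'0; try lia.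
  by rewrite addr0 subrr.
Qed.

Lemma homotopy_hom_finite :
  exists fs : seq (@hom k (homotopy_category B) P Y), forall f, in_span fs f.
Proof.
have [n Pn] := cobj_bounded P; pose N := (n + `|c|)%N.
have step (m : nat) : c - 1 <= N%:Z - m%:Z ->
    finite_modulo (fun=> True) (supported_below (N%:Z - m%:Z)).
  elim: m => [|m IHm] cm.
    exists [::] => g _; exists (@hzero k (homotopy_category B) P Y), g.
    split; [exact: heq_refl | | by rewrite hadd0l].
    exists g; split; first exact: homotopic_refl.
    by move=> i Ni x; rewrite (Pn i _ x) ?linear0 //; rewrite /N in Ni; lia.
  apply: finite_modulo_trans (IHm _) _; first lia.
  have -> : N%:Z - m%:Z = N%:Z - m.+1%:Z + 1 by lia.
  by apply: supported_below_step; lia.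
(* Descending from $N$ to $c-1$ leaves maps supported in degrees below $c$, where [P] is zero. The
   choice of $N$ ensures $N\ge c$. *)
have [|fs fsP] := step (absz (N%:Z - c + 1)%R); first by rewrite /N; lia.
exists fs => f; have [g1 [g2 [g1s [g' [g2g' g'0]] fE]]] := fsP f I.
apply: in_span_eq g1s; rewrite fE.
have -> : g2 =h @hzero k (homotopy_category B) P Y.
  apply: homotopic_trans g2g' _; apply: homotopic_chain_eq => i x.
  have [ic|ic] := boolP (i < c); first by rewrite (P0 ic x) !linear0.
  by rewrite g'0 //; rewrite /N; lia.
by rewrite hadd0r.
Qed.

End HomFinite.

(** * Hom-finiteness of the Verdier quotient *)

Section QuotientHomFinite.
Context (k : fieldType) (B : algType k) (U : lmodType B).
Context (U_fg : finitely_generated U) (e : B) (eps : U).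
Context (e_idem : e * e = e) (e_eps : e *: eps = eps).
Context (U_gen : forall u, exists b, u = b *: eps).
Context (U_free : forall (M : lmodType B) (x : M), e *: x = x ->
  exists f : {linear U -> M}, f eps = x).
Context (ker_fg : forall (M N : lmodType B) (f : {linear M -> N}),
  finitely_generated M ->
  exists (n : nat) (z : 'I_n -> M), (forall l, f (z l) = 0) /\
    forall x, f x = 0 -> exists r : 'I_n -> B,
      (forall l, e * r l = r l * e) /\ x = \sum_l r l *: z l).
Context (quotient_fd : exists (m : nat) (a : 'I_m -> B), forall b,
  exists (c : 'I_m -> k) (n : nat) (x y : 'I_n -> B),
    b = \sum_t (c t)%:A * a t + \sum_i x i * e * y i).
Context (resolution : forall X : complex B, exists (P : complex B) (q : chain_map P X),
  perfect P /\ quasi_isomorphism (q : @hom k (complexes B) _ _)).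

Theorem quotient_Hom_finite :
  Hom_finite (@verdier_quotient k (Db B) (@thick k (Db B) (stalk U_fg : Db B))).
Proof.
set VQ := verdier_quotient _ => X Y.
have U_proj := U_projective e_idem e_eps U_gen U_free.
have [P [q [P_perf /qmap_iso/(vmap_is_iso U_fg)[q' [q'q qq']]]]] := resolution X.
(* The source fixes [c], and only then is the target replaced; the replacement thus depends on both
   objects. *)
have [n Pn] := cobj_bounded P; pose c : int := - n%:Z.
have P0 : vanishes_below c P by move=> i ic; apply: Pn; rewrite /c in ic; lia.
have [Y' [[t [t' [t't tt']]] Y'_loc]] := local_replacement U_fg e_idem U_gen U_free ker_fg Y c.
have [fs fsP] := @homotopy_hom_finite k B P Y' c P_perf P0
  (fun i ci => cohomology_finite_dim e_idem ker_fg quotient_fd Y'_loc ci).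
pose T (f : @hom k (homotopy_category B) P Y') : @hom k VQ X Y :=
  t' \oh vmap U_fg (qmap f) \oh q'.
suff T_span g : in_span (map T fs) g.
  exists (size (map T fs)), (nth (hzero X Y) (map T fs)) => g.
  exact: in_span_hsum.
have [P' [s [f [sD gsE]]]] := every_fraction U_proj P_perf P0 (t \oh g \oh vmap U_fg (qmap q)).
have [f' f'E] := denominator_local_factor e_idem e_eps U_gen U_free f sD Y'_loc.
have gE : t \oh g \oh vmap U_fg (qmap q) =h vmap U_fg (qmap f').
  apply: (is_iso_epi (vmap_denominator_iso U_fg sD)).
  rewrite gsE -vmap_comp; apply: vmap_eq.
  by rewrite (qmap_homotopic f'E) qmap_comp.
have Tf'E : T f' =h g.
  rewrite /T -gE -!hcomp_assoc qq' hcomp_idr.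
  by rewrite hcomp_assoc t't hcomp_idl.
apply: (in_span_eq Tf'E); apply: in_span_map (fsP f').
- by move=> h h' /qmap_homotopic/vmap_eq hh'; rewrite /T hh'.
- move=> h h'; rewrite /T (vmap_eq _ (qmap_add _ _)) vmap_add.
  by rewrite hcomp_addr hcomp_addl.
- move=> a h; rewrite /T (vmap_eq _ (qmap_scale _ _)) vmap_scale.
  by rewrite hcomp_scaler hcomp_scalel.
Qed.

End QuotientHomFinite.

(** * Noetherian modules *)

Lemma finitely_generated_fintype (B : pzRingType) (M : lmodType B) (J : finType)
    (v : J -> M) :
  (forall x, exists a : J -> B, x = \sum_j a j *: v j) -> finitely_generated M.
Proof.
move=> v_span; exists #|J|, (fun i => v (enum_val i)) => x.
have [a ->] := v_span x; exists (fun i => a (enum_val i)).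
by rewrite (reindex _ (onW_bij _ (@enum_val_bij J))).
Qed.

Section Noetherian.
Context (k : fieldType) (R : comAlgType k) (R_noeth : noetherian R).

(** Induction on the number of generators: the ideal [I] of coefficients at the first generator is
    finitely generated, and the elements of [S] in the span of the others are covered by
    induction. *)
Lemma noetherian_submodule (M : lmodType R) n (v : 'I_n -> M) (S : set M) :
  submodule S -> (forall x, S x -> exists a : 'I_n -> R, x = \sum_l a l *: v l) ->
  exists m (w : 'I_m -> M), (forall l, S (w l)) /\
    forall x, S x -> exists b : 'I_m -> R, x = \sum_l b l *: w l.
Proof.
elim: n v S => [|n IHn] v S [S0 SP] v_span.
  exists 0%N, (fun=> 0); split=> [[] //|x /v_span[a ->]].
  by exists (fun=> 0); rewrite !big_ord0.
pose span x := exists a : 'I_n -> R, x = \sum_l a l *: v (lift ord0 l).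
have span0 : span 0 by exists (fun=> 0); rewrite big1 // => l _; rewrite scale0r.
have spanP b x y : span x -> span y -> span (b *: x + y).
  move=> [a ->] [c ->]; exists (fun l => b * a l + c l).
  rewrite scaler_sumr -big_split; apply: eq_bigr => l _ /=.
  by rewrite scalerDl scalerA.
pose I := [set r : R | exists x, S x /\ span (x - r *: v ord0)]%classic.
have I_lin b r s : I r -> I s -> I (b * r + s).
  move=> [x [Sx xr]] [y [Sy ys]]; exists (b *: x + y); split; first exact: SP.
  have := spanP b _ _ xr ys; rewrite scalerBr scalerA addrACA -opprD.
  by rewrite -scalerDl.
have I0 : I 0 by exists 0; split=> //; rewrite scale0r subr0.
have I_ideal : ideal I.
  split=> // [r s Ir Is|b r Ir]; first by rewrite -[r]mul1r; apply: I_lin.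
  by rewrite -[_ * _]addr0; apply: I_lin.
have [t [g IE]] := R_noeth I_ideal.
have Ig l : I (g l).
  rewrite IE; exists (fun i => (i == l)%:R); rewrite (bigD1 l) //= eqxx mul1r.
  by rewrite big1 ?addr0 // => i /negPf ->; rewrite mul0r.
have {Ig}/choice[x /all_and2[Sx xg]] := Ig.
have S_sum (J : finType) (b : J -> R) (y : J -> M) :
    (forall j, S (y j)) -> S (\sum_j b j *: y j).
  move=> Sy; apply: (@big_ind M S) => // [y1 y2 S1 S2|j _].
    by rewrite -[y1]scale1r; apply: SP.
  by rewrite -[_ *: _]addr0; apply: SP.
have span_sum (b : 'I_t -> R) (y : 'I_t -> M) :
    (forall j, span (y j)) -> span (\sum_j b j *: y j).
  move=> Sy; apply: (@big_ind M span) => // [y1 y2 S1 S2|j _].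
    by rewrite -[y1]scale1r; apply: spanP.
  by rewrite -[_ *: _]addr0; apply: spanP.
have [||m [w [Sw w_span]]] := IHn (fun l => v (lift ord0 l))
    [set x | S x /\ span x]%classic.
- by split=> // b y z [Sy sy] [Sz sz]; split; [apply: SP | apply: spanP].
- by move=> y [].
exists (t + m)%N, (fun j => match split j with inl j => x j | inr j => w j end); split.
  by move=> j; case: (split j) => // i; case: (Sw i).
move=> y Sy; have [a yE] := v_span y Sy.
have : I (a ord0).
  exists y; split=> //; exists (fun l => a (lift ord0 l)).
  by rewrite yE big_ord_recl addrAC subrr add0r.
rewrite IE => -[b aE].
have [|c cE] := w_span (y - \sum_j b j *: x j).
  split; first by rewrite addrC -scaleN1r; apply: SP => //; apply: S_sum.
  have -> : y - \sum_j b j *: x j =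
      (-1) *: (\sum_j b j *: (x j - g j *: v ord0)) + (y - a ord0 *: v ord0).
    rewrite [in RHS](eq_bigr (fun j => b j *: x j - (b j * g j) *: v ord0)); last first.
      by move=> j _; rewrite scalerBr scalerA.
    rewrite sumrB -scaler_suml -aE scaleN1r opprB [RHS]addrC addrA subrK //.
  apply: spanP; first exact: span_sum.
  exists (fun l => a (lift ord0 l)).
  by rewrite yE big_ord_recl addrAC subrr add0r.
exists (fun j => match split j with inl j => b j | inr j => c j end).
rewrite big_split_ord /= (eq_bigr (fun j => b j *: x j)); last first.
  by move=> j _; rewrite (unsplitK (inl j : 'I_t + 'I_m)).
rewrite [s in _ + s](eq_bigr (fun j => c j *: w j)); last first.
  by move=> j _; rewrite (unsplitK (inr j : 'I_t + 'I_m)).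
by rewrite -cE addrC subrK.
Qed.

(** * Kernels over an algebra finite over $R$ *)

Section Restriction.
Context (B : pzRingType) (rho : R -> B).
Context (rho1 : rho 1 = 1) (rhoD : {morph rho : r s / r + s}).
Context (rhoM : {morph rho : r s / r * s}).

(** A copy of [M] that carries the module structure through [rho] without clashing with the one over
    [B]. *)
Definition restriction (M : lmodType B) : Type := M.

Section Scale.
Context (M : lmodType B).
HB.instance Definition _ := GRing.Zmodule.on (restriction M).
Definition restriction_scale (r : R) (x : restriction M) : restriction M :=
  rho r *: (x : M).
Lemma restriction_scaleA a b x :
  restriction_scale a (restriction_scale b x) = restriction_scale (a * b) x.
Proof. by rewrite /restriction_scale scalerA rhoM. Qed.
Lemma restriction_scale1 : left_id 1 restriction_scale.
Proof. by move=> x; rewrite /restriction_scale rho1 scale1r. Qed.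
Lemma restriction_scaleDr : right_distributive restriction_scale +%R.
Proof. by move=> a x y; rewrite /restriction_scale scalerDr. Qed.
Lemma restriction_scaleDl x : {morph restriction_scale^~ x : a b / a + b}.
Proof. by move=> a b; rewrite /restriction_scale rhoD scalerDl. Qed.
HB.instance Definition _ := GRing.Zmodule_isLmodule.Build R (restriction M)
  restriction_scaleA restriction_scale1 restriction_scaleDr restriction_scaleDl.
End Scale.

Context (rho_central : forall r b, rho r * b = b * rho r).
Context (B_fg : exists n (a : 'I_n -> B), forall b, exists r : 'I_n -> R,
  b = \sum_i rho (r i) * a i).

Lemma noetherian_kernel (M N : lmodType B) (f : {linear M -> N}) :
  finitely_generated M ->
  exists (n : nat) (z : 'I_n -> M), (forall l, f (z l) = 0) /\
    forall x, f x = 0 -> exists r : 'I_n -> R, x = \sum_l rho (r l) *: z l.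
Proof.
move=> [n [v v_span]]; have [m [a aP]] := B_fg.
have [p [w w_span]] : finitely_generated [the lmodType R of restriction M].
  apply: (@finitely_generated_fintype _ _ ('I_n * 'I_m)%type
    (fun lt => a lt.2 *: v lt.1 : restriction M)) => x.
  have [b ->] := v_span x.
  have /choice[r rE] := fun l => aP (b l).
  exists (fun lt => r lt.1 lt.2).
  rewrite -(pair_bigA _ (fun l t => r l t *: (a t *: v l : restriction M))) /=.
  apply: eq_bigr => l _; rewrite rE scaler_suml; apply: eq_bigr => t _.
  by rewrite -scalerA.
have [||q [z [z0 z_span]]] := @noetherian_submodule
  [the lmodType R of restriction M] p w [set x | f x = 0]%classic.
- split=> [|r x y /= fx fy]; first exact: linear0.
  by rewrite linearD fy addr0 -[LHS]/(f (rho r *: (x : M))) linearZ /= fx scaler0.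
- by move=> x _; apply: w_span.
by exists q, z; split.
Qed.

End Restriction.

(** Evaluation at [n] generators embeds $\mathrm{End}_R(F)$ into $F^n$, and submodules of the latter
    are finitely generated. *)
Lemma endo_finitely_generated (F : lmodType R) : finitely_generated F ->
  exists n (a : 'I_n -> endo F), forall b : endo F, exists r : 'I_n -> R,
    forall x, endo_fun b x = \sum_i r i *: endo_fun (a i) x.
Proof.
move=> [n [w w_span]].
pose E := [the lmodType R of {ffun 'I_n -> F}].
have [p [u u_span]] : finitely_generated E.
  apply: (@finitely_generated_fintype _ _ ('I_n * 'I_n)%type
    (fun ij => [ffun i => if i == ij.1 then w ij.2 else 0] : E)) => phi.
  have /choice[a aE] := fun i => w_span (phi i).
  exists (fun ij => a ij.1 ij.2); apply/ffunP => i.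
  rewrite sum_ffunE -(pair_bigA _ (fun i' j => (a i' j *: ([ffun i0 =>
    if i0 == i' then w j else 0] : E)) i)) /= (bigD1 i) //=.
  rewrite [s in _ + s]big1 ?addr0 => [|i' i'i]; last first.
    apply: big1 => j _; rewrite ffunE ffunE eq_sym (negPf i'i).
    exact: scaler0.
  by rewrite aE; apply: eq_bigr => j _; rewrite ffunE ffunE eqxx.
have [||q [z [z_endo z_span]]] := @noetherian_submodule E p u
  [set phi : E | exists f : endo F, forall i, phi i = endo_fun f (w i)]%classic.
- split=> [|r phi psi [f fE] [g gE]]; first by exists 0 => i; rewrite ffunE.
  exists [the {linear F -> F} of (r \*: endo_fun f) \+ endo_fun g] => i.
  by rewrite !ffunE fE gE.
- by move=> phi _; apply: u_span.
have /choice[a aE] := z_endo.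
exists q, a => b.
have [|r rE] := z_span [ffun i => endo_fun b (w i)]; first by exists b => i; rewrite ffunE.
exists r => x; have [c ->] := w_span x.
rewrite linear_sum /=.
have bw i : endo_fun b (w i) = \sum_j r j *: endo_fun (a j) (w i).
  have /ffunP/(_ i) := rE; rewrite ffunE sum_ffunE => ->.
  by apply: eq_bigr => j _; rewrite ffunE aE.
under eq_bigr => i _ do rewrite linearZ /= bw scaler_sumr.
rewrite exchange_big /=; apply: eq_bigr => j _.
rewrite linear_sum /= scaler_sumr; apply: eq_bigr => i _.
by rewrite [in RHS]linearZ /= !scalerA mulrC.
Qed.

End Noetherian.

Theorem proposition5p48 (k : closedFieldType) (R : comAlgType k) (m : set R)
    (R_local : local_ring m) (R_complete : adically_complete m)
    (R_gorenstein : gorenstein R) (R_residue : residue_field_is_base m)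
    (F' : lmodType R) (F'_fg : finitely_generated F')
    (A := [the algType k of endR F']) (e := endR_idem F' : A)
    (A_gldim : finite_global_dimension A)
    (A_AeA : finite_dim_quotient (two_sided_ideal e)) :
  Hom_finite (relative_singularity_category e).
Proof.
have [R_noeth _] := R_gorenstein.
pose F : lmodType R := [the lmodType R of (R^o * F')%type].
have R_fg : finitely_generated [the lmodType R of R^o].
  exists 1%N, (fun=> 1) => x; exists (fun=> x).
  by rewrite big_ord1 /GRing.scale /= mulr1.
pose B := [the algType k of A^c].
pose rho (r : R) : B := [the {linear F -> F} of r \*: (endo_fun (1 : endo F))].
have rho1 : rho 1 = 1 by apply: endo_ext => x; rewrite /= scale1r.
have rhoD : {morph rho : r s / r + s} by move=> r s; apply: endo_ext => x; rewrite /= scalerDl.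
have rhoM : {morph rho : r s / r * s}.
  by move=> r s; apply: endo_ext => x; rewrite /= scalerA mulrC.
have rhoC r b : rho r * b = b * rho r.
  by apply: endo_ext => x; rewrite /= linearZ.
have B_fg : exists n (a : 'I_n -> B), forall b, exists r : 'I_n -> R,
    b = \sum_i rho (r i) * a i.
  have [n [a aP]] := endo_finitely_generated R_noeth (prod_finitely_generated R_fg F'_fg).
  exists n, a => b; have [r rE] := aP b; exists r; apply: endo_ext => x.
  rewrite rE.
  have evD : {morph (fun f : B => endo_fun (f : endo F) x) : f g / f + g} by [].
  have ev0 : endo_fun ((0 : B) : endo F) x = 0 by [].
  rewrite (big_morph (fun f : B => endo_fun (f : endo F) x) evD ev0).
  by apply: eq_bigr => i _; rewrite rhoC.
pose eB : B := e.
have ker_fg (M N : lmodType B) (f : {linear M -> N}) : finitely_generated M ->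
    exists (n : nat) (z : 'I_n -> M), (forall l, f (z l) = 0) /\
      forall x, f x = 0 -> exists r : 'I_n -> B,
        (forall l, eB * r l = r l * eB) /\ x = \sum_l r l *: z l.
  move=> /(noetherian_kernel R_noeth rho1 rhoD rhoM B_fg f)[n [z [z0 z_span]]].
  exists n, z; split=> // x /z_span[r xE].
  by exists (fun l => rho (r l)); split=> // l; rewrite rhoC.
have kernel_fg (K M N : lmodType B) (i : {linear K -> M}) (f : {linear M -> N}) :
    is_kernel i f -> finitely_generated M -> finitely_generated K.
  move=> [i_inj iP] /(ker_fg M N f)[n [z [z0 z_span]]].
  have /choice[y yE] : forall l, exists y, z l = i y by move=> l; apply/iP.
  exists n, y => x; have [|r [_ xE]] := z_span (i x); first by apply/iP; exists x.
  exists r; apply: i_inj; rewrite xE linear_sum; apply: eq_bigr => l _.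
  by rewrite linearZ /= yE.
have e_idem : eB * eB = eB by apply: endR_idemE.
have eP : (e : A^c^o) \in right_ideal_pred e by apply/asboolP; exists 1; rewrite mulr1.
pose U : lmodType B := [the lmodType A^c of right_ideal e].
pose eps : U := RightIdeal eP.
have e_eps : eB *: eps = eps by apply: val_inj; apply: e_idem.
have U_gen (u : U) : exists b, u = b *: eps.
  have /asboolP[a uE] := valP (u : right_ideal e).
  by exists (a : A); apply: val_inj; rewrite /= uE.
have U_free (M : lmodType B) (x : M) : eB *: x = x -> exists f : {linear U -> M}, f eps = x.
  (* The map lets $u\in eA$ act on [x]; its value at [eps] is $ex=x$. *)
  move=> ex.
  have fL : linear (fun u : U => (right_ideal_val u : B) *: x).
    by move=> b u v; rewrite /= scalerDl -scalerA.
  by exists (lin fL).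
have quotient_fd : exists (n : nat) (a : 'I_n -> B), forall b : B,
    exists (c : 'I_n -> k) (q : nat) (x y : 'I_q -> B),
      b = \sum_t (c t)%:A * a t + \sum_i x i * eB * y i.
  have [n [v vP]] := A_AeA; exists n, v => b.
  (* [x] and [y] trade places because multiplication in [B] is that of [A] reversed. *)
  have [c [q [x [y bE]]]] := vP b; exists c, q, y, x.
  rewrite (eq_bigr (fun t => (c t *: (v t : A) : B))); last first.
    by move=> t _; apply: (etrans (@mulr_algl k B _ _)).
  rewrite [s in _ = _ + s](eq_bigr (fun i => (x i * e * y i : A) : B)); last first.
    by move=> i _; apply: (@mulrA A).
  by rewrite -[b in LHS](subrK (\sum_t (c t *: (v t : A) : B))) addrC; congr (_ + _).
exact: (quotient_Hom_finite (U_fg := right_ideal_fg e) e_idem e_eps U_gen U_free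
  ker_fg quotient_fd (every_resolvable kernel_fg A_gldim)).
Qed.
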